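(* Let $\rho$ and $\sigma$ be r.i. norms on $M_+(\mathbb{R}^n)$ determined, respectively, by the r.i. norms $\bar\rho$ and $\bar\sigma$ on $M_+(\mathbb{R}_+)$, that is, $\rho(f)=\bar\rho(f^* )$ and $\sigma(f)=\bar\sigma(f^* )$ for $f\in M_+(\mathbb{R}^n)$. Assume $L_{\bar\rho}(\mathbb{R}_+)$ is an interpolation space between $L_2(\mathbb{R}_+)$ and $L_\infty(\mathbb{R}_+)$ (so that, in particular, $\bar\rho(g^{**})\le C\bar\rho(g^* )$ for all $g\in M_+(\mathbb{R}_+)$, with some constant $C$). Then there is a constant $C>0$ with $$\rho(|\hat f|)\le C\,\sigma(f),\qquad f\in(L_\sigma\cap L_1)(\mathbb{R}^n),$$ if and only if there is a constant $C>0$ with $$\bar\rho(Ug)\le C\,\bar\sigma(g),\qquad 0\le g\in L_{\bar\sigma}(\mathbb{R}_+).$$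
   Context: $\mathbb{R}_+=(0,\infty)$; $\Omega$ denotes $\mathbb{R}^n$ or $\mathbb{R}_+$ with Lebesgue measure $|\cdot|$. $M(\Omega)$ is the class of measurable functions on $\Omega$ and $M_+(\Omega)$ the nonnegative ones. For $f\in M(\Omega)$, $\mu_f(\lambda)=|\{x\in\Omega:|f(x)|>\lambda\}|$, $f^*$ is the nonincreasing rearrangement $f^*(t)=\inf\{\lambda\ge 0:\mu_f(\lambda)\le t\}$, $t\in\mathbb{R}_+$, and $f^{**}(t)=t^{-1}\int_0^t f^*$. An r.i. (rearrangement-invariant) norm on $M_+(\Omega)$ is a functional $\rho:M_+(\Omega)\to[0,\infty]$ such that: $\rho(f)=0$ iff $f=0$ a.e.; $\rho(cf)=c\rho(f)$ for $c>0$; $\rho(f+g)\le\rho(f)+\rho(g)$; $0\le f_n\uparrow f$ implies $\rho(f_n)\uparrow\rho(f)$; $\rho(\chi_E)<\infty$ whenever $|E|<\infty$; $\int_E f\le C_E\,\rho(f)$ whenever $|E|<\infty$, with $C_E$ independent of $f$; $\rho(f)=\rho(g)$ whenever $\mu_f=\mu_g$. One writes $\rho(f)$ for $\rho(|f|)$ when $f\in M(\Omega)$, and $L_\rho(\Omega)=\{f\in M(\Omega):\rho(|f|)<\infty\}$, a Banach space with norm $\rho(|f|)$. A Banach space $Y$ is an interpolation space between compatible Banach spaces $X_1,X_2$ if $X_1\cap X_2\hookrightarrow Y\hookrightarrow X_1+X_2$ continuously and every linear operator $T$ on $X_1+X_2$ that maps $X_i$ boundedly into $X_i$, $i=1,2$,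 maps $Y$ boundedly into $Y$. The Fourier transform is $\hat f(\xi)=\int_{\mathbb{R}^n}f(x)e^{-2\pi i\xi\cdot x}\,dx$ for $f\in L_1(\mathbb{R}^n)$. The operator $U$ is $(Uh)(s)=\int_0^{1/s}h$, $h\in M_+(\mathbb{R}_+)$, $s\in\mathbb{R}_+$. *)

(* Defs.v *)
From HB Require Import structures.
From mathcomp Require Export all_boot all_order all_algebra.
From mathcomp Require Export all_classical all_reals all_analysis.
From mathcomp Require Export measurable_realfun ess_sup_inf.
From mathcomp Require Export complex.
Export Order.TTheory GRing.Theory Num.Theory.
Export numFieldNormedType.Exports.

#[export] Set Implicit Arguments.
#[export] Unset Strict Implicit.
#[export] Unset Printing Implicit Defensive.

Local Open Scope classical_set_scope.
Local Open Scope ring_scope.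

(* A domain Omega is given by a measure [mu] on [T] and a set [D] of [T]; the
   functions on Omega are the functions on [T], of which only the restriction
   to [D] matters. In [Mplus] and [cmeasurable] the measure serves only to fix
   the sigma-algebra. *)
Definition Mplus d (T : measurableType d) (R : realType)
    (mu : {measure set T -> \bar R}) (D : set T) (f : T -> \bar R) : Prop :=
  measurable_fun D f /\ forall x, D x -> (0 <= f x)%E.

Definition cmeasurable d (T : measurableType d) (R : realType)
    (mu : {measure set T -> \bar R}) (D : set T) (f : T -> R[i]) : Prop :=
  measurable_fun D (fun x => complex.Re (f x)) /\
  measurable_fun D (fun x => complex.Im (f x)).

Section function_spaces.
Context d (T : measurableType d) (R : realType).
Variables (mu : {measure set T -> \bar R}) (D : set T).
Local Open Scope ereal_scope.
Local Notation Mplus := (Mplus mu D).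
Local Notation cmeasurable := (cmeasurable mu D).

Definition distribution_function (f : T -> \bar R) (l : R) : \bar R :=
  mu (D `&` [set x | l%:E < `|f x|]).

Definition rearrangement (f : T -> \bar R) (t : R) : \bar R :=
  ereal_inf [set l%:E | l in
    [set l : R | (0 <= l)%R /\ distribution_function f l <= t%:E]].

(* A norm is a total function; its values outside [Mplus] are irrelevant. *)
Record ri_norm (rho : (T -> \bar R) -> \bar R) : Prop := {
  ri_norm_ge0 : forall f, Mplus f -> 0 <= rho f ;
  ri_norm_eq0 : forall f, Mplus f ->
    (rho f = 0 <-> {ae mu, forall x, D x -> f x = 0}) ;
  ri_normZ : forall (c : R) f, (0 < c)%R -> Mplus f ->
    rho (fun x => c%:E * f x) = c%:E * rho f ;
  ri_normD : forall f g, Mplus f -> Mplus g ->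
    rho (fun x => f x + g x) <= rho f + rho g ;
  ri_norm_fatou : forall (F : nat -> T -> \bar R) f,
    (forall k, Mplus (F k)) -> Mplus f ->
    (forall x, D x -> nondecreasing_seq (F ^~ x)) ->
    (forall x, D x -> F k x @[k --> \oo] --> f x) ->
    nondecreasing_seq (fun k => rho (F k)) /\
    rho (F k) @[k --> \oo] --> rho f ;
  ri_norm_indic : forall E, measurable E -> E `<=` D -> mu E < +oo ->
    rho (fun x => (\1_E x)%:E) < +oo ;
  ri_norm_integral : forall E, measurable E -> E `<=` D -> mu E < +oo ->
    exists2 C : R, (0 < C)%R &
      forall f, Mplus f -> \int[mu]_(x in E) f x <= C%:E * rho f ;
  ri_norm_equimeasurable : forall f g, Mplus f -> Mplus g ->
    (forall l, (0 <= l)%R ->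
      distribution_function f l = distribution_function g l) ->
    rho f = rho g }.

Definition modulus (f : T -> R[i]) (x : T) : \bar R := (Normc.normc (f x))%:E.

Definition Lspace_of (rho : (T -> \bar R) -> \bar R) (f : T -> R[i]) : Prop :=
  cmeasurable f /\ rho (modulus f) < +oo.

Definition Lp_norm (p : \bar R) (f : T -> \bar R) : \bar R :=
  Lnorm mu p (f \_ D).

Definition cintegral (f : T -> R[i]) : R[i] :=
  Complex (\int[mu]_(x in D) complex.Re (f x))%R
          (\int[mu]_(x in D) complex.Im (f x))%R.

Section interpolation.
Variables rho1 rho2 : (T -> \bar R) -> \bar R.

Definition decomposition (f f1 f2 : T -> R[i]) : Prop :=
  [/\ Lspace_of rho1 f1, Lspace_of rho2 f2 &
      ae_eq mu D f (fun x => f1 x + f2 x)%R].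

Definition sum_space (f : T -> R[i]) : Prop :=
  cmeasurable f /\ exists f1 f2, decomposition f f1 f2.

Definition sum_norm (f : T -> R[i]) : \bar R :=
  ereal_inf [set rho1 (modulus g.1) + rho2 (modulus g.2) |
              g in [set g | decomposition f g.1 g.2]].

Definition inter_norm (f : T -> R[i]) : \bar R :=
  maxe (rho1 (modulus f)) (rho2 (modulus f)).

(* Elements of the spaces are classes of functions equal almost everywhere:
   an operator acts on representatives and respects that equality. *)
Record linear_on_sum (A : (T -> R[i]) -> T -> R[i]) : Prop := {
  sum_stable : forall f, sum_space f -> sum_space (A f) ;
  sum_ae_eq : forall f g, sum_space f -> sum_space g ->
    ae_eq mu D f g -> ae_eq mu D (A f) (A g) ;
  sum_linear : forall (a : R[i]) f g, sum_space f -> sum_space g ->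
    ae_eq mu D (A (fun x => a * f x + g x)%R)
               (fun x => a * A f x + A g x)%R }.

Definition bounded_on (rho : (T -> \bar R) -> \bar R)
    (A : (T -> R[i]) -> T -> R[i]) : Prop :=
  exists2 C : R, (0 < C)%R & forall f, Lspace_of rho f ->
    Lspace_of rho (A f) /\ rho (modulus (A f)) <= C%:E * rho (modulus f).

Record interpolation_space (rho : (T -> \bar R) -> \bar R) : Prop := {
  inter_embedding : exists2 C : R, (0 < C)%R &
    forall f, Lspace_of rho1 f -> Lspace_of rho2 f ->
      Lspace_of rho f /\ rho (modulus f) <= C%:E * inter_norm f ;
  sum_embedding : exists2 C : R, (0 < C)%R &
    forall f, Lspace_of rho f ->
      sum_space f /\ sum_norm f <= C%:E * rho (modulus f) ;
  interpolation_property : forall A, linear_on_sum A ->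
    bounded_on rho1 A -> bounded_on rho2 A -> bounded_on rho A }.

End interpolation.
End function_spaces.

Section euclidean_lebesgue_measure.
Context {R : realType}.
Local Open Scope ereal_scope.

Definition tuple_cons n (x : measurableTypeR R * n.-tuple (measurableTypeR R)) :
  n.+1.-tuple (measurableTypeR R) := [tuple of x.1 :: x.2].

Lemma measurable_tuple_cons n : measurable_fun setT (@tuple_cons n).
Proof. exact: measurable_cons. Qed.

Section succ.
Variables (n : nat).
Variable m : {sigma_finite_measure set n.-tuple (measurableTypeR R) -> \bar R}.

Definition lebesgue_succ : set (n.+1.-tuple (measurableTypeR R)) -> \bar R :=
  pushforward (lebesgue_measure \x m) (@tuple_cons n).

Let lebesgue_succ0 : lebesgue_succ set0 = 0.
Proof. by rewrite /lebesgue_succ /pushforward preimage_set0 measure0. Qed.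

Let lebesgue_succ_ge0 A : 0 <= lebesgue_succ A.
Proof. by rewrite /lebesgue_succ /pushforward measure_ge0. Qed.

Let measurable_preimage_cons A :
  measurable A -> measurable (@tuple_cons n @^-1` A).
Proof.
by move=> mA; rewrite -[X in measurable X]setTI; exact: measurable_tuple_cons.
Qed.

Let lebesgue_succ_sigma_additive : semi_sigma_additive lebesgue_succ.
Proof.
move=> F mF tF mUF; rewrite /lebesgue_succ /pushforward preimage_bigcup.
apply: measure_semi_sigma_additive.
- by move=> k; exact: measurable_preimage_cons.
- apply/trivIsetP => /= i j _ _ ij; rewrite -preimage_setI.
  by move/trivIsetP : tF => /(_ _ _ _ _ ij) ->//; rewrite preimage_set0.
- by rewrite -preimage_bigcup; exact: measurable_preimage_cons.
Qed.

HB.instance Definition _ := isMeasure.Build _ _ _ lebesgue_succ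
  lebesgue_succ0 lebesgue_succ_ge0 lebesgue_succ_sigma_additive.

Let lebesgue_succ_sigma_finite : sigma_finite setT lebesgue_succ.
Proof.
have /sigma_finiteP[F [TF ndF Foo]] := sigma_finiteT (@lebesgue_measure R).
have /sigma_finiteP[G [TG ndG Goo]] := sigma_finiteT m.
pose uncons (y : n.+1.-tuple (measurableTypeR R)) :
  measurableTypeR R * n.-tuple (measurableTypeR R) :=
  (thead y, [tuple of behead y]).
have consK : cancel (@tuple_cons n) uncons.
  by move=> [x y]; congr pair; apply/val_inj.
have munc : measurable_fun setT uncons.
  apply/measurable_fun_pair; first exact: measurable_tnth.
  exact: measurable_behead.
exists (fun k => uncons @^-1` (F k `*` G k)).
  rewrite -preimage_bigcup; apply/esym; rewrite -subTset => y _ /=.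
  have [a _ Fa] : (\bigcup_k F k) (uncons y).1 by rewrite -TF.
  have [b _ Gb] : (\bigcup_k G k) (uncons y).2 by rewrite -TG.
  exists (maxn a b) => //; split.
  - by move: Fa; exact/subsetPset/ndF/leq_maxl.
  - by move: Gb; exact/subsetPset/ndG/leq_maxr.
move=> k; have [mFk Fkoo] := Foo k; have [mGk Gkoo] := Goo k; split.
  by rewrite -[X in measurable X]setTI; apply: munc => //; exact: measurableX.
rewrite /lebesgue_succ /pushforward -comp_preimage.
rewrite (_ : uncons \o _ = id); last by apply/funext => x /=; exact: consK.
by rewrite preimage_id product_measure1E// lte_mul_pinfty// ge0_fin_numE.
Qed.

HB.instance Definition _ := Measure_isSigmaFinite.Build _ _ _ lebesgue_succ
  lebesgue_succ_sigma_finite.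

End succ.

(* Product of [n] copies of the one-dimensional Lebesgue measure, on the Borel
   sets. *)
Fixpoint borel_lebesgue (n : nat) :
    {sigma_finite_measure set n.-tuple (measurableTypeR R) -> \bar R} :=
  if n is n'.+1 then lebesgue_succ (borel_lebesgue n')
  else \d_([tuple] : 0.-tuple (measurableTypeR R)).

(* Completion of [borel_lebesgue]: the measurable sets are the Lebesgue
   measurable sets of R^n. *)
Definition lebesgue_tuple (n : nat) :=
  @completed_measure_extension _ _ _ (borel_lebesgue n).
HB.instance Definition _ n := Measure.on (@lebesgue_tuple n).

End euclidean_lebesgue_measure.
Arguments lebesgue_tuple R n : clear implicits.

Section operators.
Context {R : realType}.

Definition Rplus : set R := `]0%R, +oo[.

Definition expi (t : R) : R[i] := Complex (cos t) (sin t).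

Definition dot n (x y : n.-tuple R) : R := \sum_(i < n) tnth x i * tnth y i.

Definition fourier n (f : n.-tuple R -> R[i]) (xi : n.-tuple R) : R[i] :=
  cintegral (lebesgue_tuple R n) setT
    (fun x => f x * expi (- (2 * pi * dot xi x))).

Definition Uop (h : R -> \bar R) (s : R) : \bar R :=
  (\int[completed_lebesgue_measure]_(x in [set x | (0 < x < s^-1)%R]) h x)%E.

End operators.

(* Main.v *)
From HB Require Import structures.
Require Import Defs.
From mathcomp Require Import ring lra zify.
Local Open Scope classical_set_scope.
Local Open Scope ring_scope.
Local Open Scope ereal_scope.

(** Interpolation between L_2 and L_oo makes [rhobar] monotone for the
    K-functional: there is C such that rhobar F <= C rhobar G whenever F and G
    are nonincreasing and int_0^t F^2 <= int_0^t G^2 for all t. Otherwise,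
    suitably scaled counterexamples (F_i, G_i) are glued into a single G, the
    sum of the G_i, and an operator that averages against G over disjoint
    blocks, bounded on L_2 and on L_oo, maps G to a majorant of every F_i.

    If the inequality for U holds, cut f at the height f*(1/t); the trivial
    L_1 -> L_oo bound on the large part and Bessel's inequality on the small
    part give int_0^t ((hat f)^* )^2 <= C int_0^t (U f^* )^2, to which
    K-monotonicity applies.

    Conversely, let g = c sum_j 1_{E_j} with nested E_j. Replace E_j by a
    tensor product of triangles supported in a cube of volume |E_j|. Such a
    product has a nonnegative Fourier transform, comparable to |E_j| on the
    dual cube, so hat f dominates a function equimeasurable with
    k = c sum_j |E_j| 1_(0, a/|E_j|). Moreover U g <= sum_m 4^-m k(a 4^-(m+1) .),
    where by K-monotonicity the dilation by theta costs at most theta^(-1/2). *)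

(** * Rearrangement-invariant norms and rearrangements *)

(** The interpolation property bounds each operator with a constant of its own; nothing in it is
    uniform. A constant that serves all pairs (F, G) is obtained by a gliding hump: a failure of
    uniformity is concentrated in one operator. Both directions then use the hypothesis on [rhobar]
    only in the form of K-monotonicity, that is, through comparisons of int_0^t F^2.

    Plancherel's identity is replaced by an inequality with a constant depending on the dimension,
    proved on L_1 by Schur's test; no density argument and no inversion formula enter. Fubini's
    theorem is applied to Borel representatives, since the measurable functions on R^n are those of
    the completed measure.

    The shape of the test functions is dictated by sign: the transform of the indicator of a cube
    oscillates, so that the layers could cancel, while the transform of a triangle is a Fejer
    kernel. In the series for U g the weight 4^-m meets a dilation cost of order 2^m; convergence
    rests on the exponent 1/2 being less than 1, which is where L_2 as an endpoint matters. *)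

Section ri_norm_theory.
Context d (T : measurableType d) (R : realType).
Variables (mu : {measure set T -> \bar R}) (D : set T) (mD : measurable D).
Variable rho : (T -> \bar R) -> \bar R.
Hypothesis rho_ri : ri_norm mu D rho.
Local Notation Mplus := (Mplus mu D).

Lemma Mplus_cst (c : \bar R) : 0 <= c -> Mplus (fun=> c).
Proof. by move=> c0; split=> //; exact: measurable_cst. Qed.

Lemma MplusZ (c : R) f : (0 <= c)%R -> Mplus f -> Mplus (fun x => c%:E * f x).
Proof.
move=> c0 [mf f0]; split; first exact: measurable_funeM.
by move=> x Dx; rewrite mule_ge0 ?f0 ?lee_fin.
Qed.

Lemma Mplus_sum (I : Type) (s : seq I) (F : I -> T -> \bar R) :
  (forall i, Mplus (F i)) -> Mplus (fun x => \sum_(i <- s) F i x).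
Proof.
move=> MF; split; first by apply: emeasurable_sum => i; apply (MF i).
by move=> x Dx; apply: sume_ge0 => i _; apply (MF i).
Qed.

(** Monotonicity is not among the axioms; the Fatou property applied to the sequence f, g, g, ...
    yields it. *)
Lemma ri_norm_le f g : Mplus f -> Mplus g ->
  (forall x, D x -> f x <= g x) -> rho f <= rho g.
Proof.
move=> Mf Mg fg.
pose F k : T -> \bar R := if k is 0%N then f else g.
have [||||ndF _] := ri_norm_fatou rho_ri (F := F) (f := g).
- by case.
- by [].
- by move=> x Dx [|m] [|k] //= _; rewrite /F //= fg.
- move=> x Dx; apply: cvg_near_cst; exists 1%N => // -[|k] //.
- exact: (ndF 0%N 1%N).
Qed.

Lemma ri_norm_ext f g : Mplus f -> Mplus g ->
  (forall x, D x -> f x = g x) -> rho f = rho g.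
Proof.
move=> Mf Mg fg; apply/eqP; rewrite eq_le.
by rewrite !ri_norm_le// => x Dx; rewrite fg.
Qed.

Lemma ri_norm0 : rho (fun=> 0) = 0.
Proof.
apply/(ri_norm_eq0 rho_ri); first exact: Mplus_cst.
by exists set0; split=> // x /=; apply: contra_notP => _ _.
Qed.

Lemma ri_normZ_ge0 (c : R) f : (0 <= c)%R -> Mplus f ->
  rho (fun x => c%:E * f x) = c%:E * rho f.
Proof.
rewrite le_eqVlt => /predU1P[<- Mf|c0]; last exact: ri_normZ.
rewrite mul0e -[RHS]ri_norm0; apply: ri_norm_ext.
- exact: MplusZ.
- exact: Mplus_cst.
- by move=> x _; rewrite mul0e.
Qed.

Lemma ri_norm_sum (F : nat -> T -> \bar R) m : (forall i, Mplus (F i)) ->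
  rho (fun x => \sum_(0 <= i < m) F i x) <= \sum_(0 <= i < m) rho (F i).
Proof.
move=> MF; elim: m => [|m IH].
  rewrite big_geq// (_ : (fun=> _) = fun=> 0) ?ri_norm0//.
  by apply/funext => x; rewrite big_geq.
rewrite big_nat_recr//= (_ : (fun=> _) =
  fun x => \sum_(0 <= i < m) F i x + F m x); last first.
  by apply/funext => x; rewrite big_nat_recr.
apply: le_trans (leeD2r _ IH).
by apply: (ri_normD rho_ri) => //; exact: Mplus_sum.
Qed.

(** The Fatou property along the partial sums extends subadditivity to countably many terms. *)
Lemma ri_norm_nneseries (F : nat -> T -> \bar R) : (forall i, Mplus (F i)) ->
  rho (fun x => \sum_(0 <= i <oo) F i x) <= \sum_(0 <= i <oo) rho (F i).
Proof.
move=> MF.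
have F0 x i : D x -> 0 <= F i x by move=> Dx; case: (MF i) => _; exact.
have Fr i : 0 <= rho (F i) by exact: (ri_norm_ge0 rho_ri).
have MS : Mplus (fun x => \sum_(0 <= i <oo) F i x).
  split; last by move=> x Dx; apply: nneseries_ge0 => i _ _; exact: F0.
  apply: (ge0_emeasurable_sum (P := xpredT)) => //.
  - by move=> k x Dx _; exact: F0.
  - by move=> k _; case: (MF k).
have [||||_ cvS] := ri_norm_fatou rho_ri
  (F := fun m x => \sum_(0 <= i < m) F i x)
  (f := fun x => \sum_(0 <= i <oo) F i x) => //.
- by move=> k; exact: Mplus_sum.
- move=> x Dx m k mk; apply: lee_sum_nneg_natr => // i _ _; exact: F0.
- by move=> x Dx; apply: is_cvg_nneseries => i _ _; exact: F0.
have := cvg_lim (@ereal_hausdorff R) cvS => <-.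
apply: lee_lim.
- by apply/cvg_ex; eexists; exact: cvS.
- exact: is_cvg_nneseries.
- by apply: nearW => m; exact: ri_norm_sum.
Qed.

End ri_norm_theory.

(** * Dyadic staircase approximation from below *)

Section staircase.
Context {R : realType}.

(** Counts the thresholds (j+1)/2^m, up to height m, that lie strictly below v. Applied to a
    function, it gives a sum of indicators of nested superlevel sets with a common coefficient, the
    form in which the necessity part tests the inequality. *)
Definition staircase (m : nat) (v : \bar R) : R :=
  (\sum_(0 <= j < m * 2 ^ m)
    2 ^- m * (((j.+1%:R / 2 ^+ m)%:E < v)%E)%:R)%R.

Lemma staircase_ge0 m v : (0 <= staircase m v)%R.
Proof. by apply: sumr_ge0 => j _; rewrite mulr_ge0// invr_ge0 exprn_ge0. Qed.

Lemma staircaseS m v : (staircase m v <= staircase m.+1 v)%R.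
Proof.
rewrite /staircase; set a := fun t : R => ((t%:E < v)%E)%:R : R.
have a0 t : (0 <= a t)%R by rewrite ler0n.
have da s t : (s <= t)%R -> (a t <= a s)%R.
  move=> st; rewrite /a ler_nat; case: (ltP t%:E) => // tv.
  by rewrite (le_lt_trans _ tv)// lee_fin.
(* The threshold (N+1)/2^m equals (2N+2)/2^(m+1); on refinement it is kept and joined by the lower
   threshold (2N+1)/2^(m+1), both with half the weight. *)
have H N : (\sum_(0 <= j < N) 2 ^- m * a (j.+1%:R / 2 ^+ m) <=
    \sum_(0 <= j < N.*2) 2 ^- m.+1 * a (j.+1%:R / 2 ^+ m.+1))%R.
  elim: N => [|N IH]; first by rewrite !big_geq.
  rewrite doubleS !big_nat_recr//= -addrA lerD//.
  have -> : (N.+1%:R / 2 ^+ m = N.*2.+2%:R / 2 ^+ m.+1 :> R)%R.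
    by rewrite -doubleS -muln2 natrM exprS; field; rewrite expf_neq0.
  have -> : (2 ^- m = 2 ^- m.+1 + 2 ^- m.+1 :> R)%R.
    by rewrite exprS; field; rewrite expf_neq0.
  rewrite mulrDl lerD// ler_wpM2l ?invr_ge0 ?exprn_ge0//.
  by apply: da; rewrite ler_wpM2r ?invr_ge0 ?exprn_ge0// ler_nat.
apply: (le_trans (H _)).
have le_n : ((m * 2 ^ m).*2 <= m.+1 * 2 ^ m.+1)%N.
  by rewrite -muln2 expnS -mulnA leq_mul// mulnC.
rewrite [leRHS](big_cat_nat (leq0n _) le_n)//= lerDl.
by apply: sumr_ge0 => j _; rewrite mulr_ge0// invr_ge0 exprn_ge0.
Qed.

Lemma staircase_homo v : {homo staircase ^~ v : m k / (m <= k)%N >-> (m <= k)%R}.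
Proof. by apply/nondecreasing_seqP => m; exact: staircaseS. Qed.

(** For finite v, the sum over N steps of height e lies between min(v - e, N e) and min(v, N e);
    here e = 2^-m and N e = m. For v = +oo every threshold counts and the sum is m. *)
Lemma cvg_staircase v : 0 <= v -> (staircase m v)%:E @[m --> \oo] --> v.
Proof.
case: v => [r|_|//]; last first.
  rewrite (_ : (fun m => _) = (fun m : nat => (m%:R : R)%:E)); last first.
    apply/funext => m; congr EFin; rewrite /staircase.
    under eq_bigr do rewrite ltry mulr1.
    rewrite big_const_nat iter_addr_0 subn0 -[LHS]mulr_natr natrM natrX.
    by rewrite mulrCA mulVf ?mulr1// expf_neq0.
  by apply/cvgeryP; exact: cvgr_idn.
rewrite lee_fin => r0; apply: cvg_EFin; first exact: nearW.
have up (e : R) N : (0 < e)%R ->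
    (\sum_(0 <= j < N) e * (((j.+1%:R * e)%:E < r%:E)%E)%:R <= Num.min r (N%:R * e))%R.
  move=> e0; elim: N => [|N IH]; first by rewrite big_geq// mul0r le_min r0 lexx.
  rewrite big_nat_recr//= lte_fin; move: IH; rewrite !le_min => /andP[IH1 IH2].
  case: ltP => h; rewrite ?mulr1 ?mulr0 ?addr0.
    have H: (\sum_(0 <= j < N) e * (((j.+1%:R * e)%:E < r%:E)%E)%:R + e <= N.+1%:R * e)%R.
      by rewrite -natr1 mulrDl mul1r lerD.
    by rewrite H (le_trans H) ?ltW.
  by rewrite IH1 (le_trans IH2)// ler_wpM2r ?ler_nat ?ltW.
have lo (e : R) N : (0 < e)%R -> (Num.min (r - e) (N%:R * e) <=
    \sum_(0 <= j < N) e * (((j.+1%:R * e)%:E < r%:E)%E)%:R)%R.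
  move=> e0; elim: N => [|N IH]; first by rewrite big_geq// mul0r ge_min lexx orbT.
  rewrite big_nat_recr//= lte_fin.
  case: ltP => h; rewrite ?mulr1 ?mulr0 ?addr0.
    rewrite ge_min -natr1 mulrDl mul1r lerD2r; apply/orP; right.
    apply: le_trans IH; rewrite le_min lexx andbT lerBrDr.
    by rewrite -{2}(mul1r e) -mulrDl natr1 ltW.
  apply: le_trans IH; rewrite le_min !ge_min lexx/=.
  by rewrite lerBlDr -{2}(mul1r e) -mulrDl natr1 h.
apply: (@squeeze_cvgr _ _ _ _ (fun m => r - 2 ^- m)%R (fun=> r)).
- near=> m; rewrite /= /staircase; apply/andP; split.
    apply: le_trans (lo (2 ^- m)%R (m * 2 ^ m)%N _); last by rewrite invr_gt0 exprn_gt0.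
    rewrite le_min lexx/= natrM natrX mulfK ?expf_neq0//.
    rewrite (@le_trans _ _ r)//; first by rewrite gerBl invr_ge0 exprn_ge0.
    by near: m; exact: nbhs_infty_ger.
  apply: (le_trans (up (2 ^- m)%R (m * 2 ^ m)%N _)); first by rewrite invr_gt0 exprn_gt0.
  by rewrite ge_min lexx.
- rewrite -[X in _ --> X]subr0; apply: cvgB; first exact: cvg_cst.
  under eq_fun do rewrite -exprVn; apply: cvg_expr.
  by rewrite ger0_norm ?invr_ge0// invf_lt1// ltr1n.
- exact: cvg_cst.
Unshelve. all: by end_near. Qed.

End staircase.

(** * Distribution functions and rearrangements *)

Section rearrangement_theory.
Context d (T : measurableType d) (R : realType).
Variables (mu : {measure set T -> \bar R}) (D : set T) (mD : measurable D).
Local Notation Mplus := (Mplus mu D).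
Local Notation distr := (distribution_function mu D).
Implicit Types f g : T -> \bar R.

Lemma distribution_functionE f (l : R) : Mplus f ->
  distr f l = mu (D `&` [set x | l%:E < f x]).
Proof.
move=> [_ f0]; rewrite /distribution_function; congr (mu _).
by apply/seteqP; split=> x [Dx] /=; rewrite gee0_abs ?f0.
Qed.

Lemma measurable_superlevel f (l : \bar R) : Mplus f ->
  measurable (D `&` [set x | l < f x]).
Proof. by move=> [mf _]; exact: emeasurable_fun_o_infty. Qed.

Lemma distribution_function_ninc f (l l' : R) : Mplus f -> (l <= l')%R ->
  distr f l' <= distr f l.
Proof.
move=> Mf ll'; rewrite !distribution_functionE//.
apply: le_measure; rewrite ?inE; try exact: measurable_superlevel.
by move=> x [Dx] /= lf; split=> //=; rewrite (le_lt_trans _ lf)// lee_fin.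
Qed.

(** Right-continuity of the distribution function: the superlevel set at l is the increasing union
    of those at l + 1/(k+1), and the measure is continuous from below. *)
Lemma distribution_function_right f (l : R) (t : \bar R) : Mplus f ->
  t < distr f l -> exists2 l', (l < l')%R & t < distr f l'.
Proof.
move=> Mf; rewrite distribution_functionE//.
pose E k := D `&` [set x | (l + k.+1%:R^-1)%:E < f x].
have EE : D `&` [set x | l%:E < f x] = \bigcup_k E k.
  apply/seteqP; split=> x.
    move=> [Dx] /=; case fxE: (f x) => [r||] //.
    - rewrite lte_fin => lr; have [k kr] := ltr_add_invr lr.
      by exists k => //; split=> //=; rewrite fxE lte_fin.
    - by exists 0%N => //; split=> //=; rewrite fxE ltry.
  move=> [k _ [Dx]] /= lf; split=> //=; apply: lt_trans lf.
  by rewrite lte_fin ltrDl invr_gt0.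
have mE k : measurable (E k) by exact: measurable_superlevel.
have ndE : {homo E : n m / (n <= m)%N >-> (n <= m)%O}.
  move=> n m nm; apply/subsetPset => x [Dx] /= lf; split=> //=.
  apply: le_lt_trans lf; rewrite lee_fin lerD2l lef_pV2 ?posrE//.
  by rewrite ler_nat.
have := nondecreasing_cvg_mu (mu := mu) mE (bigcupT_measurable _ mE) ndE.
rewrite EE => cv lt; have [k tk] : exists k, t < mu (E k).
  apply: contrapT => /forallNP ht.
  suff : mu (\bigcup_k E k) <= t by rewrite leNgt lt.
  rewrite -(cvg_lim (@ereal_hausdorff R) cv); apply: lime_le.
    by apply/cvg_ex; eexists; exact: cv.
  by apply: nearW => k; rewrite leNgt; apply/negP; exact: ht.
exists (l + k.+1%:R^-1)%R; first by rewrite ltrDl invr_gt0.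
by rewrite distribution_functionE.
Qed.

Lemma rearrangement_ge0 f t : 0 <= rearrangement mu D f t.
Proof.
by apply: le_ereal_inf_tmp => _ [l [l0 _] <-]; rewrite lee_fin.
Qed.

Lemma rearrangement_ninc f : {homo rearrangement mu D f : s t / (s <= t)%R >-> t <= s}.
Proof.
move=> s t st; apply: ereal_inf_le_tmp => _ [l [l0 dl] <-]; exists l => //.
by split=> //; rewrite (le_trans dl)// lee_fin.
Qed.

Lemma rearrangement_le f (l t : R) : (0 <= l)%R -> distr f l <= t%:E ->
  rearrangement mu D f t <= l%:E.
Proof. by move=> l0 lt; apply: ereal_inf_lbound; exists l. Qed.

(** By right-continuity the infimum defining the rearrangement is not lost in the limit, so strict
    inequalities transfer exactly. It follows that the superlevel sets of the rearrangement are
    initial intervals of known length. *)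
Lemma lt_rearrangement f (l t : R) : Mplus f -> (0 <= l)%R ->
  (l%:E < rearrangement mu D f t) = (t%:E < distr f l).
Proof.
move=> Mf l0; apply/idP/idP.
  by apply: contraTT; rewrite -!leNgt; exact: rearrangement_le.
move=> /(distribution_function_right Mf)[l' ll' tl'].
apply: (@lt_le_trans _ _ l'%:E); first by rewrite lte_fin.
apply: le_ereal_inf_tmp => _ [r [r0 dr] <-]; rewrite lee_fin leNgt; apply/negP => rl'.
have := le_lt_trans dr tl'; rewrite ltNge distribution_function_ninc//.
exact: ltW.
Qed.

Lemma rearrangement_fin_num f (t : R) : (exists l, distr f l <= t%:E) ->
  Mplus f -> rearrangement mu D f t \is a fin_num.
Proof.
move=> [l lt] Mf; rewrite ge0_fin_numE ?rearrangement_ge0//.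
rewrite (@le_lt_trans _ _ (Num.max l 0)%:E) ?ltry//; apply: rearrangement_le.
  by rewrite le_max lexx orbT.
by apply: le_trans lt; apply: distribution_function_ninc => //; rewrite le_max lexx.
Qed.

(** Expresses the integral through the distribution function alone, so that integrals over different
    measure spaces can be compared. Monotone convergence along [staircase]. *)
Lemma ge0_integral_staircase f : Mplus f ->
  \int[mu]_(x in D) f x =
  limn (fun m => \sum_(0 <= j < m * 2 ^ m)
    (2 ^- m)%:E * distr f (j.+1%:R / 2 ^+ m)).
Proof.
move=> Mf; have [mf f0] := Mf.
pose F m x := (staircase m (f x))%:E.
pose E m j := D `&` [set x | (j.+1%:R / 2 ^+ m)%:E < f x].
have mE m j : measurable (E m j) by exact: measurable_superlevel.
have FE m x : D x -> F m x =
    \sum_(0 <= j < m * 2 ^ m) (2 ^- m)%:E * (\1_(E m j) x)%:E.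
  move=> Dx; rewrite /F /staircase sumEFin; congr EFin; apply: eq_bigr => j _.
  rewrite indicE; congr (_ * (nat_of_bool _)%:R)%R.
  by apply/idP/idP => [h|]; rewrite inE /E //= => -[].
have intF m : \int[mu]_(x in D) F m x =
    \sum_(0 <= j < m * 2 ^ m) (2 ^- m)%:E * distr f (j.+1%:R / 2 ^+ m).
  rewrite (eq_integral (fun x =>
    \sum_(0 <= j < m * 2 ^ m) (2 ^- m)%:E * (\1_(E m j) x)%:E)); last first.
    by move=> x; rewrite inE => Dx; rewrite FE.
  rewrite ge0_integral_sum//.
  - apply: eq_bigr => j _; rewrite ge0_integralZl//.
    + by rewrite integral_indic// distribution_functionE// /E setIAC setIid.
    + by apply/measurable_EFinP; exact: measurable_indic.
  - move=> j; apply: measurable_funeM.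
    by apply/measurable_EFinP; exact: measurable_indic.
rewrite -(_ : (fun m => \int[mu]_(x in D) F m x) = fun m => _); last first.
  by apply/funext => m; rewrite intF.
rewrite -(monotone_convergence mu mD (g' := F)).
- apply: eq_integral => x; rewrite inE => Dx.
  by rewrite (cvg_lim _ (cvg_staircase (f0 _ Dx))).
- move=> m; apply: (eq_measurable_fun (fun x =>
      \sum_(0 <= j < m * 2 ^ m) (2 ^- m)%:E * (\1_(E m j) x)%:E)).
    by move=> x; rewrite inE => Dx; rewrite FE.
  apply: emeasurable_sum => j; apply: measurable_funeM.
  by apply/measurable_EFinP; exact: measurable_indic.
- by move=> m x Dx; rewrite lee_fin staircase_ge0.
- by move=> x Dx m k mk; rewrite lee_fin staircase_homo.
Qed.

End rearrangement_theory.

Lemma equimeasurable_integral (R : realType) d (T : measurableType d)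
    (mu : {measure set T -> \bar R}) (D : set T) (mD : measurable D)
    d' (T' : measurableType d') (mu' : {measure set T' -> \bar R})
    (D' : set T') (mD' : measurable D') (f : T -> \bar R) (f' : T' -> \bar R) :
  Mplus mu D f -> Mplus mu' D' f' ->
  (forall l, (0 <= l)%R ->
    distribution_function mu D f l = distribution_function mu' D' f' l) ->
  \int[mu]_(x in D) f x = \int[mu']_(x in D') f' x.
Proof.
move=> Mf Mf' ff'; rewrite !ge0_integral_staircase//.
apply: (congr1 (fun u => limn u)); apply/funext => m; apply: eq_bigr => j _.
by rewrite ff'// divr_ge0// exprn_ge0.
Qed.

(** * Rearrangements as functions on the half-line *)

Section completed_lebesgue.
Context {R : realType}.
Local Notation lam := (@completed_lebesgue_measure R).
Local Notation cT := (caratheodory_type (@wlength R idfun)^*%mu).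
Local Notation MplusR := (Mplus lam (@Rplus R)).

Lemma completed_measurable (A : set R) :
  measurable (A : set (measurableTypeR R)) -> measurable (A : set cT).
Proof. exact: sub_caratheodory. Qed.

Lemma completed_measurable_itv (i : interval R) : measurable ([set` i] : set cT).
Proof. by apply: completed_measurable; exact: measurable_itv. Qed.

Lemma measurable_Rplus : measurable (@Rplus R : set cT).
Proof. exact: completed_measurable_itv. Qed.

Lemma completed_lebesgue_itv (i : interval R) :
  (lam : {measure set cT -> \bar R}) [set` i] = (if i.1 < i.2 then i.2 - i.1 else 0)%E.
Proof. exact: lebesgue_measure_itv. Qed.

Lemma RplusE (x : R) : Rplus x = (0 < x)%R.
Proof. by rewrite /Rplus /= in_itv/= andbT. Qed.

(** The superlevel sets of a monotone function are intervals. *)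
Lemma ninc_measurable_fun (f : R -> \bar R) :
  {in Rplus &, {homo f : s t / (s <= t)%R >-> t <= s}} ->
  measurable_fun (Rplus : set cT) f.
Proof.
move=> nf; apply: (measurability _ (ErealGenOInfty.measurableE R)).
move=> _ [_ [r ->] <-]; apply: completed_measurable.
apply: is_interval_measurable => x y [Rx fx] [Ry fy] z /andP[xz zy].
have Rz : Rplus z by rewrite !RplusE in Rx *; exact: lt_le_trans xz.
split=> //=; move: fy; rewrite /= !in_itv/= !andbT => fy.
by rewrite (lt_le_trans fy)// nf// inE.
Qed.

Section rearr.
Context d (T : measurableType d).
Variables (mu : {measure set T -> \bar R}) (D : set T) (mD : measurable D).
Variables (f : T -> \bar R) (Mf : Mplus mu D f).

Lemma Mplus_rearrangement : MplusR (rearrangement mu D f).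
Proof.
split; last by move=> t _; exact: rearrangement_ge0.
by apply: ninc_measurable_fun => s t _ _; exact: rearrangement_ninc.
Qed.

(** By [lt_rearrangement] the superlevel set at l is the interval of all x > 0 with x < e, where e
    is the distribution function of f at l; its length is e. *)
Lemma distribution_rearrangement (l : R) : (0 <= l)%R ->
  distribution_function lam Rplus (rearrangement mu D f) l =
  distribution_function mu D f l.
Proof.
move=> l0; rewrite distribution_functionE; last exact: Mplus_rearrangement.
set e := distribution_function mu D f l.
have -> : Rplus `&` [set x | l%:E < rearrangement mu D f x] =
    Rplus `&` [set x | x%:E < e].
  by apply/seteqP; split=> x [Rx] /=; rewrite lt_rearrangement.
have : 0 <= e by exact: measure_ge0.
case: e => [r|_|//].
  rewrite lee_fin le_eqVlt => /predU1P[<-|r0].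
    rewrite (_ : _ `&` _ = set0) ?measure0//.
    apply/seteqP; split=> x //= [] /[!RplusE] x0; rewrite lte_fin => x0'.
    by have := lt_trans x0 x0'; rewrite ltxx.
  rewrite (_ : _ `&` _ = `]0%R, r[%classic).
    by rewrite (completed_lebesgue_itv `]0%R, r[)/= lte_fin r0 oppr0 adde0.
  by apply/seteqP; split=> x /=; rewrite RplusE in_itv/= lte_fin => /andP.
rewrite (_ : _ `&` _ = Rplus).
  by rewrite /Rplus (completed_lebesgue_itv `]0%R, +oo[)/= ltry.
by apply/seteqP; split=> [x [] //|x Rx]; split=> //=; rewrite ltry.
Qed.

Lemma integral_rearrangement :
  \int[lam]_(t in Rplus) rearrangement mu D f t = \int[mu]_(x in D) f x.
Proof.
apply: equimeasurable_integral => //; first exact: measurable_Rplus.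
- exact: Mplus_rearrangement.
- by move=> l; exact: distribution_rearrangement.
Qed.

End rearr.

End completed_lebesgue.

Section complex_modulus.
Context {R : realType}.
Implicit Types z : R[i].

Lemma normc_ge0 z : (0 <= Normc.normc z)%R.
Proof. by case: z => a b; exact: sqrtr_ge0. Qed.

Lemma normc_sqr z :
  (Normc.normc z ^+ 2 = complex.Re z ^+ 2 + complex.Im z ^+ 2)%R.
Proof. by case: z => a b; rewrite /= sqr_sqrtr// addr_ge0// sqr_ge0. Qed.

Lemma abse_modulus d (T : measurableType d) (h : T -> R[i]) x :
  (`|modulus h x| = (Normc.normc (h x))%:E)%E.
Proof. by rewrite gee0_abs// lee_fin normc_ge0. Qed.

Lemma normc_real (a : R) : Normc.normc (Complex a 0%R) = `|a|%R.
Proof. by rewrite /= expr0n addr0 sqrtr_sqr. Qed.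

Lemma ler_normc_Re z : (`|complex.Re z| <= Normc.normc z)%R.
Proof.
rewrite -(ler_sqr (x := `|_|%R)) ?nnegrE ?normc_ge0// normc_sqr.
by rewrite real_normK ?num_real// lerDl sqr_ge0.
Qed.

Lemma ler_normc_Im z : (`|complex.Im z| <= Normc.normc z)%R.
Proof.
rewrite -(ler_sqr (x := `|_|%R)) ?nnegrE ?normc_ge0// normc_sqr.
by rewrite real_normK ?num_real// lerDr sqr_ge0.
Qed.

End complex_modulus.

(** * K-monotonicity from interpolation *)

Section square_integrals.
Context d (T : measurableType d) (R : realType).
Variables (mu : {measure set T -> \bar R}) (D : set T) (mD : measurable D).
Implicit Types (u v : T -> R) (h : T -> R[i]).

Lemma integrable_mul u v : measurable_fun D u -> measurable_fun D v ->
  \int[mu]_(x in D) ((u x) ^+ 2)%:E < +oo ->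
  \int[mu]_(x in D) ((v x) ^+ 2)%:E < +oo ->
  mu.-integrable D (EFin \o (fun x => u x * v x)%R).
Proof.
move=> muD mvD iu iv.
have mu2 : measurable_fun D (fun x => ((u x) ^+ 2)%:E).
  by apply/measurable_EFinP; exact: measurable_funX.
have mv2 : measurable_fun D (fun x => ((v x) ^+ 2)%:E).
  by apply/measurable_EFinP; exact: measurable_funX.
apply: (le_integrable mD (g := fun x => ((u x) ^+ 2)%:E + ((v x) ^+ 2)%:E)).
- by apply/measurable_EFinP; exact: measurable_funM.
- move=> x _; rewrite -EFinD /= lee_fin [leRHS]ger0_norm ?addr_ge0 ?sqr_ge0//.
  rewrite normrM -(real_normK (num_real (u x))) -(real_normK (num_real (v x))).
  by set a := `|u x|%R; set b := `|v x|%R; nra.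
- apply: integrableD => //; apply/integrableP; split=> //.
    by under eq_integral do rewrite gee0_abs ?lee_fin ?sqr_ge0//.
  by under eq_integral do rewrite gee0_abs ?lee_fin ?sqr_ge0//.
Qed.

Lemma cauchy_schwarz_Rintegral u v : measurable_fun D u -> measurable_fun D v ->
  \int[mu]_(x in D) ((u x) ^+ 2)%:E < +oo ->
  \int[mu]_(x in D) ((v x) ^+ 2)%:E < +oo ->
  ((\int[mu]_(x in D) (u x * v x)) ^+ 2 <=
  (\int[mu]_(x in D) (u x ^+ 2)) * (\int[mu]_(x in D) (v x ^+ 2)))%R.
Proof.
move=> muD mvD iu iv.
have iuv := integrable_mul muD mvD iu iv.
have iuu := integrable_mul muD muD iu iu.
have ivv := integrable_mul mvD mvD iv iv.
set a := Rintegral _ _ (fun x => u x ^+ 2)%R.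
set b := Rintegral _ _ (fun x => u x * v x)%R.
set c := Rintegral _ _ (fun x => v x ^+ 2)%R.
have H (t : R) : (0 <= t ^+ 2 * a - 2 * t * b + c)%R.
  have -> : (t ^+ 2 * a - 2 * t * b + c =
      \int[mu]_(x in D) ((t * u x - v x) ^+ 2))%R.
    have i1 : mu.-integrable D (EFin \o (fun x => t ^+ 2 * u x ^+ 2)%R).
      exact: (integrableZl mD _ iuu).
    have i2 : mu.-integrable D (EFin \o (fun x => 2 * t * (u x * v x))%R).
      exact: (integrableZl mD _ iuv).
    have i3 := integrableB mD i1 i2.
    rewrite /a /b /c -!RintegralZl// -RintegralB// -RintegralD//.
    by apply: eq_Rintegral => x _; ring.
  by apply: Rintegral_ge0 => x _; exact: sqr_ge0.
have a0 : (0 <= a)%R by apply: Rintegral_ge0 => x _; exact: sqr_ge0.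
have c0 : (0 <= c)%R by apply: Rintegral_ge0 => x _; exact: sqr_ge0.
case: (ltrgt0P a) a0 => // [apos|a0] _.
  have := H (b / a)%R; rewrite -(pmulr_rge0 _ apos).
  have -> : (a * ((b / a) ^+ 2 * a - 2 * (b / a) * b + c) = a * c - b ^+ 2)%R.
    by field; rewrite gt_eqF.
  by rewrite subr_ge0.
rewrite a0 mul0r; suff -> : b = 0%R by rewrite expr0n.
apply/eqP/negPn/negP => b0.
(* With a = 0 the polynomial in t is affine; were b nonzero, it would take the value -1 at this
   t. *)
have := H ((c + 1) / (2 * b))%R; rewrite a0 mulr0 add0r.
have -> : (- (2 * ((c + 1) / (2 * b)) * b) + c = - 1)%R by field.
by lra.
Qed.

Lemma integral_sqr_linear (c : R) u v : measurable_fun D u -> measurable_fun D v ->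
  \int[mu]_(x in D) ((u x) ^+ 2)%:E < +oo ->
  \int[mu]_(x in D) ((v x) ^+ 2)%:E < +oo ->
  \int[mu]_(x in D) ((c * u x + v x) ^+ 2)%:E < +oo.
Proof.
move=> muD mvD iu iv.
have msq (w : T -> R) : measurable_fun D w -> measurable_fun D (fun x => (w x ^+ 2)%:E).
  by move=> mw; apply/measurable_EFinP; exact: measurable_funX.
apply: (@le_lt_trans _ _ (\int[mu]_(x in D)
    ((2 * c ^+ 2)%:E * (u x ^+ 2)%:E + 2%:E * (v x ^+ 2)%:E))).
  apply: ge0_le_integral => //.
  - by move=> y _; rewrite lee_fin sqr_ge0.
  - apply: msq; apply: measurable_funD => //; exact: measurable_funM.
  - by apply: emeasurable_funD; apply: measurable_funeM; exact: msq.
  - move=> y _; rewrite -!EFinM -EFinD lee_fin.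
    by have := sqr_ge0 (c * u y - v y); nra.
have c0 : (0 <= 2 * c ^+ 2 :> R)%R by rewrite mulr_ge0// sqr_ge0.
rewrite ge0_integralD//.
- rewrite !ge0_integralZl//; try exact: msq.
  + by rewrite lte_add_pinfty// lte_mul_pinfty ?lee_fin.
  + by move=> y _; rewrite lee_fin sqr_ge0.
  + by move=> y _; rewrite lee_fin sqr_ge0.
- by move=> y _; rewrite -EFinM lee_fin mulr_ge0// sqr_ge0.
- by apply: measurable_funeM; exact: msq.
- by move=> y _; rewrite -EFinM lee_fin mulr_ge0// sqr_ge0.
- by apply: measurable_funeM; exact: msq.
Qed.

Lemma Mplus_modulus h : cmeasurable mu D h -> Mplus mu D (modulus h).
Proof.
move=> [mr mi]; split; last by move=> x _; rewrite lee_fin normc_ge0.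
rewrite (_ : modulus h = fun x =>
    (Num.sqrt (complex.Re (h x) ^+ 2 + complex.Im (h x) ^+ 2))%:E).
  apply/measurable_EFinP; apply: (@measurableT_comp _ _ _ _ _ _ (@Num.sqrt R)).
    by apply: continuous_measurable_fun; exact: sqrt_continuous.
  by apply: measurable_funD; exact: measurable_funX.
by apply/funext => x; rewrite -normc_sqr sqrtr_sqr ger0_norm ?normc_ge0.
Qed.

Lemma Lp_norm2E h :
  Lp_norm mu D 2%:E (modulus h) =
  (\int[mu]_(x in D) ((Normc.normc (h x)) ^+ 2)%:E) `^ (2^-1).
Proof.
rewrite /Lp_norm unlock; congr (_ `^ _).
rewrite [RHS]integral_mkcond; apply: eq_integral => x _.
rewrite /patch; case: ifPn => xD; last by rewrite /= normr0 powR0.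
by rewrite abse_modulus poweR_EFin powR_mulrn ?normc_ge0.
Qed.

Lemma Lp_norm2_fin h : Lp_norm mu D 2%:E (modulus h) < +oo ->
  \int[mu]_(x in D) ((Normc.normc (h x)) ^+ 2)%:E < +oo.
Proof.
rewrite Lp_norm2E; apply: contraTT; rewrite -!leNgt !leye_eq => /eqP ->.
by rewrite poweRyr// invr_neq0.
Qed.

Lemma Lp_norm2_le (C : R) h h' : (0 <= C)%R ->
  \int[mu]_(x in D) ((Normc.normc (h x)) ^+ 2)%:E <=
  (C ^+ 2)%:E * \int[mu]_(x in D) ((Normc.normc (h' x)) ^+ 2)%:E ->
  Lp_norm mu D 2%:E (modulus h) <= C%:E * Lp_norm mu D 2%:E (modulus h').
Proof.
move=> C0; rewrite !Lp_norm2E => le.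
have I0 g : 0 <= \int[mu]_(x in D) ((Normc.normc (g x)) ^+ 2)%:E.
  by apply: integral_ge0 => x _; rewrite lee_fin sqr_ge0.
have -> : C%:E = (C ^+ 2)%:E `^ (2^-1).
  by rewrite poweR_EFin powR12_sqrt ?sqr_ge0// sqrtr_sqr ger0_norm.
rewrite -poweRM ?I0 ?lee_fin ?sqr_ge0//.
apply: gt0_ler_poweR => //; rewrite in_itv/= leey andbT; first exact: I0.
by rewrite mule_ge0 ?lee_fin ?sqr_ge0.
Qed.

Lemma Lp_normoo_le (M : \bar R) h : 0 <= M ->
  {ae mu, forall x, D x -> (Normc.normc (h x))%:E <= M} ->
  Lp_norm mu D +oo (modulus h) <= M.
Proof.
move=> M0 hM; rewrite /Lp_norm unlock; case: ifPn => // _; apply/ess_supP.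
apply: filterS hM => x; rewrite /= /patch; case: ifPn => [|_ _].
  by rewrite inE abse_modulus => Dx; exact.
by rewrite -[point]/(0%E) abse0.
Qed.

(** The L_oo norm is 0 by definition on a space of measure zero; positivity of the measure selects
    the essential supremum. *)
Lemma Lp_normoo_ge h : 0 < mu setT ->
  {ae mu, forall x, D x -> (Normc.normc (h x))%:E <= Lp_norm mu D +oo (modulus h)}.
Proof.
move=> mu0; rewrite /Lp_norm unlock mu0.
have := ess_sup_ge mu (abse \o (modulus h \_ D)).
apply: filterS => x; rewrite /= /patch => + Dx; rewrite mem_set//.
by rewrite abse_modulus.
Qed.

End square_integrals.

(** * Dyadic decomposition of the half-line *)

Section dyadic_intervals.
Context {R : realType}.
Local Notation lam := (@completed_lebesgue_measure R).
Local Notation cT := (caratheodory_type (@wlength R idfun)^*%mu).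

Definition dyadic (k : int) : set R := [set` `](2 : R) ^ k, 2 ^ (k + 1)]%R].

(** Outside the half-line no dyadic interval contains x and the index defaults to 0. *)
Definition dyadic_index (x : R) : int := xget 0%R [set k | dyadic k x].

Lemma dyadic_Rplus k : dyadic k `<=` Rplus.
Proof.
move=> x; rewrite /dyadic /= in_itv/= RplusE => /andP[+ _].
by apply: lt_trans; rewrite exprz_gt0.
Qed.

Lemma measurable_dyadic k : measurable (dyadic k : set cT).
Proof. exact: completed_measurable_itv. Qed.

Lemma dyadic_measure k :
  (lam : {measure set cT -> \bar R}) (dyadic k) = ((2 : R) ^ k)%R%:E.
Proof.
rewrite completed_lebesgue_itv/= lte_fin ltr_eXz2l ?ltr1n// ltrDl ltr01.
rewrite -EFinB; congr EFin; rewrite expfzDr// expr1z; ring.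
Qed.

Lemma trivIset_dyadic : trivIset setT dyadic.
Proof.
apply/trivIsetP => i j _ _ ij; apply/seteqP; split=> // x [].
rewrite /dyadic /= !in_itv/= => /andP[xi xi'] /andP[xj xj'].
move/eqP: ij; apply; apply/eqP; rewrite eq_le; apply/andP; split.
- have := lt_le_trans xi xj'; rewrite ltr_eXz2l ?ltr1n//.
  by rewrite ltzD1.
- have := lt_le_trans xj xi'; rewrite ltr_eXz2l ?ltr1n//.
  by rewrite ltzD1.
Qed.

Lemma dyadic_cover x : Rplus x -> exists k, dyadic k x.
Proof.
rewrite RplusE => x0.
have pow (y : R) : (0 < y)%R -> exists n : nat, (y < 2 ^+ n)%R.
  move=> y0; exists (Num.bound y); apply: (lt_le_trans (archi_boundP (ltW y0))).
  by rewrite -natrX ler_nat; exact/ltnW/ltn_expl.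
(* Since 2^-N < x, shifting the exponents by N allows the least admissible exponent to be sought
   among the natural numbers, where it is not 0. *)
have [|N xN] := pow x^-1%R; first by rewrite invr_gt0.
have [M xM] := pow x x0.
have ex : exists n : nat, (x <= 2 ^ (n%:Z - N%:Z))%R.
  exists (M + N)%N; rewrite PoszD addrK; exact: ltW.
case: (ex_minnP ex) => -[|n] xn minn.
  exfalso; move: xn; rewrite sub0r leNgt => /negP; apply.
  by rewrite -invr_expz invf_plt ?posrE ?exprz_gt0.
exists (n%:Z - N%:Z)%R; rewrite /dyadic /= in_itv/=; apply/andP; split.
  by rewrite ltNge; apply/negP => /minn; rewrite ltnn.
by rewrite addrAC -PoszD addn1.
Qed.

Lemma dyadic_indexP x : Rplus x -> dyadic (dyadic_index x) x.
Proof.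
by move=> /dyadic_cover [k kx]; rewrite /dyadic_index; case: xgetP => // /(_ k).
Qed.

Lemma dyadic_index_eq k x : dyadic k x -> dyadic_index x = k.
Proof.
move=> kx; have ix := dyadic_indexP (dyadic_Rplus kx).
have /trivIsetP/(_ _ _ I I) := trivIset_dyadic.
move=> /(_ (dyadic_index x) k); case: eqVneq => // _ /(_ erefl) /seteqP[h _].
by have := h x (conj ix kx).
Qed.

Lemma measurable_dyadic_step d (T : measurableType d) (c : int -> T) :
  measurable_fun (Rplus : set cT) (fun x => c (dyadic_index x)).
Proof.
move=> _ Y mY.
rewrite (_ : _ `&` _ = \bigcup_k (if `[< Y (c k) >] then dyadic k else set0)).
  apply: countable_bigcupT_measurable => // k.
  by case: ifP => // _; exact: measurable_dyadic.
apply/seteqP; split=> [x [Rx Yx]|x [k _]].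
  exists (dyadic_index x) => //; case: asboolP => // _; exact: dyadic_indexP.
case: asboolP => // Yk kx; split; first exact: dyadic_Rplus kx.
by rewrite /= (dyadic_index_eq kx).
Qed.

(** Countable additivity concerns sequences, while the blocks are indexed by integers. One
    enumeration serves all families A, so that the n-th terms of two families belong to the same
    integer; a natural number that codes no integer gives the empty set. *)
Lemma enum_int_sets : exists S : (int -> set R) -> nat -> set R,
  [/\ forall A, (forall k, measurable (A k : set cT)) ->
        forall n, measurable (S A n : set cT),
      forall A, trivIset setT A -> trivIset setT (S A),
      forall A, \bigcup_n S A n = \bigcup_k A k &
      forall n, (exists k, forall A, S A n = A k) \/ forall A, S A n = set0].
Proof.
exists (fun A n => if pickle_inv n is Some k then A k else set0); split.
- by move=> A mA n; case: pickle_inv.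
- move=> A /trivIsetP tA; apply/trivIsetP => i j _ _ ij.
  case: (pickle_inv i) (@pickle_invK int i) => [k|]; last by rewrite set0I.
  case: (pickle_inv j) (@pickle_invK int j) => [l|]; last by rewrite setI0.
  rewrite /oapp => lj ki; apply: tA => //; apply: contraNneq ij => kl.
  by rewrite -lj -ki kl.
- move=> A; apply/seteqP; split=> [x [n _]|x [k _ Ak]].
    by case: pickle_inv => // k Ak; exists k.
  by exists (pickle k); [exact: I|rewrite pickleK_inv].
- by move=> n; case: pickle_inv => [k|]; [left; exists k|right].
Qed.

(** The left side splits over the dyadic intervals, the k-th of which has length 2^k, and the right
    side is at least its sum over the disjoint [J k]. The comparison is made term by term. *)
Lemma integral_dyadic_step (e : int -> R) (J : int -> set R) (w : R -> \bar R) :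
  (forall k, 0 <= e k)%R ->
  (forall k, measurable (J k : set cT)) -> (forall k, J k `<=` Rplus) ->
  trivIset setT J -> measurable_fun (Rplus : set cT) w ->
  (forall x, Rplus x -> 0 <= w x) ->
  (forall k, (e k * 2 ^ k)%R%:E <= \int[lam]_(x in J k) w x) ->
  \int[lam]_(x in Rplus) (e (dyadic_index x))%:E <= \int[lam]_(x in Rplus) w x.
Proof.
move=> e0 mJ JR tJ mw w0 eJ.
have [S [mS tS US SE]] := enum_int_sets.
have RE : Rplus = \bigcup_n S dyadic n.
  rewrite US; apply/seteqP; split=> [x /dyadic_cover [k kx]|x [k _]].
    by exists k.
  exact: dyadic_Rplus.
rewrite [X in \int[_]_(x in X) _ <= _]RE.
rewrite ge0_integral_bigcup; first last.
- exact/tS/trivIset_dyadic.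
- by move=> x _; rewrite lee_fin.
- by rewrite -RE; apply/measurable_EFinP; exact: measurable_dyadic_step.
- by apply: mS => k; exact: measurable_dyadic.
have UR : \bigcup_n S J n `<=` Rplus.
  by rewrite US => x [k _]; exact: JR.
have mU : measurable (\bigcup_n S J n : set cT).
  by apply: bigcupT_measurable; exact: mS.
apply: (@le_trans _ _ (\int[lam]_(x in \bigcup_n S J n) w x)); last first.
  by apply: ge0_subset_integral => //; exact: measurable_Rplus.
rewrite ge0_integral_bigcup//; first last.
- exact: tS.
- by move=> x /UR; exact: w0.
- exact: measurable_funS measurable_Rplus UR mw.
- exact: mS.
apply: lee_nneseries => [n _ _|n _].
  by apply: integral_ge0 => x _; rewrite lee_fin.
have [[k Sk]|S0] := SE n; last by rewrite !S0 !integral_set0.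
rewrite !Sk.
apply: le_trans (eJ k).
rewrite (eq_integral (fun=> (e k)%:E)); last first.
  by move=> x; rewrite inE => /dyadic_index_eq ->.
rewrite integral_cst; last exact: measurable_dyadic.
by rewrite dyadic_measure EFinM.
Qed.

End dyadic_intervals.

(** * The averaging operator and its bounds on L_2 and L_oo *)

Section block_averages.
Context {R : realType}.
Local Notation lam := (@completed_lebesgue_measure R).
Local Notation cT := (caratheodory_type (@wlength R idfun)^*%mu).
Variables (G : R -> R) (J : int -> set R) (alpha : int -> R).
Hypothesis mJ : forall k, measurable (J k : set cT).
Hypothesis JR : forall k, J k `<=` Rplus.
Hypothesis tJ : trivIset setT J.
Hypothesis mG : measurable_fun (Rplus : set cT) G.
Hypothesis G2J : forall k, \int[lam]_(x in J k) (G x ^+ 2)%:E < +oo.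
Hypothesis lamJ : forall k, (lam : {measure set cT -> \bar R}) (J k) <= (2 ^ k)%R%:E.
Hypothesis alphaE : forall k,
  (alpha k ^+ 2 * (\int[lam]_(x in J k) (G x ^+ 2)) * 2 ^ k <= 1)%R.

Local Notation L2 := (Lp_norm lam (@Rplus R) 2%:E).
Local Notation Loo := (Lp_norm lam (@Rplus R) +oo).

Definition block_coef (k : int) (u : R -> R) : R :=
  (alpha k * \int[lam]_(x in J k) (G x * u x))%R.

(** The constant value on the k-th dyadic interval is read off from another set, the block [J k].
    Real and imaginary parts are averaged separately because the interpolation property concerns
    complex-valued functions. *)
Definition block_average (h : R -> R[i]) (x : R) : R[i] :=
  Complex (block_coef (dyadic_index x) (fun y => complex.Re (h y)))
          (block_coef (dyadic_index x) (fun y => complex.Im (h y))).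

(** A class on which the averages are finite and linear and which contains L_2 and, the blocks
    having finite measure, L_oo; hence it contains the whole sum space, where the operator has to
    act. *)
Let locL2 (u : R -> R) := measurable_fun (Rplus : set cT) u /\
  forall k, \int[lam]_(x in J k) (u x ^+ 2)%:E < +oo.

Let mGJ k : measurable_fun (J k : set cT) G.
Proof. exact: measurable_funS measurable_Rplus (@JR k) mG. Qed.

Let locL2_measurable u k : locL2 u -> measurable_fun (J k : set cT) u.
Proof. by case=> mu _; exact: measurable_funS measurable_Rplus (@JR k) mu. Qed.

Lemma block_coef_linear k (a : R) u v : locL2 u -> locL2 v ->
  block_coef k (fun x => a * u x + v x)%R =
  (a * block_coef k u + block_coef k v)%R.
Proof.
move=> lu lv; rewrite /block_coef.
have iu : lam.-integrable (J k) (EFin \o (fun x => G x * u x)%R).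
  apply: integrable_mul; [exact: mJ|exact: mGJ|exact: locL2_measurable|exact: G2J|].
  by case: lu.
have iv : lam.-integrable (J k) (EFin \o (fun x => G x * v x)%R).
  apply: integrable_mul; [exact: mJ|exact: mGJ|exact: locL2_measurable|exact: G2J|].
  by case: lv.
have iau : lam.-integrable (J k) (EFin \o (fun x => a * (G x * u x))%R).
  exact: (integrableZl (mJ k) _ iu).
rewrite [X in (_ * X = _)%R](_ : _ = a * (\int[lam]_(x in J k) (G x * u x)) +
    \int[lam]_(x in J k) (G x * v x))%R; first by ring.
rewrite -RintegralZl; [|exact: mJ|exact: iu].
rewrite -RintegralD; [|exact: mJ|exact: iau|exact: iv].
by apply: eq_Rintegral => x _; ring.
Qed.

Lemma block_coef_ae k u v : measurable_fun (Rplus : set cT) u ->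
  measurable_fun (Rplus : set cT) v ->
  ae_eq lam Rplus u v -> block_coef k u = block_coef k v.
Proof.
move=> mu mv uv; congr (_ * fine _)%R; apply: ae_eq_integral.
- exact: mJ.
- apply/measurable_EFinP; apply: measurable_funM; first exact: mGJ.
  exact: measurable_funS measurable_Rplus (@JR k) mu.
- apply/measurable_EFinP; apply: measurable_funM; first exact: mGJ.
  exact: measurable_funS measurable_Rplus (@JR k) mv.
- by apply: filterS uv => x h /JR Rx; rewrite /= h.
Qed.

(** Cauchy-Schwarz on [J k] together with [alphaE]. The factor 2^k is the length of the dyadic
    interval that carries the coefficient, so this is the L_2 bound for a single block. *)
Lemma block_coef_sqr k u : locL2 u ->
  (block_coef k u ^+ 2 * 2 ^ k <= \int[lam]_(x in J k) (u x ^+ 2))%R.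
Proof.
move=> lu; rewrite /block_coef exprMn.
have cs := cauchy_schwarz_Rintegral (mJ k) (@mGJ k) (locL2_measurable lu) (G2J k) (lu.2 k).
pose c := (\int[lam]_(x in J k) (u x ^+ 2))%R.
have c0 : (0 <= c)%R by apply: Rintegral_ge0 => x _; exact: sqr_ge0.
apply: (@le_trans _ _ (alpha k ^+ 2 *
  ((\int[lam]_(x in J k) (G x ^+ 2)) * c) * 2 ^ k)%R).
  rewrite ler_wpM2r ?exprz_ge0//; rewrite ler_wpM2l ?sqr_ge0//; exact: cs.
rewrite mulrA mulrAC -[leRHS]mul1r ler_wpM2r//; exact: alphaE.
Qed.

Lemma measurable_block_average h : cmeasurable lam Rplus (block_average h).
Proof.
by split; [exact: (measurable_dyadic_step (fun k => block_coef k (fun y => complex.Re (h y))))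
  |exact: (measurable_dyadic_step (fun k => block_coef k (fun y => complex.Im (h y))))].
Qed.

Let locL2C (h : R -> R[i]) := cmeasurable lam Rplus h /\
  forall k, \int[lam]_(x in J k) (Normc.normc (h x) ^+ 2)%:E < +oo.

Let mnormc2 h (A : set R) : A `<=` Rplus -> cmeasurable lam Rplus h ->
  measurable_fun (A : set cT) (fun x => (Normc.normc (h x) ^+ 2)%:E).
Proof.
move=> AR [mr mi]; apply: measurable_funS measurable_Rplus AR _.
apply/measurable_EFinP; under eq_fun do rewrite normc_sqr.
by apply: measurable_funD; exact: measurable_funX.
Qed.

Let locL2C_Re h : locL2C h -> locL2 (fun x => complex.Re (h x)).
Proof.
case=> -[mr mi] h2; split=> // k; apply: le_lt_trans (h2 k).
apply: ge0_le_integral; first exact: mJ.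
- by move=> x _; rewrite lee_fin sqr_ge0.
- apply: measurable_funS measurable_Rplus (@JR k) _.
  by apply/measurable_EFinP; exact: measurable_funX.
- exact: mnormc2 (@JR k) _.
- by move=> x _; rewrite lee_fin normc_sqr lerDl sqr_ge0.
Qed.

Let locL2C_Im h : locL2C h -> locL2 (fun x => complex.Im (h x)).
Proof.
case=> -[mr mi] h2; split=> // k; apply: le_lt_trans (h2 k).
apply: ge0_le_integral; first exact: mJ.
- by move=> x _; rewrite lee_fin sqr_ge0.
- apply: measurable_funS measurable_Rplus (@JR k) _.
  by apply/measurable_EFinP; exact: measurable_funX.
- exact: mnormc2 (@JR k) _.
- by move=> x _; rewrite lee_fin normc_sqr lerDr sqr_ge0.
Qed.

Lemma block_average_sqr h x : locL2C h ->
  (Normc.normc (block_average h x) ^+ 2 * 2 ^ dyadic_index x)%R%:E <=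
  \int[lam]_(x in J (dyadic_index x)) (Normc.normc (h x) ^+ 2)%:E.
Proof.
move=> lh; set k := dyadic_index x.
have lr := locL2C_Re lh; have li := locL2C_Im lh.
rewrite normc_sqr/= mulrDl EFinD.
apply: (@le_trans _ _ (\int[lam]_(x in J k) ((complex.Re (h x)) ^+ 2)%:E +
    \int[lam]_(x in J k) ((complex.Im (h x)) ^+ 2)%:E)).
  apply: leeD.
    apply: (@le_trans _ _ (\int[lam]_(x in J k) (complex.Re (h x) ^+ 2))%R%:E).
      by rewrite lee_fin; exact: block_coef_sqr.
    rewrite /Rintegral fineK// ge0_fin_numE; first exact: lr.2.
    by apply: integral_ge0 => y _; rewrite lee_fin sqr_ge0.
  apply: (@le_trans _ _ (\int[lam]_(x in J k) (complex.Im (h x) ^+ 2))%R%:E).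
    by rewrite lee_fin; exact: block_coef_sqr.
  rewrite /Rintegral fineK// ge0_fin_numE; first exact: li.2.
  by apply: integral_ge0 => y _; rewrite lee_fin sqr_ge0.
have m2 (u : R -> R) : measurable_fun (Rplus : set cT) u ->
    measurable_fun (J k : set cT) (fun x => (u x ^+ 2)%:E).
  move=> mu; apply: measurable_funS measurable_Rplus (@JR k) _.
  by apply/measurable_EFinP; exact: measurable_funX.
rewrite -ge0_integralD; first last.
- exact: m2 li.1.
- by move=> y _; rewrite lee_fin sqr_ge0.
- exact: m2 lr.1.
- by move=> y _; rewrite lee_fin sqr_ge0.
- exact: mJ.
rewrite le_eqVlt; apply/orP; left; apply/eqP.
by apply: eq_integral => y _; rewrite normc_sqr.
Qed.

Let L2_locL2C h : Lspace_of lam Rplus L2 h -> locL2C h.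
Proof.
case=> mh h2; split=> // k.
apply: le_lt_trans (Lp_norm2_fin h2); apply: ge0_subset_integral.
- exact: mJ.
- exact: measurable_Rplus.
- exact: mnormc2.
- by move=> y _; rewrite lee_fin sqr_ge0.
- exact: JR.
Qed.

Let lamT_gt0 : 0 < (lam : {measure set cT -> \bar R}) setT.
Proof.
apply: (@lt_le_trans _ _ ((lam : {measure set cT -> \bar R}) (dyadic 0%R))).
  by rewrite dyadic_measure expr0z lte_fin ltr01.
apply: le_measure; [rewrite inE; exact: measurable_dyadic|rewrite inE; exact: measurableT|exact: subsetT].
Qed.

Let Loo_int h k : Lspace_of lam Rplus Loo h ->
  \int[lam]_(x in J k) (Normc.normc (h x) ^+ 2)%:E <=
  (fine (Loo (modulus h)) ^+ 2 * 2 ^ k)%R%:E.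
Proof.
case=> mh hoo; set M := fine _.
have Loo0 : 0 <= Loo (modulus h) by exact: Lnorm_ge0.
have ME : Loo (modulus h) = M%:E by rewrite fineK// ge0_fin_numE.
have := @Lp_normoo_ge _ _ _ lam Rplus h lamT_gt0; rewrite ME => hM.
apply: (@le_trans _ _ (\int[lam]_(x in J k) (M ^+ 2)%:E)).
  apply: ae_ge0_le_integral.
  - exact: mJ.
  - by move=> y _; rewrite lee_fin sqr_ge0.
  - exact: mnormc2 (@JR k) mh.
  - by move=> y _; rewrite lee_fin sqr_ge0.
  - exact: measurable_cst.
  - apply: filterS hM => y + Jy => /(_ (JR Jy)); rewrite !lee_fin => yM.
    by rewrite ler_pXn2r// nnegrE ?normc_ge0// (le_trans (normc_ge0 _) yM).
rewrite integral_cst; last exact: mJ.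
rewrite (_ : (M ^+ 2 * 2 ^ k)%R%:E = (M ^+ 2)%:E * (2 ^ k)%R%:E)//.
apply: lee_wpmul2l; [by rewrite lee_fin sqr_ge0|exact: lamJ].
Qed.

Let Loo_locL2C h : Lspace_of lam Rplus Loo h -> locL2C h.
Proof.
move=> hoo; split; first by case: hoo.
by move=> k; rewrite (le_lt_trans (Loo_int k hoo))// ltry.
Qed.

Lemma sum_space_locL2C h : sum_space lam Rplus L2 Loo h ->
  cmeasurable lam Rplus h /\
  forall k, \int[lam]_(x in J k) (Normc.normc (h x) ^+ 2)%:E < +oo.
Proof.
case=> mh [h1 [h2 [/L2_locL2C l1 /Loo_locL2C l2 hE]]]; split=> // k.
apply: (@le_lt_trans _ _ (\int[lam]_(x in J k)
  ((2 * Normc.normc (h1 x) ^+ 2)%:E + (2 * Normc.normc (h2 x) ^+ 2)%:E))).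
  apply: ae_ge0_le_integral.
  - exact: mJ.
  - by move=> y _; rewrite lee_fin sqr_ge0.
  - exact: mnormc2 (@JR k) mh.
  - by move=> y _; rewrite -EFinD lee_fin addr_ge0// mulr_ge0// sqr_ge0.
  - apply: emeasurable_funD; under eq_fun do rewrite EFinM; apply: measurable_funeM.
      exact: mnormc2 (@JR k) l1.1.
    exact: mnormc2 (@JR k) l2.1.
  - apply: filterS hE => y + Jy => /(_ (JR Jy)) ->; rewrite -EFinD lee_fin.
    apply: (@le_trans _ _ ((Normc.normc (h1 y) + Normc.normc (h2 y)) ^+ 2)%R).
      by rewrite ler_pXn2r ?nnegrE ?addr_ge0 ?normc_ge0// le_normcD.
    by have := sqr_ge0 (Normc.normc (h1 y) - Normc.normc (h2 y)); nra.
rewrite ge0_integralD; first last.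
- by under eq_fun do rewrite EFinM; apply: measurable_funeM; exact: mnormc2 (@JR k) l2.1.
- by move=> y _; rewrite lee_fin mulr_ge0// sqr_ge0.
- by under eq_fun do rewrite EFinM; apply: measurable_funeM; exact: mnormc2 (@JR k) l1.1.
- by move=> y _; rewrite lee_fin mulr_ge0// sqr_ge0.
- exact: mJ.
under eq_integral do rewrite EFinM.
under [X in _ + X < _]eq_integral do rewrite EFinM.
rewrite !ge0_integralZl; first last.
- by rewrite lee_fin.
- by move=> y _; rewrite lee_fin sqr_ge0.
- exact: mnormc2 (@JR k) l1.1.
- exact: mJ.
- by rewrite lee_fin.
- by move=> y _; rewrite lee_fin sqr_ge0.
- exact: mnormc2 (@JR k) l2.1.
- exact: mJ.
by rewrite lte_add_pinfty// lte_mul_pinfty ?lee_fin//; [exact: l1.2|exact: l2.2].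
Qed.

Lemma block_average_L2 : bounded_on lam Rplus L2 block_average.
Proof.
exists 1%R; [exact: ltr01|move=> h hL]; have lh := L2_locL2C hL.
have le : L2 (modulus (block_average h)) <= 1%:E * L2 (modulus h).
  apply: Lp_norm2_le => //; rewrite expr1n mul1e.
  apply: (@integral_dyadic_step R (fun k => Normc.normc
    (Complex (block_coef k (fun y => complex.Re (h y)))
             (block_coef k (fun y => complex.Im (h y)))) ^+ 2)%R J
    (fun x => (Normc.normc (h x) ^+ 2)%:E)).
  - by move=> k; exact: sqr_ge0.
  - exact: mJ.
  - exact: JR.
  - exact: tJ.
  - exact: mnormc2 (@subset_refl _ _) lh.1.
  - by move=> y _; rewrite lee_fin sqr_ge0.
  (* The right endpoint belongs to the k-th interval; the pointwise estimate is read there. *)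
  - move=> k; have kk : dyadic k ((2 : R) ^ (k + 1))%R.
      by rewrite /dyadic/= in_itv/= lexx ltr_eXz2l ?ltr1n// ltrDl ltr01.
    by have := block_average_sqr ((2 : R) ^ (k + 1))%R lh; rewrite /block_average (dyadic_index_eq kk).
split; [split; first exact: measurable_block_average|exact: le].
by rewrite (le_lt_trans le)// mul1e; case: hL.
Qed.

(** The square of the value, times 2^k, is at most the integral of |h|^2 over [J k], hence at most
    M^2 2^k because [J k] is no longer than 2^k. *)
Lemma block_average_Loo : bounded_on lam Rplus Loo block_average.
Proof.
exists 1%R; [exact: ltr01|move=> h hL]; have lh := Loo_locL2C hL.
have Loo0 : 0 <= Loo (modulus h) by exact: Lnorm_ge0.
have ME : Loo (modulus h) = (fine (Loo (modulus h)))%:E.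
  by rewrite fineK// ge0_fin_numE//; case: hL.
have le : Loo (modulus (block_average h)) <= 1%:E * Loo (modulus h).
  rewrite mul1e; apply: Lp_normoo_le => //; apply: aeW => x Rx.
  rewrite ME lee_fin -(ler_pXn2r (n := 2)) ?nnegrE ?normc_ge0 ?fine_ge0//.
  rewrite -(ler_pM2r (_ : 0 < 2 ^ dyadic_index x)%R) ?exprz_gt0// -lee_fin.
  exact: le_trans (block_average_sqr x lh) (Loo_int _ hL).
split; [split; first exact: measurable_block_average|exact: le].
by rewrite (le_lt_trans le)// mul1e; case: hL.
Qed.

Lemma block_average_linear_on_sum :
  linear_on_sum lam Rplus L2 Loo block_average.
Proof.
have lin (a : R[i]) f g x : locL2C f -> locL2C g ->
    block_average (fun x => a * f x + g x)%R x =
    (a * block_average f x + block_average g x)%R.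
  move=> lf lg; have rf := locL2C_Re lf; have jf := locL2C_Im lf.
  have rg := locL2C_Re lg; have jg := locL2C_Im lg.
  rewrite /block_average; set k := dyadic_index x; case: a => a b.
  have locD (c : R) (u v : R -> R) :
      locL2 u -> locL2 v -> locL2 (fun x => c * u x + v x)%R.
    move=> lu lv; split.
      exact: measurable_funD (measurable_funM (measurable_cst _) lu.1) lv.1.
    move=> l; apply: integral_sqr_linear; [exact: mJ|exact: locL2_measurable|
      exact: locL2_measurable|exact: lu.2|exact: lv.2].
  have eR : (fun y => complex.Re (Complex a b * f y + g y)%R) =
      (fun y => (- b) * complex.Im (f y) + (a * complex.Re (f y) + complex.Re (g y)))%R.
    by apply/funext => y; case: (f y) => ? ?; case: (g y) => ? ? /=; ring.
  have eI : (fun y => complex.Im (Complex a b * f y + g y)%R) =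
      (fun y => b * complex.Re (f y) + (a * complex.Im (f y) + complex.Im (g y)))%R.
    by apply/funext => y; case: (f y) => ? ?; case: (g y) => ? ? /=; ring.
  rewrite eR eI (block_coef_linear k (- b)%R jf (locD a _ _ rf rg)).
  rewrite (block_coef_linear k b rf (locD a _ _ jf jg)).
  rewrite (block_coef_linear k a rf rg) (block_coef_linear k a jf jg).
  by apply/eqP; rewrite eq_complex /=; apply/andP; split; apply/eqP; ring.
have ae f g x : cmeasurable lam Rplus f -> cmeasurable lam Rplus g ->
    ae_eq lam Rplus f g -> block_average f x = block_average g x.
  move=> [mfr mfi] [mgr mgi] fg; rewrite /block_average; congr Complex.
    apply: block_coef_ae; [exact: mfr|exact: mgr|].
    by apply: filterS fg => y h Ry; rewrite (h Ry).
  apply: block_coef_ae; [exact: mfi|exact: mgi|].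
  by apply: filterS fg => y h Ry; rewrite (h Ry).
split.
- move=> f [mf [f1 [f2 [l1 l2 fE]]]]; split; first exact: measurable_block_average.
  exists (block_average f1), (block_average f2).
  have [C1 _ /(_ _ l1)[L1 _]] := block_average_L2.
  have [C2 _ /(_ _ l2)[L2' _]] := block_average_Loo.
  split; [exact: L1|exact: L2'|apply: aeW => x Rx].
  have [[m1 m1'] _] := l1; have [[m2 m2'] _] := l2.
  (* The decomposition holds only almost everywhere, but the averages do not see null sets. The
     factor 1 puts the sum into the form of [lin]. *)
  have -> : block_average f x = block_average (fun y => 1 * f1 y + f2 y)%R x.
    apply: ae; [exact: mf| |by apply: filterS fE => y h Ry; rewrite (h Ry) mul1r].
    split.
      rewrite (_ : (fun _ => _) =
        fun y => (complex.Re (f1 y) + complex.Re (f2 y))%R).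
        exact: measurable_funD m1 m2.
      by apply/funext => y; rewrite mul1r; case: (f1 y); case: (f2 y).
    rewrite (_ : (fun _ => _) =
      fun y => (complex.Im (f1 y) + complex.Im (f2 y))%R).
      exact: measurable_funD m1' m2'.
    by apply/funext => y; rewrite mul1r; case: (f1 y); case: (f2 y).
  by rewrite (lin _ _ _ _ (L2_locL2C l1) (Loo_locL2C l2)) mul1r.
- move=> f g [mf _] [mg _] fg; apply: aeW => x _; exact: ae mf mg fg.
- move=> a f g sf sg; apply: aeW => x _.
  exact: lin (sum_space_locL2C sf) (sum_space_locL2C sg).
Qed.

(** Evaluates the operator on G itself. With the weights chosen later the value is the square root
    of 2^-k int_{J k} G^2, the quantity that dominates the counterexamples. *)
Lemma block_average_ge (k : int) x : dyadic k x -> (0 <= alpha k)%R ->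
  Normc.normc (block_average (fun y => Complex (G y) 0%R) x) =
  (alpha k * \int[lam]_(y in J k) (G y ^+ 2))%R.
Proof.
move=> kx a0; rewrite /block_average (dyadic_index_eq kx)/=.
have -> : block_coef k (fun=> 0%R) = 0%R.
  rewrite /block_coef /Rintegral (eq_integral (fun=> 0)).
    by rewrite integral0 mulr0.
  by move=> y _; rewrite mulr0.
rewrite expr0n addr0 sqrtr_sqr ger0_norm// mulr_ge0//.
by apply: Rintegral_ge0 => y _; rewrite -expr2 sqr_ge0.
Qed.

End block_averages.

(** * Energy of a nonincreasing function and its partition into blocks *)

Section blocks.
Context {R : realType}.
Local Notation lam := (@completed_lebesgue_measure R).
Local Notation cT := (caratheodory_type (@wlength R idfun)^*%mu).

(** The Borel measure is the image of the completed one under the identity map. It is used for the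
    continuity of an integral in its upper limit. *)
Lemma completed_integralE (f : R -> \bar R) (D : set R) :
  measurable (D : set (measurableTypeR R)) ->
  measurable_fun (D : set (measurableTypeR R)) f ->
  (forall x, D x -> 0 <= f x) ->
  \int[lam]_(x in D) f x = \int[lebesgue_measure]_(x in D) f x.
Proof.
move=> mD mf f0.
have mid : measurable_fun (setT : set cT) (fun x : cT => x : measurableTypeR R).
  by move=> _ Y mY; rewrite setTI; exact: completed_measurable.
have E := @ge0_integral_pushforward _ _ cT (measurableTypeR R) R _ mid lam D f mD mf.
transitivity (\int[pushforward lam (fun x : cT => x : measurableTypeR R)]_(y in D) f y).
  by apply/esym; apply: E => x; rewrite inE; exact: f0.
by apply: eq_measure_integral => A mA _.
Qed.

Definition nonneg_ninc (F : R -> R) :=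
  (forall x, Rplus x -> 0 <= F x)%R /\
  forall s t, Rplus s -> (s <= t)%R -> (F t <= F s)%R.

Lemma nonneg_ninc_borel (F : R -> R) : nonneg_ninc F ->
  measurable_fun (Rplus : set (measurableTypeR R)) F.
Proof.
move=> [_ nF]; apply: (measurability _ (RGenOInfty.measurableE R)).
move=> _ [_ [r ->] <-].
apply: is_interval_measurable => x y [Rx fx] [Ry fy] z /andP[xz zy].
have Rz : Rplus z by rewrite !RplusE in Rx *; exact: lt_le_trans xz.
split=> //=; move: fy; rewrite /= !in_itv/= !andbT => fy.
by rewrite (lt_le_trans fy)// nF.
Qed.

Lemma nonneg_ninc_measurable (F : R -> R) : nonneg_ninc F ->
  measurable_fun (Rplus : set cT) F.
Proof.
move=> nF _ Y mY; apply: completed_measurable.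
by apply: nonneg_ninc_borel => //; exact: measurable_itv.
Qed.

Lemma Mplus_nonneg_ninc (F : R -> R) : nonneg_ninc F ->
  Mplus lam Rplus (EFin \o F).
Proof.
move=> nF; split; last by move=> x Rx; rewrite lee_fin; exact: nF.1.
exact/measurable_EFinP/nonneg_ninc_measurable.
Qed.

Lemma nonneg_ninc_scale (c : R) (F : R -> R) : (0 <= c)%R -> nonneg_ninc F ->
  nonneg_ninc (fun x => c * F x)%R.
Proof.
move=> c0 [F0 nF]; split=> [x Rx|s t Rs st]; first by rewrite mulr_ge0// F0.
by rewrite ler_wpM2l// nF.
Qed.

Section one_function.
Variables (G : R -> R) (nG : nonneg_ninc G).

Let m2 (A : set R) : A `<=` Rplus ->
  measurable_fun (A : set cT) (fun x => (G x ^+ 2)%:E).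
Proof.
move=> AR; apply: measurable_funS measurable_Rplus AR _.
by apply/measurable_EFinP; apply: measurable_funX; exact: nonneg_ninc_measurable.
Qed.

Let ocR (s t : R) : (0 <= s)%R -> `]s, t]%classic `<=` @Rplus R.
Proof. by move=> s0 x; rewrite /= in_itv/= RplusE => /andP[+ _]; exact: le_lt_trans. Qed.

Hypothesis Gfin : forall t : R, \int[lam]_(x in `]0%R, t]) (G x ^+ 2)%:E < +oo.

Definition energy (t : R) : R := fine (\int[lam]_(x in `]0%R, t]) (G x ^+ 2)%:E).

Lemma energyE t : (energy t)%:E = \int[lam]_(x in `]0%R, t]) (G x ^+ 2)%:E.
Proof.
rewrite /energy fineK// ge0_fin_numE; first exact: Gfin.
by apply: integral_ge0 => x _; rewrite lee_fin sqr_ge0.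
Qed.

Lemma energy_ge0 t : (0 <= energy t)%R.
Proof. by apply: fine_ge0; apply: integral_ge0 => x _; rewrite lee_fin sqr_ge0. Qed.

Lemma energyB s t : (0 <= s)%R -> (s <= t)%R ->
  \int[lam]_(x in `]s, t]) (G x ^+ 2)%:E = (energy t - energy s)%:E.
Proof.
move=> s0 st; rewrite EFinB !energyE.
have E : `]0%R, t]%classic = `]0%R, s]%classic `|` `]s, t]%classic.
  by rewrite -itv_bndbnd_setU// bnd_simp.
rewrite E ge0_integral_setU; first last.
- apply/eqP/seteqP; split=> // x [] /=; rewrite !in_itv/= => /andP[_ xs] /andP[sx _].
  by have := lt_le_trans sx xs; rewrite ltxx.
- by move=> x _; rewrite lee_fin sqr_ge0.
- by rewrite -E; apply: m2; exact: ocR.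
- exact: completed_measurable_itv.
- exact: completed_measurable_itv.
by rewrite -energyE addeAC subee// add0e.
Qed.

Lemma energy_homo s t : (0 <= s)%R -> (s <= t)%R -> (energy s <= energy t)%R.
Proof.
move=> s0 st; rewrite -subr_ge0 -lee_fin -energyB//.
by apply: integral_ge0 => x _; rewrite lee_fin sqr_ge0.
Qed.

(** The energy is 0 at 0 and continuous, as the indefinite integral of an integrable function; the
    intermediate value theorem applies. *)
Lemma energy_ivt (Y v : R) : (0 <= Y)%R -> (0 <= v <= energy Y)%R ->
  exists2 y, (0 <= y)%R & energy y = v.
Proof.
move=> Y0 /andP[v0 vY].
(* G is arbitrary at 0 and below, while the integral over [0, t] includes 0; the square is therefore
   extended by 0. *)
pose g : R -> R := fun x => (if x \in Rplus then G x ^+ 2 else 0)%R.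
have mg : measurable_fun (setT : set (measurableTypeR R)) g.
  apply: (measurable_fun_if (measurableT)).
  - apply: (measurable_fun_bool true).
    rewrite setTI (_ : _ @^-1` _ = Rplus); first exact: measurable_itv.
    by apply/seteqP; split=> x /=; rewrite ?inE// => /asboolP.
  - rewrite setTI (_ : _ @^-1` _ = Rplus); last first.
      by apply/seteqP; split=> x /=; rewrite ?inE// => /asboolP.
    by apply: measurable_funX; exact: nonneg_ninc_borel.
  - exact: measurable_cst.
have g0 x : (0 <= g x)%R by rewrite /g; case: ifP => // _; rewrite sqr_ge0.
have gE t : \int[lebesgue_measure]_(x in `[0%R, t]) (g x)%:E =
    \int[lam]_(x in `]0%R, t]) (G x ^+ 2)%:E.
  rewrite -completed_integralE; first last.
  - by move=> x _; rewrite lee_fin.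
  - by apply/measurable_EFinP; exact: measurable_funTS.
  - exact: measurable_itv.
  rewrite [LHS]integral_mkcond [RHS]integral_mkcond; apply: eq_integral => x _.
  rewrite /patch /g; case: ifPn => x1; case: ifPn => x2 //.
  - rewrite ifT//; move: x1 x2; rewrite !inE/= !in_itv/= RplusE.
    by move=> /andP[_ ->] ->.
  - rewrite ifF//; apply/negbTE; apply: contra x2; rewrite !inE.
    exact: (ocR (lexx 0%R)).
  - exfalso; move/negP: x1; apply; move: x2; rewrite !inE/= !in_itv/=.
    by move=> /andP[/ltW -> ->].
have ig t : lebesgue_measure.-integrable `[0%R, t] (EFin \o g).
  apply/integrableP; split.
    by apply/measurable_EFinP; exact: measurable_funTS.
  under eq_integral do rewrite gee0_abs ?lee_fin//.
  by rewrite gE; exact: Gfin.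
have cont := parameterized_integral_continuous Y0 (ig Y).
have eP t : parameterized_integral lebesgue_measure 0%R t g = energy t.
  by rewrite /parameterized_integral /Rintegral gE.
have e0 : energy 0 = 0%R.
  by rewrite /energy set_itv_ge ?bnd_simp ?ltxx// integral_set0.
have [|c cY cv] := IVT (v := v) Y0 cont.
  by rewrite !eP e0 min_l ?max_r ?energy_ge0// v0.
exists c; last by rewrite -cv eP.
by move: cY; rewrite in_itv/= => /andP[].
Qed.

(* The block J k ends where the energy of G reaches D k, or at 2^k if that comes
   first; this cut-off keeps its length below 2^k without losing energy. *)
Lemma energy_blocks (D : int -> R) :
  (forall k, 0 <= D k <= energy (2 ^ k))%R ->
  {homo D : k l / (k <= l)%R >-> (k <= l)%R} ->
  exists J : int -> set R,
  [/\ forall k, measurable (J k : set cT), forall k, J k `<=` Rplus,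
      trivIset setT J,
      forall k, (lam : {measure set cT -> \bar R}) (J k) <= (2 ^ k)%R%:E &
      forall k, (D k - D (k - 1)%R)%:E <= \int[lam]_(x in J k) (G x ^+ 2)%:E].
Proof.
move=> De nD.
(* The endpoint is chosen as a function of the value v and not of the index k, so that equal values
   of D share one endpoint. The monotonicity [yD] depends on this. *)
have /choice[y yP] : forall v : R, exists y : R, (0 <= y)%R /\
    ((exists k, v = D k) -> energy y = v).
  move=> v; have [[k vk]|nv] := pselect (exists k, v = D k); last by exists 0%R.
  have [||y y0 yv] := @energy_ivt (2 ^ k) v; first exact: exprz_ge0.
    by rewrite vk; exact: De.
  by exists y.
have y0 v : (0 <= y v)%R by have [] := yP v.
have ey k : energy (y (D k)) = D k by have [_] := yP (D k); apply; exists k.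
have yD k l : (k <= l)%R -> (y (D k) <= y (D l))%R.
  move=> kl; rewrite leNgt; apply/negP => ylk.
  have := energy_homo (y0 _) (ltW ylk); rewrite !ey => Dlk.
  have E : D k = D l by apply/le_anti; rewrite Dlk nD.
  by rewrite E ltxx in ylk.
pose t k := Num.min (y (D k)) (2 ^ k)%R.
have t0 k : (0 <= t k)%R by rewrite le_min y0 exprz_ge0.
(* If the cut-off is active, 2^k < y (D k), then the energy at 2^k is at most D k by monotonicity
   and at least D k by hypothesis. *)
have et k : energy (t k) = D k.
  rewrite /t minEle; case: ifPn => [_|]; first exact: ey.
  rewrite -ltNge => h; apply/le_anti/andP; split; last by have /andP[] := De k.
  by rewrite -[leRHS]ey energy_homo ?exprz_ge0// ltW.
exists (fun k => `]y (D (k - 1)%R), t k]%classic); split.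
- by move=> k; exact: completed_measurable_itv.
- by move=> k; exact: ocR.
- apply/trivIsetP => i j _ _; wlog ij : i j / (i < j)%R.
    move=> h /[dup] ij; rewrite neq_lt => /orP[|] ij'; first exact: h.
    by rewrite setIC; apply: h => //; rewrite eq_sym.
  move=> _; apply/seteqP; split=> // x [] /=; rewrite !in_itv/=.
  move=> /andP[_ xi] /andP[jx _].
  have := lt_le_trans jx xi; rewrite ltNge => /negP; apply.
  rewrite (@le_trans _ _ (y (D i)))//; first by rewrite /t ge_min lexx.
  by apply: yD; lia.
- move=> k; rewrite completed_lebesgue_itv/=; case: ifPn => _.
    rewrite -EFinB lee_fin (@le_trans _ _ (t k))//.
      by rewrite gerBl.
    by rewrite /t ge_min lexx orbT.
  by rewrite lee_fin exprz_ge0.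
- move=> k; have [st|ts] := leP (y (D (k - 1)%R)) (t k).
    by rewrite energyB// et ey.
  rewrite (@le_trans _ _ 0)//; last first.
    by apply: integral_ge0 => x _; rewrite lee_fin sqr_ge0.
  rewrite lee_fin subr_le0 -{1}(et k) -(ey (k - 1)%R).
  by apply: energy_homo => //; exact: ltW.
Qed.

End one_function.

End blocks.

(** * The gluing argument *)

Section K_monotonicity.
Context {R : realType}.
Local Notation lam := (@completed_lebesgue_measure R).
Local Notation cT := (caratheodory_type (@wlength R idfun)^*%mu).
Local Notation L2 := (Lp_norm lam (@Rplus R) 2%:E).
Local Notation Loo := (Lp_norm lam (@Rplus R) +oo).

Lemma exists_exp2_gt (t : R) : exists k : nat, (t < 2 ^+ k)%R.
Proof.
exists (Num.bound `|t|%R).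
rewrite (le_lt_trans (ler_norm t))// (lt_le_trans (archi_boundP (normr_ge0 t)))//.
by rewrite -natrX ler_nat; exact/ltnW/ltn_expl.
Qed.

Lemma itv0_Rplus (t : R) : `]0%R, t]%classic `<=` @Rplus R.
Proof. by move=> x; rewrite /= in_itv/= RplusE => /andP[]. Qed.

Lemma nonneg_ninc_measurable_sqr (F : R -> R) (A : set R) : nonneg_ninc F ->
  A `<=` Rplus -> measurable_fun (A : set cT) (fun x => (F x ^+ 2)%:E).
Proof.
move=> nF AR; apply: measurable_funS measurable_Rplus AR _.
by apply/measurable_EFinP; apply: measurable_funX; exact: nonneg_ninc_measurable.
Qed.

(** The local square integrability of the sum space, applied to the nested intervals (0, 2^k] in
    place of disjoint blocks. *)
Lemma sum_space_sqr_lty (h : R -> R[i]) (t : R) : sum_space lam Rplus L2 Loo h ->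
  \int[lam]_(x in `]0%R, t]) (Normc.normc (h x) ^+ 2)%:E < +oo.
Proof.
move=> sh; pose J (k : int) : set R := `]0%R, (2 ^ k)%R]%classic.
have mJ k : measurable (J k : set cT) by exact: completed_measurable_itv.
have JR k : J k `<=` Rplus.
  by move=> x; rewrite /J /= in_itv/= RplusE => /andP[].
have lamJ k : (lam : {measure set cT -> \bar R}) (J k) <= (2 ^ k)%R%:E.
  by rewrite completed_lebesgue_itv/= lte_fin exprz_gt0// oppr0 adde0.
have [[mr mi] fin] := sum_space_locL2C mJ JR lamJ sh.
have [k tk] := exists_exp2_gt t.
apply: le_lt_trans (fin k%:Z); apply: ge0_subset_integral.
- exact: completed_measurable_itv.
- exact: mJ.
- apply: measurable_funS measurable_Rplus (JR _) _.
  apply/measurable_EFinP; under eq_fun do rewrite normc_sqr.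
  exact: measurable_funD (measurable_funX 2 mr) (measurable_funX 2 mi).
- by move=> x _; rewrite lee_fin sqr_ge0.
- move=> x; rewrite /J /= !in_itv/= => /andP[-> xt]/=.
  by rewrite (le_trans xt)// ltW.
Qed.

Lemma le_partial_nneseries (u : nat -> \bar R) n : (forall i, 0 <= u i) ->
  \sum_(0 <= i < n) u i <= \sum_(0 <= i <oo) u i.
Proof. by move=> u0; apply: nneseries_lim_ge => i _ _. Qed.

Lemma le_term_nneseries (u : nat -> \bar R) i : (forall i, 0 <= u i) ->
  u i <= \sum_(0 <= j <oo) u j.
Proof.
move=> u0; apply: le_trans (le_partial_nneseries i.+1 u0).
by rewrite big_nat_recr//= leeDr// sume_ge0.
Qed.

Lemma nneseries_geometric : \sum_(0 <= i <oo) (2 ^- i : R)%:E <= 2%:E.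
Proof.
apply: lime_le; first by apply: is_cvg_nneseries => i _ _; rewrite lee_fin invr_ge0 exprn_ge0.
apply: nearW => n; rewrite sumEFin lee_fin.
have -> : (\sum_(0 <= i < n) 2 ^- i = 2 - 2 * 2 ^- n :> R)%R.
  elim: n => [|n IH]; first by rewrite big_geq// expr0 invr1 mulr1 subrr.
  by rewrite big_nat_recr//= IH exprS; field; rewrite expf_neq0.
by rewrite gerBl mulr_ge0// invr_ge0 exprn_ge0.
Qed.

(** The right side is twice the square root of a / (2 p), which is at least the square root of a / p
    and so at least v. With p = 2^(k-1) and a the energy of G on a block, it is twice the value of
    the operator at G. For a = 0 the inverse is 0 by convention, and v = 0. *)
Lemma le_sqrt_average (p a v : R) : (0 < p)%R -> (0 <= a)%R -> (0 <= v)%R ->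
  (p * v ^+ 2 <= a)%R -> (v <= 2 * ((Num.sqrt (2 * p * a))^-1 * a))%R.
Proof.
move=> p0 a0 v0 va; move: a0; rewrite le_eqVlt => /predU1P[a0|a0].
  move: va; rewrite -a0 pmulr_rle0// => v2; rewrite !mulr0.
  by rewrite leNgt; apply/negP => v1; move: v2; rewrite leNgt exprn_gt0.
have q0 : (0 < 2 * p * a)%R by rewrite !mulr_gt0.
set s := Num.sqrt _; have s0 : (0 < s)%R by rewrite sqrtr_gt0.
have s2 : (s ^+ 2 = 2 * p * a)%R by rewrite sqr_sqrtr// ltW.
rewrite mulrCA mulrC ler_pdivlMr// -(ler_pXn2r (n := 2)) ?nnegrE ?mulr_ge0 ?(ltW s0) ?(ltW a0)//.
by rewrite !exprMn s2; nra.
Qed.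

Variables (rhobar : (R -> \bar R) -> \bar R).
Hypothesis rhobar_ri : ri_norm lam Rplus rhobar.
Hypothesis interp : interpolation_space lam Rplus L2 Loo rhobar.

Lemma nonneg_ninc_energy_eq0 (F : R -> R) : nonneg_ninc F ->
  (forall t : R, (0 < t)%R -> \int[lam]_(x in `]0%R, t]) (F x ^+ 2)%:E <= 0) ->
  forall t, Rplus t -> F t = 0%R.
Proof.
move=> nF F2 t Rt; have t0 : (0 < t)%R by rewrite -RplusE.
have : \int[lam]_(x in `]0%R, t]) (F t ^+ 2)%:E <= 0.
  apply: le_trans (F2 t t0); apply: ge0_le_integral.
  - exact: completed_measurable_itv.
  - by move=> x _; rewrite lee_fin sqr_ge0.
  - exact: measurable_cst.
  - exact: nonneg_ninc_measurable_sqr nF (@itv0_Rplus t).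
  - move=> x; rewrite /= in_itv/= lee_fin => /andP[x0 xt].
    have Rx : Rplus x by rewrite RplusE.
    by rewrite ler_pXn2r ?nnegrE ?nF.1// nF.2.
rewrite integral_cst; last exact: completed_measurable_itv.
rewrite completed_lebesgue_itv/= lte_fin t0 oppr0 adde0 -EFinM lee_fin.
rewrite pmulr_lle0// => h; apply/eqP; rewrite -sqrf_eq0.
by apply/eqP/le_anti; rewrite h sqr_ge0.
Qed.

Lemma interpolation_monotone : exists2 C : R, (0 < C)%R &
  forall F G, nonneg_ninc F -> nonneg_ninc G ->
  (forall t : R, \int[lam]_(x in `]0%R, t]) (G x ^+ 2)%:E < +oo) ->
  (forall t : R, (0 < t)%R -> \int[lam]_(x in `]0%R, t]) (F x ^+ 2)%:E <=
     \int[lam]_(x in `]0%R, t]) (G x ^+ 2)%:E) ->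
  rhobar (EFin \o F) <= C%:E * rhobar (EFin \o G).
Proof.
apply: contrapT => nC.
(* The ratio 8^i = 2^i 4^i is split by the scaling c_i = 2^-i / [rhobar] G_i: the scaled G_i have
   norm 2^-i and are summable, while the scaled F_i have norm above 4^i. *)
have /choice[FG FGP] : forall i : nat, exists FG : (R -> R) * (R -> R),
  [/\ nonneg_ninc FG.1, nonneg_ninc FG.2,
   (forall t : R, \int[lam]_(x in `]0%R, t]) (FG.2 x ^+ 2)%:E < +oo),
   (forall t : R, (0 < t)%R -> \int[lam]_(x in `]0%R, t]) (FG.1 x ^+ 2)%:E <=
     \int[lam]_(x in `]0%R, t]) (FG.2 x ^+ 2)%:E) &
   (8 ^+ i)%:E * rhobar (EFin \o FG.2) < rhobar (EFin \o FG.1)].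
  move=> i; apply: contrapT => h; apply: nC; exists (8 ^+ i)%R.
    by rewrite exprn_gt0.
  move=> F G nF nG finG le; rewrite leNgt; apply/negP => lt.
  by apply: h; exists (F, G).
pose F i := (FG i).1; pose G' i := (FG i).2; pose r i := rhobar (EFin \o G' i).
have nF i : nonneg_ninc (F i) by have [] := FGP i.
have nG' i : nonneg_ninc (G' i) by have [] := FGP i.
have rF i : (8 ^+ i)%:E * r i < rhobar (EFin \o F i) by have [] := FGP i.
have MF i := Mplus_nonneg_ninc (nF i).
have MG' i := Mplus_nonneg_ninc (nG' i).
have msq (u : R -> R) (t : R) : nonneg_ninc u ->
    measurable_fun (`]0%R, t] : set cT) (fun x => (u x ^+ 2)%:E).
  by move=> nu; exact: nonneg_ninc_measurable_sqr nu (@itv0_Rplus t).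
have sq0 (u : R -> R) (A : set R) : 0 <= \int[lam]_(x in A) (u x ^+ 2)%:E.
  by apply: integral_ge0 => x _; rewrite lee_fin sqr_ge0.
(* If G_i had norm 0 it would vanish almost everywhere, and the energy comparison would make F_i
   vanish too, against the strict inequality. *)
have r0 i : 0 < r i.
  rewrite lt_neqAle (ri_norm_ge0 rhobar_ri (MG' i)) andbT eq_sym.
  apply/eqP => r0; have := rF i; rewrite r0 mule0.
  have /(ri_norm_eq0 rhobar_ri (MG' i)) G0 := r0.
  rewrite (ri_norm_ext rhobar_ri (MF i) (Mplus_cst _ _ (lexx 0))).
    by rewrite (ri_norm0 rhobar_ri) ltxx.
  move=> x Rx; congr EFin; apply: (nonneg_ninc_energy_eq0 (nF i)) Rx => t t0.
  have [_ _ _ /(_ t t0) le _] := FGP i; apply: le_trans le _.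
  rewrite (ae_eq_integral (cst 0)).
  - by rewrite integral0.
  - exact: completed_measurable_itv.
  - exact: (msq _ _ (nG' i)).
  - exact: measurable_cst.
  - apply: filterS G0 => y + /=; rewrite in_itv/= => h /andP[y0 _].
    have := h; rewrite RplusE => /(_ y0) [E].
    by rewrite (_ : (FG i).2 y = 0%R) ?expr0n.
have rfin i : r i < +oo.
  rewrite ltey; apply/eqP => ri; have := rF i.
  by rewrite ri gt0_muley ?lte_fin ?exprn_gt0// ltNge leey.
pose c i := (2 ^- i / fine (r i))%R.
have fr0 i : (0 < fine (r i))%R by rewrite fine_gt0// r0 rfin.
have rE i : r i = (fine (r i))%:E by rewrite fineK// ge0_fin_numE ?rfin// ltW.
have c0 i : (0 < c i)%R by rewrite divr_gt0// invr_gt0 exprn_gt0.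
pose f i x := (c i * F i x)%R; pose g i x := (c i * G' i x)%R.
have nf i : nonneg_ninc (f i) by apply: nonneg_ninc_scale => //; exact: ltW.
have ng i : nonneg_ninc (g i) by apply: nonneg_ninc_scale => //; exact: ltW.
have Mf i := Mplus_nonneg_ninc (nf i).
have Mg i := Mplus_nonneg_ninc (ng i).
have rg i : rhobar (EFin \o g i) = (2 ^- i)%:E.
  rewrite (_ : EFin \o g i = fun x => (c i)%:E * (EFin \o G' i) x)//.
  rewrite (ri_normZ rhobar_ri (c0 i) (MG' i)) -/(r i) rE -EFinM.
  by congr EFin; rewrite /c divfK// gt_eqF.
have rf i : (4 ^+ i)%:E < rhobar (EFin \o f i).
  rewrite (_ : EFin \o f i = fun x => (c i)%:E * (EFin \o F i) x)//.
  rewrite (ri_normZ rhobar_ri (c0 i) (MF i)).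
  rewrite (_ : (4 ^+ i)%:E = (c i)%:E * ((8 ^+ i)%:E * r i)).
    by rewrite lte_pmul2l ?lte_fin.
  rewrite rE -!EFinM; congr EFin; rewrite /c.
  have -> : (8 ^+ i = 2 ^+ i * 4 ^+ i :> R)%R by rewrite -exprMn; congr (_ ^+ _)%R; ring.
  by field; rewrite expf_neq0// gt_eqF.
have sqZ (k : R) (u : R -> R) (t : R) : nonneg_ninc u ->
    \int[lam]_(x in `]0%R, t]) ((k * u x) ^+ 2)%:E =
    (k ^+ 2)%:E * \int[lam]_(x in `]0%R, t]) (u x ^+ 2)%:E.
  move=> nu; under eq_integral do rewrite exprMn EFinM.
  rewrite ge0_integralZl; first last.
  - by rewrite lee_fin sqr_ge0.
  - by move=> x _; rewrite lee_fin sqr_ge0.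
  - exact: (msq _ _ nu).
  - exact: completed_measurable_itv.
  by [].
have fg i (t : R) : (0 < t)%R -> \int[lam]_(x in `]0%R, t]) (f i x ^+ 2)%:E <=
     \int[lam]_(x in `]0%R, t]) (g i x ^+ 2)%:E.
  move=> t0; rewrite !sqZ//; apply: lee_wpmul2l; first by rewrite lee_fin sqr_ge0.
  by have [_ _ _ /(_ t t0)] := FGP i.
(* The counterexamples are glued into one function S, which is finite on R_+. *)
pose S x := \sum_(0 <= i <oo) (g i x)%:E.
have MS : Mplus lam Rplus S.
  split; last by move=> x Rx; apply: nneseries_ge0 => i _ _; rewrite lee_fin (ng i).1.
  apply: (ge0_emeasurable_sum (P := xpredT)).
  - by move=> k x Rx _; rewrite lee_fin (ng k).1.
  - by move=> k _; case: (Mg k).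
have rS : rhobar S <= 2%:E.
  apply: le_trans (ri_norm_nneseries rhobar_ri Mg) _.
  apply: le_trans nneseries_geometric; apply: lee_nneseries => [i _ _|i _].
    by rewrite rg lee_fin invr_ge0 exprn_ge0.
  by rewrite rg.
have Sninc x y : Rplus x -> (x <= y)%R -> S y <= S x.
  move=> Rx xy; have Ry : Rplus y by rewrite !RplusE in Rx *; exact: lt_le_trans xy.
  apply: lee_nneseries => [i _ _|i _]; first by rewrite lee_fin (ng i).1.
  by rewrite lee_fin (ng i).2.
(* As S is nonincreasing, S x = +oo would make it infinite on (0, x], although a function of finite
   norm is integrable there. *)
have Sfin x : Rplus x -> S x < +oo.
  move=> Rx; have x0 : (0 < x)%R by rewrite -RplusE.
  have ocR : `]0%R, x] `<=` @Rplus R.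
    by move=> y; rewrite /= in_itv/= RplusE => /andP[].
  have [|||C _ /(_ _ MS)] := ri_norm_integral rhobar_ri (E := `]0%R, x]%classic).
  - exact: completed_measurable_itv.
  - exact: ocR.
  - by rewrite completed_lebesgue_itv/= lte_fin x0 oppr0 adde0 ltry.
  move=> leC; rewrite ltey; apply/eqP => Sx.
  have : \int[lam]_(y in `]0%R, x]) cst +oo y <= C%:E * rhobar S.
    apply: le_trans leC; apply: ge0_le_integral.
    - exact: completed_measurable_itv.
    - by move=> y _; exact: leey.
    - exact: measurable_cst.
    - exact: measurable_funS measurable_Rplus ocR MS.1.
    - move=> y yx; rewrite -Sx; apply: Sninc; first exact: ocR.
      by move: yx; rewrite /= in_itv/= => /andP[].
  rewrite integral_cst; last exact: completed_measurable_itv.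
  rewrite completed_lebesgue_itv/= lte_fin x0 oppr0 adde0 gt0_mulye ?lte_fin// leNgt.
  rewrite ltey_eq => /negP; apply; rewrite fin_numM//.
  by rewrite ge0_fin_numE ?(le_lt_trans rS) ?ltry//; exact: (ri_norm_ge0 rhobar_ri).
pose G x := fine (S x).
have GE x : Rplus x -> (G x)%:E = S x.
  by move=> Rx; rewrite fineK// ge0_fin_numE ?Sfin//; exact: MS.2.
have nG : nonneg_ninc G.
  split=> [x Rx|s t Rs st]; first by rewrite -lee_fin GE//; exact: MS.2.
  have Rt : Rplus t by rewrite !RplusE in Rs *; exact: lt_le_trans st.
  by rewrite -lee_fin !GE// Sninc.
have MG := Mplus_nonneg_ninc nG.
have rG : rhobar (EFin \o G) <= 2%:E.
  by rewrite (ri_norm_ext rhobar_ri MG MS)// => x; exact: GE.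
pose h x : R[i] := Complex (G x) 0%R.
have hE x : Rplus x -> modulus h x = (G x)%:E.
  by move=> Rx; rewrite /modulus normc_real ger0_norm//; exact: nG.1.
have ch : cmeasurable lam Rplus h.
  by split; [exact: nonneg_ninc_measurable|exact: measurable_cst].
have Mh : Mplus lam Rplus (modulus h).
  split; last by move=> x _; rewrite lee_fin normc_ge0.
  by apply: eq_measurable_fun MG.1 => x; rewrite inE => Rx; rewrite hE.
have rh : rhobar (modulus h) = rhobar (EFin \o G).
  by apply: (ri_norm_ext rhobar_ri Mh MG).
have Lh : Lspace_of lam Rplus rhobar h.
  by split=> //; rewrite rh (le_lt_trans rG)// ltry.
have Gfin t : \int[lam]_(x in `]0%R, t]) (G x ^+ 2)%:E < +oo.
  have [C _ /(_ _ Lh)[/(sum_space_sqr_lty t) + _]] := sum_embedding interp.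
  congr (_ < _); apply: eq_integral => x _.
  by rewrite normc_real real_normK ?num_real.
(* For nonnegative terms the sum of the squares is at most the square of the sum. So the energy of G
   controls the sum of all energies, and a single sequence of blocks serves every i. *)
have partial n (t : R) : \sum_(0 <= i < n) \int[lam]_(x in `]0%R, t]) (g i x ^+ 2)%:E
    <= \int[lam]_(x in `]0%R, t]) (G x ^+ 2)%:E.
  rewrite -ge0_integral_sum; first last.
  - by move=> i x _; rewrite lee_fin sqr_ge0.
  - by move=> i; exact: (msq _ _ (ng i)).
  - exact: completed_measurable_itv.
  apply: ge0_le_integral.
  - exact: completed_measurable_itv.
  - by move=> x _; apply: sume_ge0 => i _; rewrite lee_fin sqr_ge0.
  - by apply: emeasurable_sum => i; exact: (msq _ _ (ng i)).
  - exact: (msq _ _ nG).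
  - move=> x; rewrite /= in_itv/= => /andP[x0 _].
    have Rx : Rplus x by rewrite RplusE.
    rewrite sumEFin lee_fin; apply: (@le_trans _ _ ((\sum_(0 <= i < n) g i x) ^+ 2)%R).
      have s0 m : (0 <= \sum_(0 <= i < m) g i x)%R.
        by apply: sumr_ge0 => i _; exact: (ng i).1.
      elim: n => [|n IH]; first by rewrite !big_geq// expr0n.
      rewrite !big_nat_recr//= sqrrD -addrA [in leRHS]addrC -addrA.
      have h1 := s0 n; have h2 := (ng n).1 x Rx.
      have : (0 <= (\sum_(0 <= i < n) g i x) * g n x)%R by exact: mulr_ge0.
      by move: IH; lra.
    have Sx : (\sum_(0 <= i < n) g i x <= G x)%R.
      rewrite -lee_fin GE// -sumEFin; apply: le_partial_nneseries => i.
      by rewrite lee_fin (ng i).1.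
    rewrite ler_pXn2r// nnegrE; last exact: nG.1.
    by apply: sumr_ge0 => i _; exact: (ng i).1.
have ffin i t : \int[lam]_(x in `]0%R, t]) (f i x ^+ 2)%:E < +oo.
  have [t0|t0] := ltP 0%R t; last first.
    by rewrite set_itv_ge ?bnd_simp -?leNgt// integral_set0.
  apply: le_lt_trans (fg i t t0) _; rewrite sqZ// lte_mul_pinfty//.
  - by rewrite lee_fin sqr_ge0.
  - by have [_ _ /(_ t)] := FGP i.
(* The total energy of the f_i up to 2^k, which that of G dominates. *)
pose DE (k : int) := \sum_(0 <= i <oo) (energy (f i) (2 ^ k)%R)%:E.
have e0 i t : 0 <= (energy (f i) t)%:E by rewrite lee_fin energy_ge0.
have p20 (k : int) : (0 <= 2 ^ k :> R)%R by exact: exprz_ge0.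
have p2S (k : int) : (2 ^ k = 2 * 2 ^ (k - 1) :> R)%R.
  by rewrite -{1}(subrK 1%R k) expfzDr// expr1z mulrC.
have DEG k : DE k <= (energy G (2 ^ k)%R)%:E.
  apply: lime_le; first by apply: is_cvg_nneseries => i _ _; exact: e0.
  apply: nearW => n; rewrite (energyE Gfin); apply: le_trans (partial n _).
  apply: lee_sum => i _; rewrite (energyE (ffin i)); apply: fg.
  exact: exprz_gt0.
have DE0 k : 0 <= DE k by apply: nneseries_ge0 => i _ _; exact: e0.
have [D DK] : exists D : int -> R, forall k, (D k)%:E = DE k.
  exists (fun k => fine (DE k)) => k.
  by rewrite fineK// ge0_fin_numE// (le_lt_trans (DEG k)) ?ltry.
have De k : (0 <= D k <= energy G (2 ^ k))%R.
  by rewrite -!lee_fin DK DE0 DEG.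
have nD : {homo D : k l / (k <= l)%R >-> (k <= l)%R}.
  move=> k l kl; rewrite -lee_fin (DK k) (DK l); apply: lee_nneseries => [i _ _|i _]; first exact: e0.
  rewrite lee_fin; apply: (energy_homo (nf i) (ffin i)); first exact: p20.
  by rewrite ler_eXz2l ?ltr1n.
(* By monotonicity the left side is at most the energy of f_i on (2^(k-1), 2^k], which is one term
   of the increment of the total energy. *)
have Dstep i k : (2 ^ (k - 1) * f i (2 ^ k) ^+ 2 <= D k - D (k - 1))%R.
  have p21 : (2 ^ (k - 1) <= 2 ^ k :> R)%R.
    by rewrite (p2S k) ler_peMl// ler1n.
  pose u j := (energy (f j) (2 ^ k) - energy (f j) (2 ^ (k - 1)))%R%:E.
  have u0 j : 0 <= u j.
    by rewrite lee_fin subr_ge0 (energy_homo (nf j) (ffin j)).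
  have DD : DE k = DE (k - 1)%R + \sum_(0 <= j <oo) u j.
    rewrite -nneseriesD; [|by move=> *; exact: e0|by move=> *; exact: u0].
    by apply: eq_eseriesr => j _; rewrite /u -EFinD addrC subrK.
  have : (D k)%:E = (D (k - 1)%R)%:E + \sum_(0 <= j <oo) u j.
    by rewrite (DK k) (DK (k - 1)%R).
  have := le_term_nneseries i u0; case: (\sum_(0 <= j <oo) u j) => [s| |].
  - rewrite -EFinD lee_fin => us [->]; rewrite addrAC subrr add0r.
    apply: le_trans us; rewrite -lee_fin -(energyB (nf i) (ffin i))//.
    have : \int[lam]_(x in `](2 ^ (k - 1))%R, (2 ^ k)%R]) ((f i (2 ^ k)%R) ^+ 2)%:E
      <= \int[lam]_(x in `](2 ^ (k - 1))%R, (2 ^ k)%R]) (f i x ^+ 2)%:E.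
      have ocR : `](2 ^ (k - 1))%R, (2 ^ k)%R] `<=` @Rplus R.
        by move=> y; rewrite /= in_itv/= RplusE => /andP[+ _]; exact: le_lt_trans.
      apply: ge0_le_integral.
      - exact: completed_measurable_itv.
      - by move=> x _; rewrite lee_fin sqr_ge0.
      - exact: measurable_cst.
      - exact: nonneg_ninc_measurable_sqr (nf i) ocR.
      - move=> x xI; rewrite lee_fin ler_pXn2r ?nnegrE.
        + by apply: (nf i).2; [exact: ocR|move: xI; rewrite /= in_itv/= => /andP[]].
        + by [].
        + by apply: (nf i).1; rewrite RplusE exprz_gt0.
        + by apply: (nf i).1; exact: ocR.
    rewrite integral_cst; last exact: completed_measurable_itv.
    rewrite completed_lebesgue_itv/= ifT.
      by rewrite -EFinB -EFinM (p2S k) mulrC; congr (_%:E <= _); ring.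
    by rewrite lte_fin (p2S k) ltr_pMl ?ltr1n// exprz_gt0.
  - by move=> _; rewrite addey.
  - by rewrite leNgt ltNye.
have [J [mJ JR tJ lamJ intJ]] := energy_blocks nG Gfin De nD.
have G2J k : \int[lam]_(x in J k) (G x ^+ 2)%:E < +oo.
  have := sum_embedding interp => -[C _ /(_ _ Lh)[sh _]].
  have [_ /(_ k)] := sum_space_locL2C mJ JR lamJ sh.
  congr (_ < _); apply: eq_integral => x _.
  by rewrite normc_real real_normK ?num_real.
pose a k := (\int[lam]_(x in J k) (G x ^+ 2))%R.
have aE k : (a k)%:E = \int[lam]_(x in J k) (G x ^+ 2)%:E.
  by rewrite /a /Rintegral fineK// ge0_fin_numE.
have a0 k : (0 <= a k)%R by rewrite -lee_fin aE.
(* The largest weights for which [block_average] is a contraction of L_2. *)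
pose alpha k := (Num.sqrt (2 ^ k * a k))^-1%R.
have alphaE k : (alpha k ^+ 2 * a k * 2 ^ k <= 1)%R.
  rewrite /alpha exprVn sqr_sqrtr ?mulr_ge0//.
  have [->|ak] := eqVneq (a k) 0%R; first by rewrite !(mulr0, mul0r) ler01.
  rewrite -mulrA (mulrC (a k)) mulVf// mulf_neq0// expfz_neq0//.
have mG := nonneg_ninc_measurable nG.
have [C C0 bC] := interpolation_property interp
  (block_average_linear_on_sum mJ JR tJ mG G2J lamJ alphaE)
  (block_average_L2 mJ JR tJ mG G2J alphaE)
  (block_average_Loo mJ JR mG G2J lamJ alphaE).
have [LT leT] := bC _ Lh.
have MT : Mplus lam Rplus (modulus (block_average G J alpha h)).
  by apply: Mplus_modulus; case: LT.
(* On the k-th dyadic interval f_i is at most f_i(2^k), and the operator at G is constant there;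
   [le_sqrt_average] compares the two. *)
have fT i x : Rplus x ->
    (f i x)%:E <= 2%:E * modulus (block_average G J alpha h) x.
  move=> Rx; have := dyadic_indexP Rx; set k := dyadic_index x => kx.
  have al0 : (0 <= alpha k)%R by rewrite invr_ge0 sqrtr_ge0.
  rewrite /modulus (block_average_ge G J kx al0) -EFinM lee_fin -/(a k).
  have x2k : (2 ^ k <= x)%R by move: kx; rewrite /dyadic /= in_itv/= => /andP[/ltW].
  have R2k : Rplus (2 ^ k : R)%R by rewrite RplusE exprz_gt0.
  apply: (le_trans ((nf i).2 _ _ R2k x2k)).
  have : (2 ^ (k - 1) * f i (2 ^ k) ^+ 2 <= a k)%R.
    by apply: (le_trans (Dstep i k)); rewrite -lee_fin aE.
  rewrite /alpha; have := (nf i).1 _ R2k; set v := f i (2 ^ k)%R => v0 va.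
  by rewrite (p2S k); apply: le_sqrt_average => //; exact: exprz_gt0.
(* In 4 C one factor 2 comes from [fT] and the other from [rhobar] G <= 2. The left side is
   unbounded in i. *)
have le4C i : (4 ^+ i)%:E <= (4 * C)%:E.
  apply: le_trans (ltW (rf i)) _.
  apply: (@le_trans _ _ (rhobar (fun x => 2%:E * modulus (block_average G J alpha h) x))).
    by apply: (ri_norm_le rhobar_ri (Mf i)); [exact: MplusZ|exact: fT].
  rewrite (ri_normZ rhobar_ri _ MT); last by rewrite ltr0n.
  apply: (@le_trans _ _ (2%:E * (C%:E * 2%:E))).
    apply: lee_wpmul2l => //; apply: le_trans leT _.
    by apply: lee_wpmul2l; [rewrite lee_fin ltW|rewrite rh].
  by rewrite -!EFinM lee_fin; lra.
have [n nC'] := exists_exp2_gt (4 * C)%R.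
have := le4C n; rewrite lee_fin leNgt => /negP; apply.
by apply: (lt_le_trans nC'); apply: lerXn2r; rewrite ?nnegrE ?ler0n ?ler_nat.
Qed.

End K_monotonicity.

(** * Bessel inequality for the Fourier transform *)

Section completed_extension.
Context d (T : measurableType d) (R : realType).
Variable mu : {measure set T -> \bar R}.
Local Notation cT := (caratheodory_type (mu^*)%mu).
Local Notation cmu := (@completed_measure_extension _ _ _ mu).

Lemma completed_extension_measurable (A : set T) :
  measurable A -> measurable (A : set cT).
Proof. by move=> mA; exact: caratheodory_measurable_mu_ext. Qed.

Lemma completed_extensionE (A : set T) : measurable A ->
  (cmu : {measure set cT -> \bar R}) A = mu A.
Proof. by move=> mA; rewrite -(measurable_mu_extE mu mA). Qed.

Lemma completed_extension_measurable_fun d' (T' : measurableType d')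
    (D : set T) (f : T -> T') :
  measurable_fun D f -> measurable D -> measurable_fun (D : set cT) f.
Proof.
by move=> mf mD _ Y mY; apply: completed_extension_measurable; exact: mf.
Qed.

Lemma completed_extension_integralE (f : T -> \bar R) (D : set T) :
  measurable D -> measurable_fun D f -> (forall x, D x -> 0 <= f x) ->
  \int[cmu]_(x in D) f x = \int[mu]_(x in D) f x.
Proof.
move=> mD mf f0.
have mid : measurable_fun (setT : set cT) (fun x : cT => x : T).
  by move=> _ Y mY; rewrite setTI; exact: completed_extension_measurable.
have E := @ge0_integral_pushforward _ _ cT T R _ mid cmu D f mD mf.
transitivity (\int[pushforward cmu (fun x : cT => x : T)]_(y in D) f y).
  by apply/esym; apply: E => x; rewrite inE; exact: f0.
by apply: eq_measure_integral => A mA _; exact: completed_extensionE.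
Qed.

(** For finite outer measure, intersect countable covers that are optimal up to 1/(n+1); otherwise
    the whole space will do. *)
Lemma measurable_hull (E : set T) : exists F : set T,
  [/\ measurable F, E `<=` F & mu F = (mu^*)%mu E].
Proof.
have Eoo : (mu^*)%mu E = +oo -> mu setT = +oo.
  move=> Eoo; apply/eqP; rewrite -leye_eq -Eoo.
  rewrite -(measurable_mu_extE mu measurableT).
  by apply: le_outer_measure; exact: subsetT.
have [Efin|] := boolP ((mu^*)%mu E \is a fin_num); last first.
  rewrite ge0_fin_numE ?mu_ext_ge0// -leNgt leye_eq => /eqP E1.
  by exists setT; split => //; rewrite Eoo.
have cover n : exists F : set T, [/\ measurable F, E `<=` F &
    mu F <= (mu^*)%mu E + (n.+1%:R^-1)%:E].
  have n0 : (0 < n.+1%:R^-1 :> R)%R by rewrite invr_gt0.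
  have [_ [A [mA EA] <-] lt] := lb_ereal_inf_adherent n0 Efin.
  exists (\bigcup_k A k); split => //.
    by apply: bigcupT_measurable => k; exact: mA.
  apply: le_trans (ltW lt); apply: measure_sigma_subadditive => //.
  by apply: bigcupT_measurable => k; exact: mA.
have /choice[F FP] := cover.
exists (\bigcap_n F n).
have mF : measurable (\bigcap_n F n).
  by apply: bigcapT_measurable => n; have [] := FP n.
have EF : E `<=` \bigcap_n F n by move=> x Ex n _; have [_ + _] := FP n; apply.
split => //; apply/eqP; rewrite eq_le; apply/andP; split; last first.
  by rewrite -(measurable_mu_extE mu mF); exact: le_outer_measure.
apply/lee_addgt0Pr => e e0; have [n] := ltr_add_invr e0; rewrite add0r => ne.
have [_ _ Fn] := FP n.
apply: (@le_trans _ _ (mu (F n))).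
  apply: le_measure; [by rewrite inE|by rewrite inE; have [] := FP n|].
  by move=> x; apply.
by apply: (le_trans Fn); rewrite leeD2l// lee_fin ltW.
Qed.

Hypothesis sf : sigma_finite setT mu.

(** On a piece S_i of finite measure let F be the hull of E [&] S_i. Both have the same finite
    measure, so their difference is null for the completion, and a hull of that difference is a null
    set of the original sigma-algebra. *)
Lemma completed_measurable_sandwich (E : set T) : measurable (E : set cT) ->
  exists A N : set T, [/\ measurable A, measurable N, mu N = 0,
    E `<=` A & A `\` E `<=` N].
Proof.
move=> mE; have [S TS mS] := sf.
have mSc i : measurable (S i : set cT).
  by apply: completed_extension_measurable; have [] := mS i.
have /choice[FN FNP] : forall i, exists FN : set T * set T,
    [/\ measurable FN.1, measurable FN.2, mu FN.2 = 0, E `&` S i `<=` FN.1 &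
      FN.1 `\` (E `&` S i) `<=` FN.2].
  move=> i; have [F [mF EF muF]] := measurable_hull (E `&` S i).
  have [N [mN FN muN]] := measurable_hull (F `\` (E `&` S i)).
  exists (F, N); split => //=; rewrite muN.
  have mES : measurable (E `&` S i : set cT) by exact: measurableI.
  have cF := completed_extension_measurable mF.
  have fin : (cmu : {measure set cT -> \bar R}) F < +oo.
    rewrite completed_extensionE// muF.
    apply: (@le_lt_trans _ _ ((mu^*)%mu (S i))).
      exact: le_outer_measure.
    by rewrite (measurable_mu_extE mu) //; have [] := mS i.
  rewrite -[LHS]/((cmu : {measure set cT -> \bar R}) (F `\` (E `&` S i))).
  have E1 : (cmu : {measure set cT -> \bar R}) F = (mu^*)%mu (E `&` S i).
    by rewrite completed_extensionE.
  have -> : (cmu : {measure set cT -> \bar R}) (F `\` (E `&` S i)) =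
      (cmu : {measure set cT -> \bar R}) F -
      (cmu : {measure set cT -> \bar R}) (F `&` (E `&` S i)).
    exact: measureD.
  rewrite (setIidr EF) E1; apply: subee.
  by rewrite -E1 ge0_fin_numE.
exists (\bigcup_i (FN i).1), (\bigcup_i (FN i).2); split.
- by apply: bigcupT_measurable => i; have [] := FNP i.
- by apply: bigcupT_measurable => i; have [] := FNP i.
- apply/eqP; rewrite -measure_le0.
  apply: (le_trans (measure_sigma_subadditive _ _ _ (@subset_refl _ _))).
  + by move=> i; have [] := FNP i.
  + by apply: bigcupT_measurable => i; have [] := FNP i.
  + by rewrite eseries0// => i _ _; have [_ _ ->] := FNP i.
- move=> x Ex; have [i _ Si] : (\bigcup_i S i) x by rewrite -TS.
  by exists i => //; have [_ _ _ + _] := FNP i; apply.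
- move=> x [[i _ Fi] nE]; exists i => //; have [_ _ _ _] := FNP i; apply.
  by split=> // -[].
Qed.

(** The superlevel sets at rational levels are measurable up to null sets. Only countably many
    levels are involved, so one null set N accounts for all of them. *)
Lemma completed_measurable_fun_borel (f : T -> R) :
  measurable_fun (setT : set cT) f ->
  exists N : set T, [/\ measurable N, mu N = 0 &
    measurable_fun setT (fun x => f x * \1_(~` N) x)%R].
Proof.
move=> mf.
have /choice[AN ANP] : forall q : rat, exists AN : set T * set T,
    [/\ measurable AN.1, measurable AN.2, mu AN.2 = 0,
      [set x | ratr q < f x]%R `<=` AN.1 & AN.1 `\` [set x | ratr q < f x]%R `<=` AN.2].
  move=> q.
  have mE : measurable ([set x | ratr q < f x]%R : set cT).
    have := mf measurableT `]ratr q, +oo[%classic (measurable_itv _).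
    by rewrite setTI; congr measurable; apply/seteqP; split=> x /=;
      rewrite in_itv/= andbT.
  by have [A [N ?]] := completed_measurable_sandwich mE; exists (A, N).
pose N := \bigcup_q (AN q).2.
have mN : measurable N.
  apply: countable_bigcupT_measurable => // q.
  by have [] := ANP q.
have muN : mu N = 0.
  pose M n := if unpickle n is Some q then (AN q).2 else set0.
  have mM n : measurable (M n).
    by rewrite /M; case: unpickle => // q; have [] := ANP q.
  apply/eqP; rewrite -measure_le0.
  have NM : N `<=` \bigcup_n M n.
    by move=> x [q _ qx]; exists (pickle q); [exact: I|rewrite /M pickleK].
  apply: (@le_trans _ _ (\sum_(n <oo) mu (M n))).
    exact: measure_sigma_subadditive.
  by rewrite eseries0// => n _ _; rewrite /M; case: unpickle => // q;
    have [_ _ ->] := ANP q.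
exists N; split=> //.
apply: (measurability _ (RGenOInfty.measurableE R)).
move=> _ [_ [r ->] <-]; rewrite setTI.
(* On N the product is 0, so N lies in the superlevel set at r exactly when r < 0. *)
rewrite [X in measurable X](_ : _ =
    \bigcup_q (if (r < ratr q)%R then
      (if (ratr q < 0 :> R)%R then N else set0) `|` ((AN q).1 `\` N) else set0)
    `|` (if (r < 0)%R then N else set0)).
  apply: measurableU; last by case: ifP.
  apply: countable_bigcupT_measurable => // q; case: ifP => // _.
  apply: measurableU; first by case: ifP.
  by apply: measurableD => //; have [] := ANP q.
apply/seteqP; split=> x /=; rewrite in_itv/= andbT.
  have [Nx|Nx] := pselect (N x).
    rewrite indicE memNset/= ?mulr0; last exact.
    by move=> ->; right.
  rewrite indicE mem_set//= mulr1 => rf.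
  have [q /andP[rq qf]] := rat_in_itvoo rf.
  rewrite !bnd_simp in rq qf.
  left; exists q => //; rewrite rq; right; split=> //.
  by have [_ _ _ + _] := ANP q; apply.
move=> [[q _]|]; last first.
  case: ifP => // r0 Nx; rewrite indicE memNset/= ?mulr0//.
case: ifP => // rq [|[Ax Nx]].
  case: ifP => // q0 Nx; rewrite indicE memNset/= ?mulr0; last exact.
  exact: lt_trans q0.
rewrite indicE mem_set//= mulr1; apply: (lt_trans rq).
apply: contrapT => fq; apply: Nx; exists q => //.
by have [_ _ _ _] := ANP q; apply.
Qed.

End completed_extension.

(** * The triangle function and the Fejer kernel *)

Section triangle.
Context {R : realType}.
Local Notation leb := (@lebesgue_measure R).
Implicit Types r w x phi : R.

Definition tri r x : R := Num.max 0%R (1 - `|x| / r)%R.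

(** The Fourier transform of the triangle in angular frequency: the factor 2 pi is left to the
    argument w. There is no sine part, since the triangle is even. *)
Definition tri_hat r w : R := (\int[leb]_x (tri r x * cos (w * x)))%R.

Lemma tri_ge0 r x : (0 <= tri r x)%R.
Proof. by rewrite /tri le_max lexx. Qed.

Lemma tri_le1 r x : (0 < r)%R -> (tri r x <= 1)%R.
Proof. by move=> r0; rewrite /tri ge_max ler01/= gerBl divr_ge0// ltW. Qed.

Lemma tri_eq0 r x : (0 < r)%R -> (r <= `|x|)%R -> tri r x = 0%R.
Proof.
by move=> r0 rx; rewrite /tri max_l// subr_le0 ler_pdivlMr// mul1r.
Qed.

Lemma continuous_tri r : continuous (tri r).
Proof.
move=> x; rewrite (_ : tri r = (cst 0%R : R -> R^o) \max (fun y => 1 - `|y| / r)%R)//.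
apply: continuous_max; first exact: cst_continuous.
apply: continuousB; first exact: cst_continuous.
by apply: continuousM; [exact: norm_continuous|exact: cst_continuous].
Qed.

Lemma measurable_tri r : measurable_fun (setT : set (measurableTypeR R)) (tri r).
Proof. by apply: continuous_measurable_fun; exact: continuous_tri. Qed.

Lemma continuous_phase phi w : continuous (fun x => cos (phi + w * x)%R).
Proof.
move=> x; apply: (@continuous_comp _ _ _ (fun x => phi + w * x)%R cos); last exact: continuous_cos.
apply: continuousD; first exact: cst_continuous.
by apply: continuousM; [exact: cst_continuous|].
Qed.

Lemma triE r x : (0 < r)%R -> (0 <= x <= r)%R -> tri r x = (1 - x / r)%R.
Proof.
move=> r0 /andP[x0 xr]; rewrite /tri ger0_norm// max_r// subr_ge0.
by rewrite ler_pdivrMr// mul1r.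
Qed.

Lemma tri_opp r x : tri r (- x) = tri r x.
Proof. by rewrite /tri normrN. Qed.

Lemma integrable_itv (f : R -> R) a b : continuous f ->
  leb.-integrable `[a, b] (EFin \o f).
Proof.
move=> cf; apply: continuous_compact_integrable; first exact: segment_compact.
exact: continuous_subspaceT.
Qed.

(** Folds the integral onto [0, r], where the triangle is affine and the fundamental theorem of
    calculus applies. *)
Lemma integral_tri_half r (f : R -> R) : (0 < r)%R -> continuous f ->
  (\int[leb]_x (tri r x * f x) =
   \int[leb]_(x in `[0%R, r]) (tri r x * (f x + f (- x))))%R.
Proof.
move=> r0 cf; pose g x := (tri r x * f x)%R.
have cg : continuous g.
  by move=> x; apply: continuousM; [exact: continuous_tri|exact: cf].
have -> : (\int[leb]_x (tri r x * f x) = \int[leb]_(x in `[(- r)%R, r]) g x)%R.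
  rewrite [RHS]Rintegral_mkcond; congr fine; apply: eq_integral => x _.
  rewrite /patch; case: ifPn => // xr; congr EFin.
  rewrite tri_eq0 ?mul0r//; move: xr; rewrite notin_setE/= in_itv/= => xr.
  by rewrite leNgt; apply/negP; rewrite ltr_norml => /andP[/ltW a /ltW b]; apply: xr; rewrite a b.
have -> : `[(- r)%R, r]%classic = `[(- r)%R, 0%R] `|` `]0%R, r].
  by rewrite -itv_bndbnd_setU// bnd_simp// ?oppr_le0 ltW.
rewrite Rintegral_setU//; first last.
- apply/disj_setPS => x [] /=; rewrite !in_itv/= => /andP[_ x0] /andP[x0' _].
  by have := lt_le_trans x0' x0; rewrite ltxx.
- rewrite -itv_bndbnd_setU// ?bnd_simp ?oppr_le0 ?ltW//.
  exact: integrable_itv.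
have ig a b (h : R -> R) : continuous h -> leb.-integrable `[a, b] (EFin \o h).
  exact: integrable_itv.
have igo : leb.-integrable `]0%R, r] (EFin \o g).
  by apply: (integrableS _ _ _ (ig 0%R r _ cg)) => //; exact: subset_itv_oc_cc.
rewrite (Rintegral_itv_obnd_cbnd igo).
have cgN : continuous (g \o -%R).
  by move=> x; apply: continuous_comp; [exact: opp_continuous|exact: cg].
have -> : (\int[leb]_(x in `[(- r)%R, 0%R]) g x =
    \int[leb]_(x in `[0%R, r]) (g \o -%R) x)%R.
  congr fine; rewrite -[X in `[_, X]]oppr0.
  apply: integration_by_substitution_oppr; first exact: ltW.
  exact: continuous_subspaceT.
rewrite -RintegralD//; [|exact: ig|exact: ig].
by apply: eq_Rintegral => x _; rewrite /g/= tri_opp; ring.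
Qed.

Lemma continuous_cosM w : continuous (fun x => cos (w * x)%R).
Proof. by have := @continuous_phase 0%R w; under eq_fun do rewrite add0r. Qed.

Lemma tri_hatE0 r w : (0 < r)%R ->
  (tri_hat r w = 2 * \int[leb]_(x in `[0%R, r]) (tri r x * cos (w * x)))%R.
Proof.
move=> r0; rewrite /tri_hat integral_tri_half//; last exact: continuous_cosM.
rewrite -RintegralZl//; last first.
  apply: integrable_itv => x.
  by apply: continuousM; [exact: continuous_tri|exact: continuous_cosM].
by apply: eq_Rintegral => x _; rewrite mulrN cosN; ring.
Qed.

(** The part of cos (phi + w x) that contains sin (w x) is odd and integrates to 0 against the even
    triangle. *)
Lemma integral_tri_cos r w phi : (0 < r)%R ->
  (\int[leb]_x (tri r x * cos (phi + w * x)) = cos phi * tri_hat r w)%R.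
Proof.
move=> r0; rewrite integral_tri_half//; last exact: continuous_phase.
rewrite tri_hatE0// mulrA -RintegralZl//; last first.
  apply: integrable_itv => x.
  by apply: continuousM; [exact: continuous_tri|exact: continuous_cosM].
apply: eq_Rintegral => x _; rewrite !cosD !mulrN cosN sinN; ring.
Qed.

Lemma integral_tri_itv r : (0 < r)%R ->
  (\int[leb]_(x in `[0%R, r]) tri r x = r / 2)%R.
Proof.
move=> r0; pose F x := (x - x ^+ 2 / (2 * r))%R.
have dF x : is_derive x (1%R : R) F (1 - x / r)%R.
  rewrite /F; apply: is_derive_eq.
  by rewrite /GRing.scale/= ?expr1; field; rewrite gt_eqF.
rewrite /Rintegral (continuous_FTC2 (F := F)) //.
- by rewrite /F /= expr0n/= mul0r subr0 subr0; field; rewrite gt_eqF.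
- exact/continuous_subspaceT/continuous_tri.
- split.
  + by move=> x _; apply: ex_derive.
  + by apply: cvg_at_right_filter; apply: differentiable_continuous; apply/derivable1_diffP; apply: ex_derive.
  + by apply: cvg_at_left_filter; apply: differentiable_continuous; apply/derivable1_diffP; apply: ex_derive.
- move=> x; rewrite in_itv/= => /andP[x0 xr]; rewrite derive1E derive_val triE//.
  by rewrite !ltW.
Qed.

Lemma tri_hatE r w : (0 < r)%R -> w != 0%R ->
  (tri_hat r w = 2 * (1 - cos (w * r)) / (r * w ^+ 2))%R.
Proof.
move=> r0 w0; rewrite tri_hatE0//.
(* An antiderivative of (1 - x / r) cos (w x), found by one integration by parts. *)
pose F x := ((1 - x / r) * (sin (w * x) / w) - cos (w * x) / (r * w ^+ 2))%R.
have dw x : is_derive x (1%R : R) (fun y => w * y)%R w.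
  by apply: is_derive_eq; rewrite /GRing.scale/= mulr1.
have ds x : is_derive x (1%R : R) (fun y => sin (w * y)%R) (cos (w * x) * w)%R.
  by apply: is_derive1_comp.
have dc x : is_derive x (1%R : R) (fun y => cos (w * y)%R) (- sin (w * x) * w)%R.
  by apply: is_derive1_comp.
have dF x : is_derive x (1%R : R) F ((1 - x / r) * cos (w * x))%R.
  rewrite /F; apply: is_derive_eq.
  by rewrite /GRing.scale/=; field; rewrite w0 gt_eqF.
rewrite /Rintegral (continuous_FTC2 (F := F)) //.
- have -> : F r = (- (cos (w * r) / (r * w ^+ 2)))%R.
    by rewrite /F divff ?gt_eqF// subrr mul0r sub0r.
  have -> : F 0%R = (- (1 / (r * w ^+ 2)))%R.
    by rewrite /F !(mulr0, mul0r, sin0, cos0) sub0r.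
  by rewrite -EFinB/=; field; rewrite w0 gt_eqF.
- apply: continuous_subspaceT => x.
  by apply: continuousM; [exact: continuous_tri|exact: continuous_cosM].
- split.
  + by move=> x _; apply: ex_derive.
  + by apply: cvg_at_right_filter; apply: differentiable_continuous; apply/derivable1_diffP; apply: ex_derive.
  + by apply: cvg_at_left_filter; apply: differentiable_continuous; apply/derivable1_diffP; apply: ex_derive.
- move=> x; rewrite in_itv/= => /andP[x0 xr]; rewrite derive1E derive_val triE//.
  by rewrite !ltW.
Qed.

(** On the support of the triangle |w x| <= |w r| <= 1, where the cosine is at least cos 1; the
    triangle has integral r. *)
Lemma tri_hat_ge r w : (0 < r)%R -> (`|w * r| <= 1)%R ->
  (cos 1 * r <= tri_hat r w)%R.
Proof.
move=> r0 wr; rewrite tri_hatE0//.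
have -> : (cos 1 * r = 2 * \int[leb]_(x in `[0%R, r]) (cos 1 * tri r x))%R.
  rewrite RintegralZl//; last exact/integrable_itv/continuous_tri.
  by rewrite integral_tri_itv//; field.
rewrite ler_pM2l//; apply: le_Rintegral => //.
- apply: integrable_itv => x.
  by apply: continuousM; [exact: cst_continuous|exact: continuous_tri].
- apply: integrable_itv => x.
  by apply: continuousM; [exact: continuous_tri|exact: continuous_cosM].
- move=> x; rewrite /= in_itv/= => /andP[x0 xr].
  rewrite mulrC ler_wpM2l ?tri_ge0//.
  have -> : cos (w * x) = cos `|w * x|%R.
    by case: (ger0P (w * x)%R) => // _; rewrite cosN.
  set t := `|w * x|%R.
  have t1 : (t <= 1)%R.
    apply: le_trans wr; rewrite /t !normrM ler_wpM2l//.
    by rewrite !ger0_norm// ltW.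
  have p2 := @pi_ge2 R.
  have t0 : (0 <= t)%R by exact: normr_ge0.
  by rewrite leNgt ltr_cos -?leNgt// in_itv/=; apply/andP; split; lra.
Qed.

Lemma tri_hat0 r : (0 < r)%R -> tri_hat r 0 = r.
Proof.
move=> r0; rewrite tri_hatE0//.
have -> : (\int[leb]_(x in `[0%R, r]) (tri r x * cos (0 * x)) =
   \int[leb]_(x in `[0%R, r]) tri r x)%R.
  by apply: eq_Rintegral => x _; rewrite mul0r cos0 mulr1.
by rewrite integral_tri_itv//; field.
Qed.

Lemma tri_hat_ge0 r w : (0 < r)%R -> (0 <= tri_hat r w)%R.
Proof.
move=> r0; have [->|w0] := eqVneq w 0%R; first by rewrite tri_hat0// ltW.
rewrite tri_hatE//; apply: divr_ge0.
  by rewrite mulr_ge0// subr_ge0 cos_le1.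
by rewrite mulr_ge0 ?sqr_ge0// ltW.
Qed.

Lemma tri_hat_le r w : (0 < r)%R -> (tri_hat r w <= r)%R.
Proof.
move=> r0; rewrite -[leRHS](tri_hat0 r0) !tri_hatE0// ler_pM2l//.
apply: le_Rintegral => //.
- apply: integrable_itv => x.
  by apply: continuousM; [exact: continuous_tri|exact: continuous_cosM].
- apply: integrable_itv => x.
  by apply: continuousM; [exact: continuous_tri|exact: continuous_cosM].
- by move=> x _; rewrite mul0r cos0 ler_wpM2l ?tri_ge0 ?cos_le1.
Qed.

Lemma tri_hat_decay r w : (0 < r)%R -> w != 0%R -> (tri_hat r w <= 4 / (r * w ^+ 2))%R.
Proof.
move=> r0 w0; rewrite tri_hatE// ler_wpM2r//.
  by rewrite invr_ge0 mulr_ge0 ?sqr_ge0// ltW.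
have := @cos_geN1 R (w * r)%R; lra.
Qed.

End triangle.

(** * Products of triangles on R^n *)

Section borel_product.
Context {R : realType}.
Local Notation leb := (@lebesgue_measure R).
Local Notation bl := (@borel_lebesgue R).
Local Notation tupleR n := (n.-tuple (measurableTypeR R)).

Lemma borel_lebesgue_ge0_integral n (F : tupleR n.+1 -> \bar R) :
  measurable_fun setT F -> (forall x, 0 <= F x) ->
  \int[bl n.+1]_x F x = \int[leb]_x \int[bl n]_y F [tuple of x :: y].
Proof.
move=> mF F0.
have := @ge0_integral_pushforward _ _ _ _ R _ (@measurable_tuple_cons R n)
  (leb \x bl n) setT F measurableT mF.
rewrite preimage_setT => E.
transitivity (\int[leb \x bl n]_x (F \o @tuple_cons R n) x).
  rewrite -E; last by move=> y _; exact: F0.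
  apply: eq_measure_integral; first exact: measurable_tuple_cons.
  by move=> ? A mA _.
rewrite (@fubini_tonelli1 _ _ _ _ R leb (bl n))//.
  by apply: measurableT_comp => //; exact: measurable_tuple_cons.
by move=> x; exact: F0.
Qed.

Lemma borel_lebesgue_integral n (F : tupleR n.+1 -> \bar R) :
  (bl n.+1).-integrable setT F ->
  \int[bl n.+1]_x F x = \int[leb]_x \int[bl n]_y F [tuple of x :: y].
Proof.
move=> iF; have /integrableP[mF F1] := iF.
have mFc : measurable_fun setT (F \o @tuple_cons R n).
  by apply: measurableT_comp => //; exact: measurable_tuple_cons.
have iFc : (leb \x bl n).-integrable setT (F \o @tuple_cons R n).
  apply/integrableP; split => //; move: F1.
  rewrite (@borel_lebesgue_ge0_integral _ (fun x => `|F x|))//; last exact: measurableT_comp.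
  rewrite (@fubini_tonelli1 _ _ _ _ R leb (bl n))//.
  exact: measurableT_comp.
transitivity (\int[leb \x bl n]_x (F \o @tuple_cons R n) x).
  have := @integral_pushforward _ _ _ _ R _ (@measurable_tuple_cons R n)
    (leb \x bl n) setT F mF.
  rewrite preimage_setT => /(_ iFc measurableT) <-.
  apply: eq_measure_integral; first exact: measurable_tuple_cons.
  by move=> ? A mA _.
by rewrite -integral12_prod_meas1.
Qed.

Definition tuple_prod n (q : nat -> R -> R) (x : tupleR n) : R :=
  (\prod_(i < n) q i (tnth x i))%R.

Lemma tuple_prod_cons n (q : nat -> R -> R) x (y : tupleR n) :
  tuple_prod q [tuple of x :: y] = (q 0%N x * tuple_prod (fun i => q i.+1) y)%R.
Proof.
rewrite /tuple_prod big_ord_recl tnth0; congr (_ * _)%R.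
by apply: eq_bigr => i _; rewrite tnthS.
Qed.

Lemma measurable_tuple_prod n (q : nat -> R -> R) :
  (forall i, measurable_fun (setT : set (measurableTypeR R)) (q i)) ->
  measurable_fun (setT : set (tupleR n)) (tuple_prod q).
Proof.
move=> mq; apply: measurable_prod => i _.
by apply: measurableT_comp; [exact: mq|exact: measurable_tnth].
Qed.

Lemma tuple_prod_ge0 n (q : nat -> R -> R) (x : tupleR n) :
  (forall i x, 0 <= q i x)%R -> (0 <= tuple_prod q x)%R.
Proof. by move=> q0; apply: prodr_ge0. Qed.

Lemma integral_tuple_prod n (q : nat -> R -> R) :
  (forall i, measurable_fun (setT : set (measurableTypeR R)) (q i)) ->
  (forall i x, 0 <= q i x)%R ->
  \int[bl n]_x (tuple_prod q x)%:E = \prod_(i < n) \int[leb]_x (q i x)%:E.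
Proof.
elim: n q => [|n IH] q mq q0.
  rewrite big_ord0 integral_dirac//; last first.
    by apply/measurable_EFinP; exact: measurable_tuple_prod.
  by rewrite diracT mul1e /tuple_prod big_ord0.
rewrite borel_lebesgue_ge0_integral; last 2 first.
- by apply/measurable_EFinP; exact: measurable_tuple_prod.
- by move=> x; rewrite lee_fin tuple_prod_ge0.
under eq_integral => x _.
  under eq_integral do rewrite tuple_prod_cons EFinM.
  rewrite ge0_integralZl//; last 3 first.
    by apply/measurable_EFinP; exact: measurable_tuple_prod.
    by move=> y _; rewrite lee_fin tuple_prod_ge0.
    by rewrite lee_fin.
  rewrite IH// muleC; over.
rewrite ge0_integralZl//.
- by rewrite big_ord_recl muleC.
- exact/measurable_EFinP.
- by move=> x _; rewrite lee_fin.
- apply: prode_ge0 => i _; apply: integral_ge0 => x _; by rewrite lee_fin.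
Qed.

Definition tuple_sum n (w : nat -> R) (x : tupleR n) : R :=
  (\sum_(i < n) w i * tnth x i)%R.

Lemma tuple_sum_cons n (w : nat -> R) x (y : tupleR n) :
  tuple_sum w [tuple of x :: y] = (w 0%N * x + tuple_sum (fun i => w i.+1) y)%R.
Proof.
rewrite /tuple_sum big_ord_recl tnth0; congr (_ + _)%R.
by apply: eq_bigr => i _; rewrite tnthS.
Qed.

Lemma measurable_tuple_sum n (w : nat -> R) :
  measurable_fun (setT : set (tupleR n)) (tuple_sum w).
Proof.
apply: measurable_sum => i.
by apply: measurable_funM; [exact: measurable_cst|exact: measurable_tnth].
Qed.

Definition box n r : tupleR n -> R := tuple_prod (fun=> tri r).

Lemma measurable_box n r : measurable_fun (setT : set (tupleR n)) (box r).
Proof. by apply: measurable_tuple_prod => _; exact: measurable_tri. Qed.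

Lemma box_ge0 n r (x : tupleR n) : (0 <= box r x)%R.
Proof. by apply: tuple_prod_ge0 => _ y; exact: tri_ge0. Qed.

Lemma integral_tri r : (0 < r)%R -> \int[leb]_x (tri r x)%:E = r%:E.
Proof.
move=> r0.
have fin : \int[leb]_x (tri r x)%:E < +oo.
  have -> : \int[leb]_x (tri r x)%:E = \int[leb]_(x in `[(- r)%R, r]) (tri r x)%:E.
    rewrite [RHS]integral_mkcond; apply: eq_integral => x _.
    rewrite /patch; case: ifPn => // xr.
    rewrite tri_eq0//; move: xr; rewrite notin_setE/= in_itv/= => xr.
    by rewrite leNgt; apply/negP; rewrite ltr_norml => /andP[/ltW a /ltW b]; apply: xr; rewrite a b.
  have := integrable_itv (- r)%R r (@continuous_tri R r).
  by move=> /integrableP[_]; under eq_integral do rewrite /= ger0_norm ?tri_ge0//.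
rewrite -[in RHS](tri_hat0 r0) /tri_hat /Rintegral.
rewrite -[LHS]fineK; last first.
  by rewrite ge0_fin_numE// integral_ge0// => x _; rewrite lee_fin tri_ge0.
by congr (fine _)%:E; apply: eq_integral => x _; rewrite mul0r cos0 mulr1.
Qed.

Lemma integral_box n r : (0 < r)%R -> \int[bl n]_x (box r x)%:E = (r ^+ n)%:E.
Proof.
move=> r0; rewrite integral_tuple_prod.
- rewrite (eq_bigr (fun=> r%:E)); last by move=> i _; exact: integral_tri.
  by rewrite prodEFin prodr_const card_ord.
- by move=> _; exact: measurable_tri.
- by move=> _; exact: tri_ge0.
Qed.

Lemma measurable_cos_phase n (w : nat -> R) phi :
  measurable_fun (setT : set (tupleR n)) (fun x => cos (phi + tuple_sum w x)%R).
Proof.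
apply: measurableT_comp.
  by apply: continuous_measurable_fun; exact: continuous_cos.
by apply: measurable_funD; [exact: measurable_cst|exact: measurable_tuple_sum].
Qed.

Lemma abs_cos_le1 (t : R) : (`|cos t| <= 1)%R.
Proof. by rewrite ler_norml cos_geN1 cos_le1. Qed.

Lemma integrable_box_cos n r (w : nat -> R) phi : (0 < r)%R ->
  (bl n).-integrable setT
    (EFin \o (fun x : tupleR n => box r x * cos (phi + tuple_sum w x))%R).
Proof.
move=> r0; apply: (le_integrable measurableT (g := EFin \o @box n r)).
- apply/measurable_EFinP; apply: measurable_funM; first exact: measurable_box.
  exact: measurable_cos_phase.
- move=> x _; rewrite /= lee_fin normrM ler_piMr//.
  exact: abs_cos_le1.
- apply/integrableP; split; first by apply/measurable_EFinP; exact: measurable_box.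
  under eq_integral do rewrite /= ger0_norm ?box_ge0//.
  by rewrite integral_box// ltry.
Qed.

(* With a free phase the induction on the dimension closes on cosines alone. *)
Lemma integral_box_cos n r (w : nat -> R) phi : (0 < r)%R ->
  (\int[bl n]_x (box r x * cos (phi + tuple_sum w x)) =
   cos phi * \prod_(i < n) tri_hat r (w i))%R.
Proof.
move=> r0; elim: n w phi => [|n IH] w phi.
  rewrite big_ord0 /Rintegral integral_dirac//; last first.
    apply/measurable_EFinP; apply: measurable_funM; first exact: measurable_box.
    exact: measurable_cos_phase.
  by rewrite diracT mul1e/= /box /tuple_prod /tuple_sum !big_ord0 addr0 mul1r mulr1.
have i1 := @integrable_box_cos n.+1 r w phi r0.
rewrite {1}/Rintegral (borel_lebesgue_integral i1).
(* After integration over the last n coordinates w_0 x has joined the phase, and the induction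
   hypothesis leaves cos (phi + w_0 x) as a factor in the first one. *)
rewrite (eq_integral (fun x : measurableTypeR R => (tri r x * cos (phi + w 0%N * x))%:E *
    (\prod_(i < n) tri_hat r (w i.+1))%:E)); last first.
  move=> x _.
  rewrite (eq_integral (fun y : tupleR n => (tri r x)%:E *
    (box r y * cos ((phi + w 0%N * x) + tuple_sum (fun i => w i.+1) y))%:E)); last first.
    move=> y _; rewrite -EFinM; congr EFin.
    by rewrite /box tuple_prod_cons tuple_sum_cons addrA mulrA.
  have i2 := @integrable_box_cos n r (fun i => w i.+1) (phi + w 0%N * x)%R r0.
  rewrite integralZl//.
  have := IH (fun i => w i.+1) (phi + w 0%N * x)%R; rewrite /Rintegral => IH'.
  rewrite -[X in _ * X](fineK (integrable_fin_num measurableT i2)) IH'.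
  by rewrite -!EFinM mulrA.
have i3 : leb.-integrable setT (EFin \o (fun x => tri r x * cos (phi + w 0%N * x))%R).
  apply: (le_integrable measurableT (g := (EFin \o tri r : measurableTypeR R -> \bar R))).
  - apply/measurable_EFinP; apply: measurable_funM; first exact: measurable_tri.
    by apply: continuous_measurable_fun; exact: continuous_phase.
  - move=> x _; rewrite /= lee_fin normrM ler_piMr//.
    exact: abs_cos_le1.
  - apply/integrableP; split; first by apply/measurable_EFinP; exact: measurable_tri.
    under eq_integral do rewrite /= ger0_norm ?tri_ge0//.
    by rewrite integral_tri// ltry.
rewrite integralZr// fineM//; last exact: integrable_fin_num i3.
have := integral_tri_cos (w 0%N) phi r0; rewrite /Rintegral => ->.
by rewrite big_ord_recl mulrA.
Qed.

Lemma measurable_tri_hat r : (0 < r)%R ->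
  measurable_fun (setT : set (measurableTypeR R)) (tri_hat r).
Proof.
move=> r0; apply: (eq_measurable_fun (fun w : measurableTypeR R => if w == 0%R then r else
    (2 * (1 - cos (w * r)) / (r * w ^+ 2))%R)).
  by move=> w _; case: eqVneq => [->|w0]; [rewrite tri_hat0|rewrite tri_hatE].
apply: measurable_fun_if => //.
- apply: (measurable_fun_bool true); rewrite setTI.
  rewrite (_ : _ @^-1` _ = [set 0%R])//.
  by apply/seteqP; split=> x /= => [/eqP|->]//; rewrite eqxx.
- apply: measurable_funTS; apply: measurable_funM.
    apply: measurable_funM => //; apply: measurable_funB => //.
    apply: measurableT_comp; first by apply: continuous_measurable_fun; exact: continuous_cos.
    exact: measurable_funM.
  rewrite (_ : (fun _ => _) = (fun w : measurableTypeR R => (r * w ^+ 2) `^ (-1))%R).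
    have := @measurableT_comp _ _ _ _ _ _ (fun v : measurableTypeR R => v `^ (-1))%R
      _ (fun w : measurableTypeR R => r * w ^+ 2)%R; apply.
      exact: measurable_powR.
    by apply: measurable_funM => //; exact: measurable_funX.
  by apply/funext => w; rewrite powR_inv1// mulr_ge0 ?sqr_ge0// ltW.
Qed.

Lemma tri_hat_opp (r w : R) : tri_hat r (- w)%R = tri_hat r w.
Proof. by apply: eq_Rintegral => x _; rewrite mulNr cosN. Qed.

End borel_product.

(** * The kernel of the weighted quadratic form *)

Section kernel_mass.
Context {R : realType}.
Local Notation leb := (@lebesgue_measure R).
Local Notation bl := (@borel_lebesgue R).
Local Notation tupleR n := (n.-tuple (measurableTypeR R)).

Lemma continuous_at_inv_sqr (r a y : R) : r != 0%R -> (y - a)%R != 0%R ->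
  {for y, continuous (fun x : R => (r * (x - a) ^+ 2)^-1)%R}.
Proof.
move=> r0 ya; have n0 : (r * (y - a) ^+ 2 != 0)%R by rewrite mulf_neq0// expf_neq0.
by apply: differentiable_continuous; apply/derivable1_diffP; apply: ex_derive.
Qed.

(** The tail starts at distance 1/r from a, where the two bounds r and 1 / (r (y - a)^2) for the
    Fejer kernel meet. *)
Lemma integral_tail (r a : R) : (0 < r)%R ->
  \int[leb]_(y in `[(a + r^-1)%R, +oo[) ((r * (y - a) ^+ 2)^-1)%:E = 1%:E.
Proof.
move=> r0; have ir0 : (0 < r^-1)%R by rewrite invr_gt0.
pose F (y : R) := (- (r * (y - a))^-1)%R.
have pos (y : R) : (a + r^-1 <= y)%R -> (0 < y - a)%R by move=> ?; lra.
have dF (y : R) : (a < y)%R -> is_derive y (1%R : R) F ((r * (y - a) ^+ 2)^-1)%R.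
  move=> ay; have ya : (r * (y - a) != 0)%R by rewrite mulf_neq0 ?gt_eqF// subr_gt0.
  rewrite /F; apply: is_derive_eq.
  by rewrite /GRing.scale/=; field; rewrite !gt_eqF// subr_gt0.
rewrite (@ge0_continuous_FTC2y R (fun y => (r * (y - a) ^+ 2)^-1)%R F (a + r^-1)%R 0%R).
- have -> : F (a + r^-1)%R = (- 1)%R.
    by rewrite /F (addrAC a) subrr add0r divff ?gt_eqF// invr1.
  by rewrite EFinN oppeK add0e.
- by move=> y _; rewrite invr_ge0 mulr_ge0 ?sqr_ge0// ltW.
- apply: continuous_in_subspaceT => y; rewrite inE/= in_itv/= andbT => /pos ya.
  by apply: continuous_at_inv_sqr; rewrite gt_eqF.
- rewrite -[X in _ --> X]oppr0; apply: cvgN; apply/gtr0_cvgV0.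
    near=> y; rewrite mulr_gt0// subr_gt0.
    by near: y; apply: nbhs_pinfty_gt; exact: num_real.
  apply/cvgryPge => A; near=> y.
  rewrite -ler_pdivrMl// lerBrDr.
  by near: y; apply: nbhs_pinfty_ge; exact: num_real.
- move=> y ay; apply: ex_derive; apply: dF; lra.
- apply: cvg_at_right_filter; apply: differentiable_continuous; apply/derivable1_diffP.
  apply: ex_derive; apply: dF; lra.
- move=> y; rewrite in_itv/= andbT => ay; rewrite derive1E.
  have d := dF y (lt_trans _ ay); apply: derive_val; apply: d; lra.
Unshelve. all: by end_near. Qed.

(** 4 = 1 + 2 + 1: within distance 1/r of a the integrand is at most r, on a length of 2/r; on
    either side the decay bound leaves a tail of integral 1. Fourier inversion would give the exact
    value 1, but only a bound uniform in r matters. *)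
Lemma integral_tri_hat_le (r a : R) : (0 < r)%R ->
  \int[leb]_y (tri_hat r (2 * pi * (a - y))%R)%:E <= 4%:E.
Proof.
move=> r0; have ir0 : (0 < r^-1)%R by rewrite invr_gt0.
have p0 := @pi_gt0 R; have p2 := @pi_ge2 R.
pose q (y : R) := tri_hat r (2 * pi * (a - y))%R.
have mq : measurable_fun (setT : set (measurableTypeR R)) (EFin \o q).
  apply/measurable_EFinP; apply: measurableT_comp; first exact: measurable_tri_hat.
  by apply: measurable_funM => //; exact: measurable_funB.
have q0 y : 0 <= (EFin \o q) y by rewrite lee_fin tri_hat_ge0.
have qle y : (y != a)%R -> (q y <= (r * (y - a) ^+ 2)^-1)%R.
  move=> ya; have ay : (a - y != 0)%R by rewrite subr_eq0 eq_sym.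
  have w0 : (2 * pi * (a - y) != 0)%R.
    by rewrite mulf_neq0// mulf_neq0 ?pnatr_eq0// gt_eqF.
  apply: (le_trans (tri_hat_decay r0 w0)).
  have -> : (4 / (r * (2 * pi * (a - y)) ^+ 2) = (r * (y - a) ^+ 2)^-1 * (pi ^+ 2)^-1)%R.
    have aux (e p : R) : (0 < p)%R -> e != 0%R ->
        (4 / (r * (2 * p * - e) ^+ 2) = (r * e ^+ 2)^-1 / p ^+ 2)%R.
      by move=> p'0 e0; field; rewrite e0 (gt_eqF p'0) (gt_eqF r0).
    by rewrite -aux ?subr_eq0// opprB.
  have A0 : (0 <= (r * (y - a) ^+ 2)^-1)%R.
    by rewrite invr_ge0 mulr_ge0 ?sqr_ge0// ltW.
  rewrite ler_piMr// invf_le1 ?exprn_gt0//; nra.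
have E1 : [set: measurableTypeR R] = `]-oo, (a - r^-1)%R] `|` (`](a - r^-1)%R, (a + r^-1)%R[ `|` `[(a + r^-1)%R, +oo[).
  apply/seteqP; split=> // y _ /=; rewrite !in_itv/= andbT.
  case: (leP y (a - r^-1)%R) => /= ?; first by left.
  by right; case: (ltP y (a + r^-1)%R) => /= ?; [left|right].
have mqS (A : set (measurableTypeR R)) : measurable_fun A (EFin \o q).
  exact: measurable_funTS.
rewrite -[X in X <= _]/(\int[leb]_(y in setT) (EFin \o q) y) E1.
rewrite ge0_integral_setU//; first last.
- apply/disj_setPS => y [] /=; rewrite !in_itv/= andbT => h [/andP[h' _]|h'].
    by have := lt_le_trans h' h; rewrite ltxx.
  lra.
- exact: measurableU.
rewrite ge0_integral_setU//; last first.
  apply/disj_setPS => y [] /=; rewrite !in_itv/= andbT => /andP[_ h] h'.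
  by have := lt_le_trans h h'; rewrite ltxx.
have I1 : \int[leb]_(y in `[(a + r^-1)%R, +oo[) (EFin \o q) y <= 1%:E.
  rewrite -(integral_tail a r0); apply: ge0_le_integral => //.
  - apply/measurable_EFinP; apply: subspace_continuous_measurable_fun => //.
    apply: continuous_in_subspaceT => y; rewrite inE/= in_itv/= andbT => ya.
    by apply: continuous_at_inv_sqr; rewrite gt_eqF//; lra.
  - move=> y; rewrite /= in_itv/= andbT => ya; rewrite lee_fin; apply: qle.
    by rewrite gt_eqF//; lra.
have I2 : \int[leb]_(y in `](a - r^-1)%R, (a + r^-1)%R[) (EFin \o q) y <= 2%:E.
  apply: (@le_trans _ _ (\int[leb]_(y in `](a - r^-1)%R, (a + r^-1)%R[) (cst r%:E y))).
    apply: ge0_le_integral => //.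
    by move=> y _; rewrite lee_fin; exact: tri_hat_le.
  rewrite integral_cst//= lebesgue_measure_itv/= lte_fin ifT; last by lra.
  rewrite -EFinB -EFinM lee_fin.
  have -> : (r * (a + r^-1 - (a - r^-1)) = 2)%R by field; rewrite gt_eqF.
  exact: lexx.
have I3 : \int[leb]_(y in `]-oo, (a - r^-1)%R]) (EFin \o q) y <= 1%:E.
  pose G (y : R) := ((r * (y - a) ^+ 2)^-1)%R.
  have cG : {within `]-oo, (a - r^-1)%R], continuous G}.
    apply: continuous_in_subspaceT => y; rewrite inE/= in_itv/= => ya.
    by apply: continuous_at_inv_sqr; [rewrite gt_eqF|rewrite lt_eqF//; lra].
  apply: (@le_trans _ _ (\int[leb]_(y in `]-oo, (a - r^-1)%R]) (G y)%:E)).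
    apply: ge0_le_integral => //.
    - by apply/measurable_EFinP; apply: subspace_continuous_measurable_fun.
    - move=> y; rewrite /= in_itv/= => ya; rewrite lee_fin; apply: qle.
      by rewrite lt_eqF//; lra.
  have E : (a - r^-1 = - (- a + r^-1))%R by ring.
  rewrite E (ge0_integration_by_substitutionNy (G := G)).
  - rewrite -(integral_tail (- a) r0) le_eqVlt; apply/orP; left; apply/eqP.
    apply: eq_integral => y _; congr (_%:E); rewrite /G/=; congr (_^-1)%R; ring.
  - by rewrite -E.
  - by move=> y _; rewrite /G invr_ge0 mulr_ge0 ?sqr_ge0// ltW.
have -> : 4%:E = 1%:E + (2%:E + 1%:E) :> \bar R.
  by rewrite -!EFinD; congr EFin; ring.
by apply: leeD => //; exact: leeD.
Qed.

(** The Fourier transform of [box r] at x - y, as a function of y. It is symmetric because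
    [tri_hat r] is even. *)
Definition kernel n (r : R) (x y : tupleR n) : R :=
  tuple_prod (fun i t => tri_hat r (2 * pi * (nth 0%R x i - t))%R) y.

Lemma kernelC n r (x y : tupleR n) : kernel r x y = kernel r y x.
Proof.
apply: eq_bigr => i _; rewrite !(tnth_nth 0%R) -tri_hat_opp; congr tri_hat; ring.
Qed.

Lemma kernel_ge0 n r (x y : tupleR n) : (0 < r)%R -> (0 <= kernel r x y)%R.
Proof. by move=> r0; apply: tuple_prod_ge0 => i t; exact: tri_hat_ge0. Qed.

Lemma integral_kernel_le n r (x : tupleR n) : (0 < r)%R ->
  \int[bl n]_y (kernel r x y)%:E <= (4 ^+ n)%:E.
Proof.
move=> r0; rewrite integral_tuple_prod.
- apply: (@le_trans _ _ (\prod_(i < n) 4%:E)); last first.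
    by rewrite prodEFin prodr_const card_ord.
  suff /andP[] : 0 <= \prod_(i < n)
      \int[leb]_t (tri_hat r (2 * pi * (nth 0%R x i - t))%R)%:E <= \prod_(i < n) 4%:E.
    by [].
  elim/big_ind2 : _ => [|u v u' v' /andP[u0 uv] /andP[u'0 u'v']|i _].
  - by rewrite lee01 lexx.
  - by rewrite mule_ge0//= lee_pmul.
  - rewrite integral_tri_hat_le// andbT.
    by apply: integral_ge0 => t _; rewrite lee_fin tri_hat_ge0.
- move=> i; apply: measurableT_comp; first exact: measurable_tri_hat.
  by apply: measurable_funM => //; exact: measurable_funB.
- by move=> i t; exact: tri_hat_ge0.
Qed.

Lemma measurable_kernel n r : (0 < r)%R ->
  measurable_fun (setT : set (tupleR n * tupleR n)) (fun z => kernel r z.1 z.2).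
Proof.
move=> r0; apply: measurable_prod => i _.
apply: measurableT_comp; first exact: measurable_tri_hat.
apply: measurable_funM => //; apply: measurable_funB.
  rewrite (_ : (fun _ => _) = (fun z => tnth z i) \o fst); last first.
    by apply/funext => z /=; rewrite (tnth_nth 0%R).
  by apply: measurableT_comp => //; exact: measurable_tnth.
by apply: (measurableT_comp (measurable_tnth i)).
Qed.

End kernel_mass.

(* The canonical sigma-finiteness of a product is declared by the library only
   for subprobabilities; an alias gives access to the general case. *)
Section sigma_finite_product.
Context d1 d2 (T1 : measurableType d1) (T2 : measurableType d2) (R : realType).
Variables (m1 : {sigma_finite_measure set T1 -> \bar R}).
Variables (m2 : {sigma_finite_measure set T2 -> \bar R}).

Definition product_measure : set (T1 * T2)%type -> \bar R := m1 \x m2.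

HB.instance Definition _ := Measure.on product_measure.
HB.instance Definition _ := Measure_isSigmaFinite.Build _ _ _ product_measure
  (isSigmaFinite.sigma_finiteT
    (lebesgue_integral_fubini.measure_function_Measure_isSigmaFinite__to__measure_function_isSigmaFinite
      m1 m2)).

End sigma_finite_product.

Section integral_products.
Context d1 d2 (T1 : measurableType d1) (T2 : measurableType d2) (R : realType).
Variables (m1 : {sigma_finite_measure set T1 -> \bar R}).
Variables (m2 : {sigma_finite_measure set T2 -> \bar R}).

Lemma integrable_tensor (u : T1 -> R) (v : T2 -> R) :
  m1.-integrable setT (EFin \o u) -> m2.-integrable setT (EFin \o v) ->
  (m1 \x m2).-integrable setT (fun z => (u z.1 * v z.2)%:E).
Proof.
move=> iu iv; have /integrableP[/measurable_EFinP mu fu] := iu.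
have /integrableP[/measurable_EFinP mv fv] := iv.
have m : measurable_fun setT (fun z : T1 * T2 => (u z.1 * v z.2)%:E).
  by apply/measurable_EFinP; apply: measurable_funM; apply: measurableT_comp.
apply/integrableP; split=> //.
rewrite (@fubini_tonelli1 _ _ _ _ R m1 m2)//; last exact: measurableT_comp.
rewrite /fubini_F.
rewrite (eq_integral (fun x => (\int[m2]_y `|(v y)%:E|) * `|(u x)%:E|)); last first.
  move=> x _; rewrite (eq_integral (fun y => `|(u x)%:E| * `|(v y)%:E|)); last first.
    by move=> y _; rewrite -abseM -EFinM.
  rewrite ge0_integralZl//; first by rewrite muleC.
  by apply: measurableT_comp => //; exact/measurable_EFinP.
rewrite ge0_integralZl//; first last.
- by apply: integral_ge0 => y _; exact: abse_ge0.
- by apply: measurableT_comp => //; exact/measurable_EFinP.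
apply: lte_mul_pinfty => //; first by apply: integral_ge0 => y _; exact: abse_ge0.
by rewrite ge0_fin_numE//; apply: integral_ge0 => y _; exact: abse_ge0.
Qed.

Lemma integral_tensor (u : T1 -> R) (v : T2 -> R) :
  m1.-integrable setT (EFin \o u) -> m2.-integrable setT (EFin \o v) ->
  (\int[m1 \x m2]_z (u z.1 * v z.2) = (\int[m1]_x u x) * (\int[m2]_y v y))%R.
Proof.
move=> iu iv; have iuv := integrable_tensor iu iv.
rewrite /Rintegral -(integral12_prod_meas1 iuv).
have fv : \int[m2]_y (v y)%:E \is a fin_num by exact: (integrable_fin_num measurableT iv).
have fu : \int[m1]_x (u x)%:E \is a fin_num by exact: (integrable_fin_num measurableT iu).
rewrite -fineM//; congr fine.
transitivity (\int[m1]_x ((u x)%:E * \int[m2]_y (v y)%:E)).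
  apply: eq_integral => x _.
  transitivity (\int[m2]_y ((u x)%:E * (v y)%:E)); last by rewrite integralZl.
  by apply: eq_integral => y _; rewrite -EFinM.
by rewrite -(fineK fv) integralZr.
Qed.

End integral_products.

(** * The weighted Bessel inequality *)

Section bessel.
Context {R : realType} (n : nat).
Local Notation T := (n.-tuple (measurableTypeR R)).
Local Notation mu := (@borel_lebesgue R n).

Definition phase (xi x : n.-tuple R) : R := (2 * pi * dot xi x)%R.

Lemma measurable_dot : measurable_fun (setT : set (T * T)) (fun z => dot z.1 z.2).
Proof.
apply: measurable_sum => i; apply: measurable_funM.
  by apply: (measurableT_comp (measurable_tnth i)).
by apply: (measurableT_comp (measurable_tnth i)).
Qed.

Lemma measurable_phase : measurable_fun (setT : set (T * T)) (fun z => phase z.1 z.2).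
Proof. by apply: measurable_funM => //; exact: measurable_dot. Qed.

Lemma measurable_cos_phase2 :
  measurable_fun (setT : set (T * T)) (fun z => cos (phase z.1 z.2)).
Proof.
apply: measurableT_comp; last exact: measurable_phase.
by apply: continuous_measurable_fun; exact: continuous_cos.
Qed.

Lemma measurable_sin_phase2 :
  measurable_fun (setT : set (T * T)) (fun z => sin (phase z.1 z.2)).
Proof.
apply: measurableT_comp; last exact: measurable_phase.
by apply: continuous_measurable_fun; exact: continuous_sin.
Qed.

Lemma measurable_sectionr d' (T' : measurableType d') (g : T * T -> T') (xi : T) :
  measurable_fun setT g -> measurable_fun (setT : set T) (fun x => g (xi, x)).
Proof. by move=> mg; apply: measurableT_comp. Qed.

Lemma abs_sin_le1 (t : R) : (`|sin t| <= 1)%R.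
Proof. by rewrite ler_norml sin_geN1 sin_le1. Qed.

Variable f : T -> R.
Hypothesis if1 : mu.-integrable setT (EFin \o f).

Let mf : measurable_fun setT f.
Proof. by have /integrableP[/measurable_EFinP] := if1. Qed.

Lemma integrable_cos_phase xi :
  mu.-integrable setT (EFin \o (fun x => f x * cos (phase xi x))%R).
Proof.
apply: le_integrable if1 => //.
- apply/measurable_EFinP; apply: measurable_funM => //.
  exact: (measurable_sectionr xi measurable_cos_phase2).
- by move=> x _; rewrite /= lee_fin normrM ler_piMr// abs_cos_le1.
Qed.

Lemma integrable_sin_phase xi :
  mu.-integrable setT (EFin \o (fun x => f x * sin (phase xi x))%R).
Proof.
apply: le_integrable if1 => //.
- apply/measurable_EFinP; apply: measurable_funM => //.
  exact: (measurable_sectionr xi measurable_sin_phase2).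
- by move=> x _; rewrite /= lee_fin normrM ler_piMr// abs_sin_le1.
Qed.

(** For real f the Fourier transform is [cos_transform] - i [sin_transform]. The estimates are made
    for real functions and combined afterwards. *)
Definition cos_transform (xi : T) : R := (\int[mu]_x (f x * cos (phase xi x)))%R.
Definition sin_transform (xi : T) : R := (\int[mu]_x (f x * sin (phase xi x)))%R.

Local Notation P := (product_measure mu mu).

Lemma transform_sqr xi :
  (cos_transform xi ^+ 2 + sin_transform xi ^+ 2 =
   \int[P]_z (f z.1 * f z.2 * cos (phase xi z.1 - phase xi z.2)))%R.
Proof.
have ic := integrable_cos_phase xi; have is_ := integrable_sin_phase xi.
rewrite !expr2 /cos_transform /sin_transform -!integral_tensor//.
rewrite -RintegralD//; [|exact: (integrable_tensor ic ic)|exact: (integrable_tensor is_ is_)].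
by apply: eq_Rintegral => z _; rewrite cosB; ring.
Qed.

Lemma integral_box_phase (r : R) (x y : T) : (0 < r)%R ->
  (\int[mu]_xi (box r xi * cos (phase xi x - phase xi y)) = kernel r x y)%R.
Proof.
move=> r0.
rewrite (@eq_Rintegral _ _ _ mu setT (fun xi => box r xi * cos (0 +
   tuple_sum (fun i => 2 * pi * (nth 0 x i - nth 0 y i)) xi))%R); last first.
  move=> xi _; congr (_ * cos _)%R; rewrite add0r /phase /dot /tuple_sum.
  rewrite -mulrBr -sumrB mulr_sumr; apply: eq_bigr => i _.
  by rewrite !(tnth_nth 0%R); ring.
rewrite integral_box_cos// cos0 mul1r; apply: eq_bigr => i _.
by rewrite (tnth_nth 0%R).
Qed.

(** The weight [box r] makes the triple integral absolutely convergent. Integrating in xi first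
    turns the left side into the double integral of f(x) f(y) [kernel r x y]. Schur's test
    concludes: |f(x) f(y)| <= (f(x)^2 + f(y)^2) / 2, and the nonnegative kernel has mass at most 4^n
    in either variable. *)
Lemma bessel_box (r : R) : (0 < r)%R ->
  \int[mu]_xi (box r xi * (cos_transform xi ^+ 2 + sin_transform xi ^+ 2))%:E <=
  (4 ^+ n)%:E * \int[mu]_x (f x ^+ 2)%:E.
Proof.
move=> r0.
pose H (z : T * (T * T)) : \bar R :=
  (box r z.1 * (f z.2.1 * f z.2.2 * cos (phase z.1 z.2.1 - phase z.1 z.2.2)))%:E.
have mH : measurable_fun setT H.
  apply/measurable_EFinP; apply: measurable_funM.
    by apply: measurableT_comp => //; exact: measurable_box.
  apply: measurable_funM.
    by apply: measurable_funM; apply: measurableT_comp => //; apply: measurableT_comp.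
  apply: measurableT_comp; first by apply: continuous_measurable_fun; exact: continuous_cos.
  apply: measurable_funB.
    apply: (measurableT_comp measurable_phase (g := fun z : T * (T * T) => (z.1, z.2.1))).
    by apply/measurable_fun_pair => //; apply: measurableT_comp.
  apply: (measurableT_comp measurable_phase (g := fun z : T * (T * T) => (z.1, z.2.2))).
  by apply/measurable_fun_pair => //; apply: measurableT_comp.
have ibox : mu.-integrable setT (EFin \o box r).
  apply/integrableP; split; first by apply/measurable_EFinP; exact: measurable_box.
  under eq_integral do rewrite /= ger0_norm ?box_ge0//.
  by rewrite integral_box// ltry.
have iabs : mu.-integrable setT (EFin \o (fun x => `|f x|)%R).
  have := integrable_abse if1; apply: eq_integrable => //.
have iff : P.-integrable setT (@EFin R \o (fun z : T * T => `|f z.1| * `|f z.2|)%R).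
  exact: (integrable_tensor iabs iabs).
have iH : (mu \x P).-integrable setT H.
  have := @integrable_tensor _ _ _ _ R mu P (@box R n r)
    (fun z : T * T => `|f z.1| * `|f z.2|)%R ibox iff.
  apply: le_integrable => //.
  move=> z _; rewrite lee_fin !normrM !normr_id ler_wpM2l//.
  by rewrite ler_piMr ?mulr_ge0// abs_cos_le1.
have HE xi : \int[P]_z H (xi, z) =
    (box r xi * (cos_transform xi ^+ 2 + sin_transform xi ^+ 2))%:E.
  rewrite transform_sqr /H /=; under eq_integral do rewrite EFinM.
  have i2 : P.-integrable setT (EFin \o (fun z : T * T =>
      f z.1 * f z.2 * cos (phase xi z.1 - phase xi z.2))%R).
    have := integrable_tensor iabs iabs; apply: le_integrable => //.
      apply/measurable_EFinP; apply: measurable_funM.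
        by apply: measurable_funM; apply: measurableT_comp.
      apply: measurableT_comp; first by apply: continuous_measurable_fun; exact: continuous_cos.
      apply: measurable_funB.
        by apply: (measurableT_comp (measurable_sectionr xi measurable_phase)).
      by apply: (measurableT_comp (measurable_sectionr xi measurable_phase)).
    move=> z _; rewrite lee_fin !normrM !normr_id.
    by rewrite ler_piMr ?mulr_ge0// abs_cos_le1.
  rewrite integralZl// EFinM /Rintegral fineK//; exact: (integrable_fin_num measurableT i2).
have HG z : \int[mu]_xi H (xi, z) = (f z.1 * f z.2 * kernel r z.1 z.2)%:E.
  rewrite -(integral_box_phase z.1 z.2 r0) /H /=.
  rewrite (eq_integral (fun xi : T => (f z.1 * f z.2)%:E *
     (box r xi * cos (phase xi z.1 - phase xi z.2))%:E)); last first.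
    by move=> xi _; rewrite -EFinM; congr EFin; ring.
  have i3 : mu.-integrable setT (EFin \o (fun xi : T =>
      box r xi * cos (phase xi z.1 - phase xi z.2))%R).
    apply: le_integrable ibox => //.
    - apply/measurable_EFinP; apply: measurable_funM; first exact: measurable_box.
      apply: measurableT_comp; first by apply: continuous_measurable_fun; exact: continuous_cos.
      apply: measurable_funB.
        apply: (measurableT_comp measurable_phase (g := fun xi : T => (xi, z.1))).
        exact: measurable_fun_pair.
      apply: (measurableT_comp measurable_phase (g := fun xi : T => (xi, z.2))).
      exact: measurable_fun_pair.
    - move=> xi _; rewrite /= lee_fin normrM ler_piMr//; exact: abs_cos_le1.
  rewrite integralZl// [RHS]EFinM /Rintegral fineK//; exact: (integrable_fin_num measurableT i3).
have := Fubini iH.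
rewrite (eq_integral _ _ (fun xi _ => HE xi)) => ->.
rewrite (eq_integral _ _ (fun z _ => HG z)).
(* The two halves of the arithmetic-geometric bound, each integrated first in the variable on which
   f does not depend. *)
pose L (z : T * T) := (2^-1 * (f z.1 ^+ 2 * kernel r z.1 z.2))%:E : \bar R.
pose L' (z : T * T) := (2^-1 * (f z.2 ^+ 2 * kernel r z.1 z.2))%:E : \bar R.
have k0 (x y : T) := @kernel_ge0 R n r x y r0.
have L0 z : 0 <= L z by rewrite lee_fin mulr_ge0// mulr_ge0// ?sqr_ge0.
have L'0 z : 0 <= L' z by rewrite lee_fin mulr_ge0// mulr_ge0// ?sqr_ge0.
have mk := @measurable_kernel R n r r0.
have mL : measurable_fun setT L.
  apply/measurable_EFinP; apply: measurable_funM => //; apply: measurable_funM => //.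
  by apply: measurable_funX; apply: measurableT_comp.
have mL' : measurable_fun setT L'.
  apply/measurable_EFinP; apply: measurable_funM => //; apply: measurable_funM => //.
  by apply: measurable_funX; apply: measurableT_comp.
have mf2 : measurable_fun setT (fun x => (f x ^+ 2)%:E).
  by apply/measurable_EFinP; exact: measurable_funX.
have half (x : T) : \int[mu]_y (2^-1 * (f x ^+ 2 * kernel r x y))%:E <=
    (2^-1 * 4 ^+ n)%:E * (f x ^+ 2)%:E.
  rewrite (eq_integral (fun y => (2^-1 * f x ^+ 2)%:E * (kernel r x y)%:E)); last first.
    by move=> y _; rewrite -EFinM mulrA.
  rewrite ge0_integralZl//.
  - rewrite [leRHS](_ : _ = (2^-1 * f x ^+ 2)%:E * (4 ^+ n)%:E); last first.
      by rewrite -!EFinM; congr EFin; ring.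
    apply: lee_wpmul2l; first by rewrite lee_fin mulr_ge0// ?sqr_ge0.
    exact: integral_kernel_le.
  - by apply/measurable_EFinP; exact: (measurable_sectionr x mk).
  - by move=> y _; rewrite lee_fin.
  - by rewrite lee_fin mulr_ge0// ?sqr_ge0.
have tot : \int[mu]_x ((2^-1 * 4 ^+ n)%:E * (f x ^+ 2)%:E) =
    (2^-1 * 4 ^+ n)%:E * \int[mu]_x (f x ^+ 2)%:E.
  have c0 : 0 <= (2^-1 * 4 ^+ n : R)%:E by rewrite lee_fin mulr_ge0// exprn_ge0.
  by rewrite ge0_integralZl// => x _; rewrite lee_fin sqr_ge0.
apply: (@le_trans _ _ (\int[P]_z (L z + L' z))).
  apply: (@le_trans _ _ (\int[P]_z `|(f z.1 * f z.2 * kernel r z.1 z.2)%:E|)).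
    apply: (le_trans (lee_abs _)); apply: le_abse_integral => //.
    apply/measurable_EFinP; apply: measurable_funM => //.
    by apply: measurable_funM; apply: measurableT_comp.
  apply: ge0_le_integral => //.
  - apply: measurableT_comp => //; apply/measurable_EFinP; apply: measurable_funM => //.
    by apply: measurable_funM; apply: measurableT_comp.
  - exact: emeasurable_funD.
  - move=> z _; rewrite /L /L' -EFinD lee_fin !normrM (ger0_norm (k0 _ _)).
    rewrite -mulrDr -mulrDl mulrA ler_wpM2r//.
    rewrite -(real_normK (num_real (f z.1))) -(real_normK (num_real (f z.2))).
    by have := sqr_ge0 (`|f z.1| - `|f z.2|)%R; nra.
rewrite ge0_integralD//.
have -> : (4 ^+ n)%:E * \int[mu]_x (f x ^+ 2)%:E =
  (2^-1 * 4 ^+ n)%:E * \int[mu]_x (f x ^+ 2)%:E +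
  (2^-1 * 4 ^+ n)%:E * \int[mu]_x (f x ^+ 2)%:E.
  rewrite -ge0_muleDl ?lee_fin ?mulr_ge0 ?exprn_ge0// -EFinD.
  by congr (_%:E * _); field.
apply: leeD.
- rewrite (@fubini_tonelli1 _ _ _ _ R mu mu)// -tot; apply: ge0_le_integral => //.
  + by move=> x _; apply: integral_ge0 => y _; exact: L0.
  + exact: measurable_fun_fubini_tonelli_F.
  + exact: measurable_funeM.
  + by move=> x _; exact: half.
- rewrite (@fubini_tonelli2 _ _ _ _ R mu mu)// -tot; apply: ge0_le_integral => //.
  + by move=> x _; apply: integral_ge0 => y _; exact: L'0.
  + exact: measurable_fun_fubini_tonelli_G.
  + exact: measurable_funeM.
  + move=> y _; rewrite /fubini_G /L'/=; under eq_integral do rewrite kernelC.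
    exact: half.
Qed.

End bessel.

(** The integral of a signed function is the difference of those of its positive and negative parts,
    and Tonelli's theorem makes each of these measurable in x. *)
Lemma measurable_integral_section d1 d2 (T1 : measurableType d1)
    (T2 : measurableType d2) (R : realType)
    (m2 : {sigma_finite_measure set T2 -> \bar R}) (k : T1 * T2 -> \bar R) :
  measurable_fun setT k -> measurable_fun setT (fun x => \int[m2]_y k (x, y)).
Proof.
move=> mk; apply: (eq_measurable_fun (fun x : T1 =>
  fubini_F m2 (k^\+) x - fubini_F m2 (k^\-) x)).
  move=> x _ /=; rewrite [RHS]integralE /fubini_F; congr (_ - _);
    by apply: eq_integral => y _; rewrite !(funeposE, funenegE).
apply: emeasurable_funB; apply: measurable_fun_fubini_tonelli_F => //.
  exact: measurable_funepos.
exact: measurable_funeneg.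
Qed.

Section bessel_inequality.
Context {R : realType} (n : nat).
Local Notation T := (n.-tuple (measurableTypeR R)).
Local Notation mu := (@borel_lebesgue R n).
Variable f : T -> R.
Hypothesis if1 : mu.-integrable setT (EFin \o f).

Let mf : measurable_fun setT f.
Proof. by have /integrableP[/measurable_EFinP] := if1. Qed.

Lemma measurable_cos_transform : measurable_fun setT (cos_transform f).
Proof.
apply: measurableT_comp; first exact: fine_measurable measurableT.
apply: (@measurable_integral_section _ _ _ _ _ mu
  (fun z : T * T => (f z.2 * cos (phase z.1 z.2))%:E)).
apply/measurable_EFinP; apply: measurable_funM; first exact: measurableT_comp.
exact: measurable_cos_phase2.
Qed.

Lemma measurable_sin_transform : measurable_fun setT (sin_transform f).
Proof.
apply: measurableT_comp; first exact: fine_measurable measurableT.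
apply: (@measurable_integral_section _ _ _ _ _ mu
  (fun z : T * T => (f z.2 * sin (phase z.1 z.2))%:E)).
apply/measurable_EFinP; apply: measurable_funM; first exact: measurableT_comp.
exact: measurable_sin_phase2.
Qed.

(** 8^n = 2^n 4^n: the factor 4^n is that of [bessel_box], and 2^n is the price of removing a weight
    that is at least 2^-n on sets increasing to R^n. *)
Lemma bessel_inequality :
  \int[mu]_xi (cos_transform f xi ^+ 2 + sin_transform f xi ^+ 2)%:E <=
  (8 ^+ n)%:E * \int[mu]_x (f x ^+ 2)%:E.
Proof.
pose q (xi : T) := (cos_transform f xi ^+ 2 + sin_transform f xi ^+ 2)%:E.
have q0 xi : 0 <= q xi by rewrite lee_fin addr_ge0// sqr_ge0.
have mq : measurable_fun setT q.
  apply/measurable_EFinP; apply: measurable_funD; apply: measurable_funX.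
    exact: measurable_cos_transform.
  exact: measurable_sin_transform.
(* The sets where the weight of [bessel_box] is at least 2^-n exhaust R^n. *)
pose E (m : nat) := [set xi : T | (2^-1 ^+ n <= box m.+1%:R xi)%R].
have tri_homo (a b x : R) : (0 < a)%R -> (a <= b)%R -> (tri a x <= tri b x)%R.
  move=> a0 ab; rewrite /tri; apply: le_max2 => //.
  by rewrite lerD2l lerN2 ler_wpM2l// lef_pV2// posrE (lt_le_trans a0).
have Em m : measurable (E m).
  rewrite -[X in measurable X]setTI.
  have := @measurable_box R n m.+1%:R measurableT `[(2^-1 ^+ n)%R, +oo[%classic.
  rewrite (_ : _ @^-1` _ = E m); first by apply; exact: measurable_itv.
  by apply/seteqP; split => x /=; rewrite in_itv/= andbT.
have Eh : {homo E : i j / (i <= j)%N >-> (i <= j)%O}.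
  move=> i j ij; apply/subsetPset => xi /le_trans; apply.
  by apply: ler_prod => k _; rewrite tri_ge0 tri_homo// ler_nat.
have ET : \bigcup_m E m = setT.
  apply/seteqP; split=> // xi _.
  pose s := (\sum_(i < n) `|tnth xi i|)%R.
  have s0 : (0 <= s)%R by apply: sumr_ge0.
  (* A triangle of half-width at least 2 s is at least 1/2 at every coordinate of xi, since |xi_i|
     <= s. *)
  exists (Num.bound (2 * s)%R) => //; rewrite /E/=.
  have bs : (2 * s <= (Num.bound (2 * s)%R).+1%:R)%R.
    apply: ltW; apply: (lt_trans (archi_boundP _)); first by rewrite mulr_ge0.
    by rewrite ltr_nat.
  rewrite -[X in (_ ^+ X)%R]card_ord -prodr_const; apply: ler_prod => i _.
  rewrite invr_ge0 ler0n/= /tri le_max; apply/orP; right.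
  have : (`|tnth xi i| <= s)%R.
    by rewrite /s (bigD1 i)//= lerDl; apply: sumr_ge0.
  move: bs; set b := (_.+1%:R : R) => bs xs.
  have b0 : (0 < b)%R by rewrite ltr0n.
  rewrite lerBrDr -lerBrDl ler_pdivrMr//; lra.
have := @ge0_nondecreasing_set_cvg_integral _ _ R E q mu Eh Em
  (fun m => measurable_funTS mq) (fun m x _ => q0 x).
rewrite ET => /cvg_lim <- //; apply: lime_le.
  by apply: ereal_nondecreasing_is_cvgn => i j ij; apply: ge0_subset_integral => //;
    [exact: measurable_funTS|exact/subsetPset/Eh].
apply: nearW => m.
have -> : (8 ^+ n)%:E * \int[mu]_x (f x ^+ 2)%:E =
   (2 ^+ n)%:E * ((4 ^+ n)%:E * \int[mu]_x (f x ^+ 2)%:E).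
  rewrite muleA -EFinM -exprMn; congr ((_ ^+ _)%:E * _); ring.
apply: (@le_trans _ _ ((2 ^+ n)%:E * \int[mu]_xi ((box m.+1%:R xi)%:E * q xi))); last first.
  apply: lee_wpmul2l; first by rewrite lee_fin exprn_ge0.
  have := @bessel_box R n f if1 m.+1%:R (ltr0Sn _ _).
  apply: le_trans; rewrite le_eqVlt; apply/orP; left; apply/eqP.
  by apply: eq_integral => xi _; rewrite -EFinM.
have bm0 xi : 0 <= (box m.+1%:R xi)%:E * q xi.
  by apply: mule_ge0 => //; rewrite lee_fin box_ge0.
have mb : measurable_fun setT (fun xi : T => (box m.+1%:R xi)%:E * q xi).
  by apply: emeasurable_funM => //; apply/measurable_EFinP; exact: measurable_box.
rewrite -ge0_integralZl//.
apply: (@le_trans _ _ (\int[mu]_(x in E m) ((2 ^+ n)%:E * ((box m.+1%:R x)%:E * q x)))).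
  apply: ge0_le_integral => //.
  - exact: measurable_funTS.
  - by apply: measurable_funTS; exact: measurable_funeM.
  - move=> x Ex; rewrite /q -!EFinM lee_fin mulrA -[leLHS]mul1r.
    rewrite ler_wpM2r ?addr_ge0 ?sqr_ge0//.
    rewrite [leLHS](_ : _ = 2 ^+ n * 2^-1 ^+ n)%R; last by rewrite -exprMn divff ?expr1n.
    by rewrite ler_wpM2l// exprn_ge0.
apply: ge0_subset_integral => //; first exact: measurable_funeM.
by move=> x _; apply: mule_ge0.
Qed.

End bessel_inequality.

(* The filter instance of [almost_everywhere] is not found for a completed
   measure, hence these two forms for an abstract one. *)
Lemma ae_impl d (T : measurableType d) (R : realType) (mu : {measure set T -> \bar R})
    (P Q : T -> Prop) : (forall x, P x -> Q x) ->
  {ae mu, forall x, P x} -> {ae mu, forall x, Q x}.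
Proof. exact: filterS. Qed.

Lemma ae_impl2 d (T : measurableType d) (R : realType) (mu : {measure set T -> \bar R})
    (P Q S : T -> Prop) : (forall x, P x -> Q x -> S x) ->
  {ae mu, forall x, P x} -> {ae mu, forall x, Q x} -> {ae mu, forall x, S x}.
Proof. exact: filterS2. Qed.

(** * Borel representatives *)

Section borel_version.
Context d (T : measurableType d) (R : realType).
Variable mu : {measure set T -> \bar R}.
Local Notation cT := (caratheodory_type (mu^*)%mu).
Local Notation cmu := (@completed_measure_extension _ _ _ mu).

Lemma completed_extension_integral (f : T -> \bar R) :
  measurable_fun setT f -> \int[cmu]_x f x = \int[mu]_x f x.
Proof.
move=> mf; rewrite [LHS]integralE [RHS]integralE.
congr (_ - _); apply: completed_extension_integralE => //.
- exact: measurable_funepos.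
- exact: measurable_funeneg.
Qed.

Lemma exists_borel_version (f : T -> R) : sigma_finite setT mu ->
  measurable_fun (setT : set cT) f ->
  exists g : T -> R, [/\ measurable_fun setT g, forall x, (`|g x| <= `|f x|)%R &
    {ae cmu, forall x, f x = g x}].
Proof.
move=> sf mf; have [N [mN N0 mg]] := completed_measurable_fun_borel sf mf.
exists (fun x => f x * \1_(~` N) x)%R; split=> //.
- move=> x; rewrite normrM ler_piMr// indicE normr_nat.
  by case: (_ \in _).
- exists N; split; first exact: completed_extension_measurable.
    by rewrite completed_extensionE.
  move=> x /=; apply: contra_notP => Nx.
  by rewrite indicE mem_set// mulr1.
Qed.

End borel_version.

(** * Oscillatory integrals *)

Section complex_exponential.
Context {R : realType}.

Lemma Re_mul_expi (z : R[i]) (p : R) : complex.Re (z * expi (- p))%R =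
  (complex.Re z * cos p + complex.Im z * sin p)%R.
Proof. by case: z => a b; rewrite /expi /= cosN sinN; ring. Qed.

Lemma Im_mul_expi (z : R[i]) (p : R) : complex.Im (z * expi (- p))%R =
  (complex.Im z * cos p - complex.Re z * sin p)%R.
Proof. by case: z => a b; rewrite /expi /= cosN sinN; ring. Qed.

Lemma normc_expi (z : R[i]) (p : R) :
  Normc.normc (z * expi p)%R = Normc.normc z.
Proof.
apply/eqP; rewrite -(eqrXn2 (n := 2)) ?normc_ge0// !normc_sqr; apply/eqP.
have := cos2Dsin2 p; case: z => a b /= h.
transitivity ((a ^+ 2 + b ^+ 2) * (cos p ^+ 2 + sin p ^+ 2))%R; first ring.
by rewrite h mulr1.
Qed.

Lemma normc_le_ReIm (z : R[i]) :
  (Normc.normc z <= `|complex.Re z| + `|complex.Im z|)%R.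
Proof.
rewrite -(ler_sqr (y := (_ + _)%R)) ?nnegrE ?normc_ge0 ?addr_ge0// normc_sqr.
rewrite -(real_normK (num_real (complex.Re z))) -(real_normK (num_real (complex.Im z))).
by rewrite sqrrD -addrA lerD2l lerDr mulrn_wge0// mulr_ge0.
Qed.

Lemma sqrD_le (a b : R) : ((a + b) ^+ 2 <= 2 * (a ^+ 2 + b ^+ 2))%R.
Proof. by have := sqr_ge0 (a - b)%R; nra. Qed.

End complex_exponential.

Section oscillatory_integral.
Context d (T : measurableType d) (R : realType).
Variables (mu : {measure set T -> \bar R}) (p : T -> R).
Hypothesis mp : measurable_fun setT p.

(** The Fourier transform at one frequency, over an abstract measure and with an abstract phase. *)
Definition oscillatory (f : T -> R[i]) : R[i] :=
  cintegral mu setT (fun x => f x * expi (- p x))%R.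

Definition summable (f : T -> R[i]) :=
  cmeasurable mu setT f /\ \int[mu]_x modulus f x < +oo.

Lemma measurable_cos_comp : measurable_fun setT (fun x => cos (p x)).
Proof.
by apply: measurableT_comp => //; apply: continuous_measurable_fun; exact: continuous_cos.
Qed.

Lemma measurable_sin_comp : measurable_fun setT (fun x => sin (p x)).
Proof.
by apply: measurableT_comp => //; apply: continuous_measurable_fun; exact: continuous_sin.
Qed.

Section summable.
Variable f : T -> R[i].
Hypothesis sf : summable f.

Let mRe : measurable_fun setT (fun x => complex.Re (f x)). Proof. by case: sf => -[]. Qed.
Let mIm : measurable_fun setT (fun x => complex.Im (f x)). Proof. by case: sf => -[]. Qed.
Let Mf : Mplus mu setT (modulus f).
Proof. by apply: Mplus_modulus; case: sf. Qed.

Lemma integrable_le_modulus (g : T -> R) : measurable_fun setT g ->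
  (forall x, (`|g x| <= Normc.normc (f x))%R) -> mu.-integrable setT (EFin \o g).
Proof.
move=> mg gf; apply/integrableP; split; first exact/measurable_EFinP.
case: sf => _; apply: le_lt_trans; apply: ge0_le_integral => //.
- by apply: measurableT_comp => //; exact/measurable_EFinP.
- by case: Mf.
- by move=> x _; rewrite /= lee_fin.
Qed.

Lemma measurable_oscillatory_Re :
  measurable_fun setT (fun x => complex.Re (f x * expi (- p x))%R).
Proof.
rewrite (_ : (fun x => _) = fun x => complex.Re (f x) * cos (p x) +
  complex.Im (f x) * sin (p x))%R; last by apply/funext => x; rewrite Re_mul_expi.
apply: measurable_funD; apply: measurable_funM => //.
  exact: measurable_cos_comp.
exact: measurable_sin_comp.
Qed.

Lemma measurable_oscillatory_Im :
  measurable_fun setT (fun x => complex.Im (f x * expi (- p x))%R).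
Proof.
rewrite (_ : (fun x => _) = fun x => complex.Im (f x) * cos (p x) -
  complex.Re (f x) * sin (p x))%R; last by apply/funext => x; rewrite Im_mul_expi.
apply: measurable_funB; apply: measurable_funM => //.
  exact: measurable_cos_comp.
exact: measurable_sin_comp.
Qed.

Lemma integrable_oscillatory_Re :
  mu.-integrable setT (EFin \o (fun x => complex.Re (f x * expi (- p x))%R)).
Proof.
apply: integrable_le_modulus; first exact: measurable_oscillatory_Re.
by move=> x; rewrite -(normc_expi (f x) (- p x)); exact: ler_normc_Re.
Qed.

Lemma integrable_oscillatory_Im :
  mu.-integrable setT (EFin \o (fun x => complex.Im (f x * expi (- p x))%R)).
Proof.
apply: integrable_le_modulus; first exact: measurable_oscillatory_Im.
by move=> x; rewrite -(normc_expi (f x) (- p x)); exact: ler_normc_Im.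
Qed.

Lemma abs_Rintegral_le_modulus (g : T -> R) : measurable_fun setT g ->
  (forall x, (`|g x| <= Normc.normc (f x))%R) ->
  `|\int[mu]_x g x|%R%:E <= \int[mu]_x modulus f x.
Proof.
move=> mg gf; have ig := integrable_le_modulus mg gf.
rewrite /Rintegral -[leLHS]/(`|(fine _)%:E|) fineK; last first.
  exact: (integrable_fin_num measurableT ig).
apply: (le_trans (le_abse_integral _ _ _)) => //; first exact/measurable_EFinP.
apply: ge0_le_integral => //.
- by apply: measurableT_comp => //; exact/measurable_EFinP.
- by case: Mf.
- by move=> x _; rewrite lee_fin.
Qed.

(** The factor 2 arises from bounding the real and the imaginary part separately. *)
Lemma normc_oscillatory_le :
  (Normc.normc (oscillatory f))%:E <= 2%:E * \int[mu]_x modulus f x.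
Proof.
apply: (@le_trans _ _ (`|complex.Re (oscillatory f)| + `|complex.Im (oscillatory f)|)%:E).
  by rewrite lee_fin normc_le_ReIm.
have I0 : 0 <= \int[mu]_x modulus f x by apply: integral_ge0 => x _; case: Mf => _; exact.
have -> : 2%:E * \int[mu]_x modulus f x = \int[mu]_x modulus f x + \int[mu]_x modulus f x.
  by rewrite (_ : 2%:E = 1 + 1)// ge0_muleDl ?lee01// mul1e.
rewrite EFinD; apply: leeD.
- apply: abs_Rintegral_le_modulus; first exact: measurable_oscillatory_Re.
  by move=> x; rewrite -(normc_expi (f x) (- p x)); exact: ler_normc_Re.
- apply: abs_Rintegral_le_modulus; first exact: measurable_oscillatory_Im.
  by move=> x; rewrite -(normc_expi (f x) (- p x)); exact: ler_normc_Im.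
Qed.

End summable.

Lemma oscillatoryD f f1 f2 : summable f1 -> summable f2 ->
  (forall x, f x = f1 x + f2 x)%R ->
  oscillatory f = (oscillatory f1 + oscillatory f2)%R.
Proof.
move=> s1 s2 fE; rewrite /oscillatory /cintegral.
transitivity (Complex
  (\int[mu]_x (complex.Re (f1 x * expi (- p x)) + complex.Re (f2 x * expi (- p x))))%R
  (\int[mu]_x (complex.Im (f1 x * expi (- p x)) + complex.Im (f2 x * expi (- p x))))%R)%R.
  by congr Complex; apply: eq_Rintegral => x _; rewrite fE mulrDl;
    case: (f1 x * _)%R => ? ?; case: (f2 x * _)%R.
rewrite RintegralD//; [|exact: integrable_oscillatory_Re|exact: integrable_oscillatory_Re].
by rewrite RintegralD//; exact: integrable_oscillatory_Im.
Qed.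

End oscillatory_integral.

Section oscillatory_completion.
Context d (T : measurableType d) (R : realType).
Variable mu : {sigma_finite_measure set T -> \bar R}.
Local Notation cT := (caratheodory_type (mu^*)%mu).
Local Notation cmu := (@completed_measure_extension _ _ _ mu : {measure set cT -> \bar R}).

(** One pair of Borel functions u, v serves all phases, hence all frequencies. This is what allows
    the measurability of the transform in xi and Bessel's inequality to be taken over from the Borel
    measure. *)
Lemma oscillatory_borel (f : T -> R[i]) : summable cmu f -> exists u v : T -> R,
  [/\ mu.-integrable setT (EFin \o u), mu.-integrable setT (EFin \o v),
    forall x, (u x ^+ 2 + v x ^+ 2 <= Normc.normc (f x) ^+ 2)%R &
    forall p : T -> R, measurable_fun setT p -> oscillatory cmu p f =
      Complex (\int[mu]_x (u x * cos (p x)) + \int[mu]_x (v x * sin (p x)))%R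
              (\int[mu]_x (v x * cos (p x)) - \int[mu]_x (u x * sin (p x)))%R].
Proof.
move=> sf; have [[mRe mIm] _] := sf.
have sfmu := sigma_finiteT mu.
have [u [mu_ ule uE]] := exists_borel_version sfmu mRe.
have [v [mv vle vE]] := exists_borel_version sfmu mIm.
have int (g : T -> R) : measurable_fun setT g ->
    (forall x, (`|g x| <= Normc.normc (f x))%R) -> mu.-integrable setT (EFin \o g).
  move=> mg gf; have mgc : measurable_fun (setT : set cT) g := completed_extension_measurable_fun mg measurableT.
  have /integrableP[_] := integrable_le_modulus sf mgc gf.
  have mabs : measurable_fun setT (fun x : T => `|(EFin \o g) x|).
    by apply: measurableT_comp => //; exact/measurable_EFinP.
  rewrite (completed_extension_integral mu mabs).
  by move=> ?; apply/integrableP; split; [exact/measurable_EFinP|].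
have iu : mu.-integrable setT (EFin \o u).
  by apply: int => [|x]; [exact: mu_|rewrite (le_trans (ule x))// ler_normc_Re].
have iv : mu.-integrable setT (EFin \o v).
  by apply: int => [|x]; [exact: mv|rewrite (le_trans (vle x))// ler_normc_Im].
exists u, v; split; [exact: iu|exact: iv| |].
  move=> x; rewrite normc_sqr; apply: lerD.
    by rewrite -(real_normK (num_real (u x))) -(real_normK (num_real (complex.Re _))) ler_sqr ?nnegrE.
  by rewrite -(real_normK (num_real (v x))) -(real_normK (num_real (complex.Im _))) ler_sqr ?nnegrE.
move=> p mp; rewrite /oscillatory /cintegral.
have mc := measurable_cos_comp mp.
have ms := measurable_sin_comp mp.
have mpc : measurable_fun (setT : set cT) p := completed_extension_measurable_fun mp measurableT.
have red (g : T -> R) (h : T -> R) : measurable_fun (setT : set cT) g ->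
   measurable_fun setT h -> {ae cmu, forall x, g x = h x} ->
   (\int[cmu]_x g x = \int[mu]_x h x)%R.
  move=> mg mh gh; rewrite /Rintegral; congr fine.
  rewrite -(@completed_extension_integral _ T _ mu); last exact/measurable_EFinP.
  apply: ae_eq_integral; [exact: measurableT| | |].
  - exact/measurable_EFinP.
  - by apply/measurable_EFinP; exact: (completed_extension_measurable_fun mh measurableT).
  - by apply: ae_impl gh => x -> _.
have bnd (g h : T -> R) : mu.-integrable setT (EFin \o g) -> measurable_fun setT h ->
    (forall x, (`|h x| <= 1)%R) -> mu.-integrable setT (EFin \o (fun x => g x * h x)%R).
  move=> ig mh h1; have /integrableP[/measurable_EFinP mg _] := ig.
  apply: (le_integrable measurableT _ _ ig).
    by apply/measurable_EFinP; exact: measurable_funM.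
  by move=> x _; rewrite /= lee_fin normrM ler_piMr.
congr Complex.
- rewrite -RintegralD; [|exact: measurableT|exact: bnd iu mc (fun x => abs_cos_le1 _)|exact: bnd iv ms (fun x => abs_sin_le1 _)].
  apply: red; first exact: (measurable_oscillatory_Re mpc sf).
    by apply: measurable_funD; apply: measurable_funM.
  by apply: ae_impl2 uE vE => x ux vx; rewrite Re_mul_expi ux vx.
- rewrite -RintegralB; [|exact: measurableT|exact: bnd iv mc (fun x => abs_cos_le1 _)|exact: bnd iu ms (fun x => abs_sin_le1 _)].
  apply: red; first exact: (measurable_oscillatory_Im mpc sf).
    by apply: measurable_funB; apply: measurable_funM.
  by apply: ae_impl2 uE vE => x ux vx; rewrite Im_mul_expi ux vx.
Qed.

(* Stated for an abstract measure, where the Fourier transform is replaced by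
   any [F] whose square is dominated as in the identity of [oscillatory_borel]. *)
Lemma integral_normc_sqr_le (F f : T -> R[i]) (Qu Qv : T -> \bar R) (u v : T -> R) (c : R) :
  (0 <= c)%R -> cmeasurable cmu setT F -> cmeasurable cmu setT f ->
  measurable_fun setT Qu -> measurable_fun setT Qv ->
  (forall x, 0 <= Qu x) -> (forall x, 0 <= Qv x) ->
  (forall x, (Normc.normc (F x) ^+ 2)%:E <= 2%:E * (Qu x + Qv x)) ->
  measurable_fun setT u -> measurable_fun setT v ->
  (forall x, (u x ^+ 2 + v x ^+ 2 <= Normc.normc (f x) ^+ 2)%R) ->
  \int[mu]_x Qu x <= c%:E * \int[mu]_x (u x ^+ 2)%:E ->
  \int[mu]_x Qv x <= c%:E * \int[mu]_x (v x ^+ 2)%:E ->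
  \int[cmu]_x (Normc.normc (F x) ^+ 2)%:E <=
  (2 * c)%:E * \int[cmu]_x (Normc.normc (f x) ^+ 2)%:E.
Proof.
move=> c0 cF cf mQu mQv Qu0 Qv0 FQ mu_ mv uvf Hu Hv.
have sq (h : T -> R[i]) : cmeasurable cmu setT h ->
    measurable_fun (setT : set cT) (fun x => (Normc.normc (h x) ^+ 2)%:E).
  move=> /Mplus_modulus[/measurable_EFinP mh _].
  by apply/measurable_EFinP; exact: measurable_funX.
have mw2 (w : T -> R) : measurable_fun setT w -> measurable_fun setT (fun x => (w x ^+ 2)%:E).
  by move=> mw; apply/measurable_EFinP; exact: measurable_funX.
have w20 (w : T -> R) x : 0 <= (w x ^+ 2)%:E by rewrite lee_fin sqr_ge0.
have S0 x : 0 <= Qu x + Qv x by rewrite adde_ge0.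
have mS : measurable_fun setT (fun x => Qu x + Qv x) by exact: emeasurable_funD.
apply: (@le_trans _ _ (\int[cmu]_x (2%:E * (Qu x + Qv x)))).
  apply: ge0_le_integral; [exact: measurableT| |exact: sq| |].
  - by move=> x _; rewrite lee_fin sqr_ge0.
  - have m2 := measurable_funeM 2%:E mS.
    exact: (completed_extension_measurable_fun m2 measurableT).
  - by move=> x _; exact: FQ.
rewrite completed_extension_integral; last exact: measurable_funeM.
rewrite ge0_integralZl//.
rewrite ge0_integralD//.
rewrite EFinM -muleA; apply: lee_wpmul2l; first by rewrite lee_fin.
apply: (le_trans (leeD Hu Hv)).
rewrite -ge0_muleDr; [|exact: integral_ge0|exact: integral_ge0].
apply: lee_wpmul2l; first by rewrite lee_fin.
rewrite -ge0_integralD//; [|exact: mw2|exact: mw2].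
have m := emeasurable_funD (mw2 _ mu_) (mw2 _ mv).
rewrite -completed_extension_integral; last exact: m.
apply: ge0_le_integral; [exact: measurableT| | |exact: sq|].
- by move=> x _; rewrite adde_ge0.
- exact: (completed_extension_measurable_fun m measurableT).
- by move=> x _; rewrite -EFinD lee_fin.
Qed.

End oscillatory_completion.

(** * The Fourier transform of a summable function *)

Section fourier_transform.
Context {R : realType} (n : nat).
Local Notation T := (n.-tuple (measurableTypeR R)).
Local Notation mu := (@borel_lebesgue R n).
Local Notation L := (lebesgue_tuple R n).
Local Notation cT := (caratheodory_type (mu^*)%mu).
Implicit Types f : n.-tuple R -> R[i].

Lemma Lp_norm1E d (S : measurableType d) (nu : {measure set S -> \bar R}) (f : S -> R[i]) :
  Lp_norm nu setT 1 (modulus f) = \int[nu]_x modulus f x.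
Proof.
rewrite /Lp_norm patch_setT Lnorm1; apply: eq_integral => x _.
by rewrite abse_modulus.
Qed.

Lemma summable_Lspace f :
  Lspace_of L setT (Lp_norm L setT 1) f <-> summable L f.
Proof.
split=> -[cf]; first by move=> f1; split; [exact: cf|rewrite -Lp_norm1E].
by move=> f1; split; [exact: cf|rewrite Lp_norm1E].
Qed.

Lemma measurable_phase_section xi : measurable_fun setT (fun x : T => phase xi x).
Proof. exact: (@measurable_sectionr R n _ _ _ xi (@measurable_phase R n)). Qed.

Lemma measurable_phase_completed xi :
  measurable_fun (setT : set cT) (fun x => phase xi x).
Proof.
exact: (completed_extension_measurable_fun (measurable_phase_section xi) measurableT).
Qed.

Lemma fourierE f xi : fourier f xi = oscillatory L (phase xi) f.
Proof. by []. Qed.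

Lemma normc_fourier_le f xi : summable L f ->
  (Normc.normc (fourier f xi))%:E <= 2%:E * \int[L]_x modulus f x.
Proof. exact: (normc_oscillatory_le (measurable_phase_completed xi)). Qed.

Lemma fourierD f f1 f2 xi : summable L f1 -> summable L f2 ->
  (forall x, f x = f1 x + f2 x)%R ->
  fourier f xi = (fourier f1 xi + fourier f2 xi)%R.
Proof. exact: (oscillatoryD (measurable_phase_completed xi)). Qed.

Lemma fourier_borel f : summable L f -> exists u v : T -> R,
  [/\ mu.-integrable setT (EFin \o u), mu.-integrable setT (EFin \o v),
    forall x, (u x ^+ 2 + v x ^+ 2 <= Normc.normc (f x) ^+ 2)%R &
    forall xi, fourier f xi =
      Complex (cos_transform u xi + sin_transform v xi)%R
              (cos_transform v xi - sin_transform u xi)%R].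
Proof.
move=> /oscillatory_borel[u [v [iu iv uv fE]]]; exists u, v.
split; [exact: iu|exact: iv|exact: uv|].
by move=> xi; rewrite fourierE (fE _ (measurable_phase_section xi)).
Qed.

Lemma cmeasurable_fourier f : summable L f -> cmeasurable L setT (fourier f).
Proof.
move=> /fourier_borel[u [v [iu iv _ fE]]].
have mre : measurable_fun setT (fun xi : T => complex.Re (fourier f xi)).
  rewrite (_ : (fun _ => _) = fun xi => (cos_transform u xi + sin_transform v xi)%R).
    apply: measurable_funD; first exact: measurable_cos_transform.
    exact: measurable_sin_transform.
  by apply/funext => xi; rewrite fE.
have mim : measurable_fun setT (fun xi : T => complex.Im (fourier f xi)).
  rewrite (_ : (fun _ => _) = fun xi => (cos_transform v xi - sin_transform u xi)%R).
    apply: measurable_funB; first exact: measurable_cos_transform.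
    exact: measurable_sin_transform.
  by apply/funext => xi; rewrite fE.
split.
- exact: (completed_extension_measurable_fun mre measurableT).
- exact: (completed_extension_measurable_fun mim measurableT).
Qed.

(** Bessel's inequality for u and for v separately; their transforms mix in the real and imaginary
    parts of that of f, and (a + b)^2 <= 2 (a^2 + b^2) costs the factor 2. *)
Lemma integral_fourier_sqr f : summable L f ->
  \int[L]_xi (Normc.normc (fourier f xi) ^+ 2)%:E <=
  (2 * 8 ^+ n)%:E * \int[L]_x (Normc.normc (f x) ^+ 2)%:E.
Proof.
move=> sf; have [u [v [iu iv uv fE]]] := fourier_borel sf.
pose Q (w : T -> R) (xi : T) := (cos_transform w xi ^+ 2 + sin_transform w xi ^+ 2)%:E.
have Q0 w xi : 0 <= Q w xi by rewrite lee_fin addr_ge0// sqr_ge0.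
have mQ w : mu.-integrable setT (EFin \o w) -> measurable_fun setT (Q w).
  move=> iw; apply/measurable_EFinP; apply: measurable_funD; apply: measurable_funX.
    exact: measurable_cos_transform.
  exact: measurable_sin_transform.
have /integrableP[/measurable_EFinP mu_ _] := iu.
have /integrableP[/measurable_EFinP mv _] := iv.
apply: (@integral_normc_sqr_le _ T R mu (fourier f) f (Q u) (Q v) u v).
- by rewrite exprn_ge0.
- exact: cmeasurable_fourier.
- by case: sf.
- exact: mQ.
- exact: mQ.
- exact: Q0.
- exact: Q0.
- move=> xi; rewrite fE normc_sqr /= /Q -EFinD -EFinM lee_fin.
  have := sqrD_le (cos_transform u xi) (sin_transform v xi).
  have := sqrD_le (cos_transform v xi) (- sin_transform u xi)%R; rewrite sqrrN.
  by move=> ? ?; lra.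
- exact: mu_.
- exact: mv.
- exact: uv.
- exact: bessel_inequality.
- exact: bessel_inequality.
Qed.

End fourier_transform.

(** * The operator U controls the Fourier transform *)

Section rearrangement_more.
Context d (T : measurableType d) (R : realType).
Variables (mu : {measure set T -> \bar R}) (D : set T) (mD : measurable D).
Local Notation cT := (caratheodory_type (@wlength R idfun)^*%mu).
Local Notation lam := (@completed_lebesgue_measure R : {measure set cT -> \bar R}).
Local Notation rearr := (rearrangement mu D).

Lemma rearrangement_affine (h k : T -> \bar R) (c t : R) :
  Mplus mu D h -> Mplus mu D k -> (0 <= c)%R ->
  (forall x, D x -> h x <= c%:E + k x) -> rearr h t <= c%:E + rearr k t.
Proof.
move=> Mh Mk c0 hk; rewrite -leeBlDl//; apply: le_ereal_inf_tmp => _ [l [l0 dl] <-].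
rewrite leeBlDl// -EFinD; apply: rearrangement_le; first by rewrite addr_ge0.
apply: le_trans dl; rewrite (distribution_functionE _ Mh) (distribution_functionE _ Mk).
apply: le_measure; rewrite ?inE; [exact: (measurable_superlevel mD _ Mh)|
  exact: (measurable_superlevel mD _ Mk)|].
move=> x [Dx] /= ch; split=> //=.
have := lt_le_trans ch (hk x Dx); rewrite EFinD lteD2lE//.
Qed.

Lemma Mplus_comp (psi : R -> R) (k : T -> R) : measurable_fun setT psi ->
  (forall v, (0 <= psi v)%R) -> Mplus mu D (EFin \o k) ->
  Mplus mu D (fun x => (psi (k x))%:E).
Proof.
move=> mpsi psi0 [/measurable_EFinP mk _]; split.
  by apply/measurable_EFinP; exact: measurableT_comp.
by move=> x _; rewrite lee_fin.
Qed.

End rearrangement_more.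

Section integral_comp.
Context d (T : measurableType d) (R : realType).
Variables (mu : {measure set T -> \bar R}) (D : set T) (mD : measurable D).
Context d' (T' : measurableType d').
Variables (mu' : {measure set T' -> \bar R}) (D' : set T') (mD' : measurable D').

(** The condition on psi says that on [0, +oo) each of its superlevel sets is an open ray or empty.
    Superlevel sets of psi o k are then superlevel sets of k or empty, and equimeasurability of k
    and q passes to the compositions. *)
Lemma equimeasurable_integral_comp (k : T -> R) (q : T' -> R) (psi : R -> R) :
  Mplus mu D (EFin \o k) -> Mplus mu' D' (EFin \o q) ->
  (forall l, (0 <= l)%R -> distribution_function mu D (EFin \o k) l =
                           distribution_function mu' D' (EFin \o q) l) ->
  measurable_fun setT psi -> (forall v, (0 <= psi v)%R) ->
  (forall l, (0 <= l)%R ->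
    (exists2 l', (0 <= l')%R & forall v, (0 <= v)%R -> (l < psi v)%R = (l' < v)%R) \/
    (forall v, (0 <= v)%R -> (psi v <= l)%R)) ->
  \int[mu]_(x in D) (psi (k x))%:E = \int[mu']_(x in D') (psi (q x))%:E.
Proof.
move=> Mk Mq kq mpsi psi0 psiP.
have k0 x : D x -> (0 <= k x)%R by case: Mk => _ /(_ x); rewrite lee_fin.
have q0 x : D' x -> (0 <= q x)%R by case: Mq => _ /(_ x); rewrite lee_fin.
have M1 := Mplus_comp mpsi psi0 Mk; have M2 := Mplus_comp mpsi psi0 Mq.
apply: (equimeasurable_integral mD mD' M1 M2) => l l0.
rewrite (distribution_functionE l M1) (distribution_functionE l M2).
case: (psiP l l0) => [[l' l'0 E]|E].
- have := kq l' l'0; rewrite (distribution_functionE l' Mk) (distribution_functionE l' Mq).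
  rewrite (_ : D `&` [set x | l'%:E < (EFin \o k) x] = D `&` [set x | l%:E < (psi (k x))%:E]).
    rewrite (_ : D' `&` [set x | l'%:E < (EFin \o q) x] = D' `&` [set x | l%:E < (psi (q x))%:E])//.
    by apply/seteqP; split=> x [Dx] /= h; split=> //=; move: h; rewrite !lte_fin E// q0.
  by apply/seteqP; split=> x [Dx] /= h; split=> //=; move: h; rewrite !lte_fin E// k0.
- rewrite (_ : _ `&` _ = set0); last first.
    by apply/seteqP; split=> // x [Dx] /=; rewrite lte_fin ltNge E// k0.
  rewrite (_ : _ `&` _ = set0) ?measure0//.
  by apply/seteqP; split=> // x [Dx] /=; rewrite lte_fin ltNge E// q0.
Qed.

End integral_comp.

(** * Functions with monotone level sets *)

Section test_functions.
Context {R : realType}.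
Implicit Types l v c : R.

Lemma measurable_sqrR : measurable_fun (setT : set (measurableTypeR R)) (fun v : R => v ^+ 2)%R.
Proof. exact: measurable_funX. Qed.

Lemma lt_sqrP l v : (0 <= l)%R -> (0 <= v)%R -> (l < v ^+ 2)%R = (Num.sqrt l < v)%R.
Proof.
move=> l0 v0; rewrite -{1}(sqr_sqrtr l0) ltr_sqr// nnegrE//; exact: sqrtr_ge0.
Qed.

Lemma sqr_levelP l : (0 <= l)%R ->
  (exists2 l', (0 <= l')%R & forall v, (0 <= v)%R -> (l < v ^+ 2)%R = (l' < v)%R) \/
  (forall v, (0 <= v)%R -> (v ^+ 2 <= l)%R).
Proof.
by move=> l0; left; exists (Num.sqrt l); [exact: sqrtr_ge0|move=> v v0; exact: lt_sqrP].
Qed.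

Definition cut c v : R := (v * \1_(`]c, +oo[%classic) v)%R.

Lemma cutE c v : cut c v = (if c < v then v else 0)%R.
Proof.
rewrite /cut indicE; case: ifPn => cv.
  by rewrite mem_set ?mulr1//= in_itv/= cv.
by rewrite memNset ?mulr0//= in_itv/= andbT; exact/negP.
Qed.

Lemma measurable_cut c : measurable_fun (setT : set (measurableTypeR R)) (cut c).
Proof. by apply: measurable_funM => //; exact: measurable_indic. Qed.

Lemma cut_ge0 c v : (0 <= c)%R -> (0 <= cut c v)%R.
Proof. by move=> c0; rewrite cutE; case: ifPn => // /(le_lt_trans c0)/ltW. Qed.

Lemma cut_levelP c l : (0 <= c)%R -> (0 <= l)%R ->
  (exists2 l', (0 <= l')%R & forall v, (0 <= v)%R -> (l < cut c v)%R = (l' < v)%R) \/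
  (forall v, (0 <= v)%R -> (cut c v <= l)%R).
Proof.
move=> c0 l0; left; exists (Num.max c l); first by rewrite le_max c0.
move=> v v0; rewrite cutE gt_max; case: ifPn => //= _.
by apply/negbTE; rewrite -leNgt.
Qed.

(** The square of the part of v below c, extended by 0, is not monotone in v and does not commute
    with rearrangement; min(v, c)^2 dominates it and does. The maximum with 0 makes the function
    monotone on the whole line. *)
Definition trunc_sqr c v : R := (Num.min (Num.max v 0) c ^+ 2)%R.

Lemma trunc_sqrE c v : (0 <= v)%R -> trunc_sqr c v = (Num.min v c ^+ 2)%R.
Proof. by move=> v0; rewrite /trunc_sqr max_l. Qed.

Lemma measurable_trunc_sqr c : measurable_fun (setT : set (measurableTypeR R)) (trunc_sqr c).
Proof.
apply: measurable_funX; apply: measurable_minr => //; exact: measurable_maxr.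
Qed.

Lemma trunc_sqr_levelP c l : (0 <= c)%R -> (0 <= l)%R ->
  (exists2 l', (0 <= l')%R & forall v, (0 <= v)%R -> (l < trunc_sqr c v)%R = (l' < v)%R) \/
  (forall v, (0 <= v)%R -> (trunc_sqr c v <= l)%R).
Proof.
move=> c0 l0; case: (ltP (Num.sqrt l) c) => lc; [left|right].
- exists (Num.sqrt l) => [|v v0]; first exact: sqrtr_ge0.
  by rewrite trunc_sqrE// lt_sqrP ?le_min ?v0// lt_min lc andbT.
- move=> v v0; rewrite trunc_sqrE// leNgt lt_sqrP ?le_min ?v0//.
  by rewrite lt_min negb_and -!leNgt lc orbT.
Qed.

End test_functions.

(** * Energy estimates for U applied to a nonincreasing function *)

Section uop_energy.
Context {R : realType}.
Local Notation cT := (caratheodory_type (@wlength R idfun)^*%mu).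
Local Notation lam := (@completed_lebesgue_measure R : {measure set cT -> \bar R}).

Definition uop_fine (p : R -> R) (s : R) : R :=
  fine (\int[lam]_(x in `]0%R, (s^-1)%R[) (p x)%:E).

Variable p : R -> R.
Hypothesis np : nonneg_ninc p.
Hypothesis ip : \int[lam]_(x in Rplus) (p x)%:E < +oo.

Local Notation G := (uop_fine p).

Let ooR (s : R) : `]0%R, s[%classic `<=` @Rplus R.
Proof. by move=> x; rewrite /= in_itv/= RplusE => /andP[]. Qed.

Let mp (B : set R) : B `<=` Rplus -> measurable_fun (B : set cT) (EFin \o p).
Proof.
move=> BR; apply: measurable_funS measurable_Rplus BR _.
by case: (Mplus_nonneg_ninc np).
Qed.

Let mI (i : interval R) : measurable ([set` i] : set cT).
Proof. exact: completed_measurable_itv. Qed.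

Let p0 x : Rplus x -> 0 <= (p x)%:E.
Proof. by move=> Rx; rewrite lee_fin; apply np.1. Qed.

Let intS (B : set R) : measurable (B : set cT) -> B `<=` Rplus ->
  \int[lam]_(x in B) (p x)%:E <= \int[lam]_(x in Rplus) (p x)%:E.
Proof.
move=> mB BR; apply: ge0_subset_integral; [exact: mB|exact: measurable_Rplus|exact: mp| |exact: BR].
by move=> x Rx; exact: p0.
Qed.

Lemma uop_fineE s : (G s)%:E = \int[lam]_(x in `]0%R, (s^-1)%R[) (p x)%:E.
Proof.
rewrite fineK// ge0_fin_numE; last by apply: integral_ge0 => x /ooR; exact: p0.
by apply: le_lt_trans ip; exact: intS.
Qed.

Lemma uop_nonneg_ninc : nonneg_ninc G.
Proof.
split=> [x Rx|s t Rs st].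
  by rewrite -lee_fin uop_fineE; apply: integral_ge0 => y /ooR; exact: p0.
rewrite -lee_fin !uop_fineE; apply: ge0_subset_integral; [exact: mI|exact: mI| | |].
- by apply: mp; exact: ooR.
- by move=> x /ooR; exact: p0.
- move=> x; rewrite /= !in_itv/= => /andP[-> /lt_le_trans]; apply.
  rewrite RplusE in Rs.
  by rewrite lef_pV2// posrE// (lt_le_trans Rs).
Qed.

(** At 1/s the operator integrates p over (0, s), where p is at least p(s). *)
Lemma mulr_le_uop s : (0 < s)%R -> (s * p s <= G s^-1)%R.
Proof.
move=> s0; rewrite -lee_fin uop_fineE invrK.
rewrite (_ : (s * p s)%:E = \int[lam]_(x in `]0%R, s[) (cst (p s)%:E x)); last first.
  rewrite integral_cst; last exact: mI.
  by rewrite completed_lebesgue_itv /= lte_fin s0 sube0 -EFinM mulrC.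
apply: ge0_le_integral; [exact: mI| |exact: measurable_cst|by apply: mp; exact: ooR|].
- by move=> x _; apply: p0; rewrite RplusE.
- move=> x xs; rewrite lee_fin; apply np.2; first exact: ooR xs.
  by move: xs; rewrite /= in_itv/= => /andP[_ /ltW].
Qed.

Let nG := uop_nonneg_ninc.

Local Notation sqG B := (\int[lam]_(x in B) (G x ^+ 2)%:E).
Local Notation sqp B := (\int[lam]_(x in B) (p x ^+ 2)%:E).

Let ocR (s t : R) : (0 <= s)%R -> `]s, t]%classic `<=` @Rplus R.
Proof. by move=> s0 x; rewrite /= in_itv/= RplusE => /andP[+ _]; exact: le_lt_trans. Qed.

Lemma ninc_sqr_integral_bounds (F : R -> R) (s t : R) : nonneg_ninc F -> (0 < s)%R -> (s <= t)%R ->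
  ((t - s) * F t ^+ 2)%:E <= \int[lam]_(x in `]s, t]) (F x ^+ 2)%:E /\
  \int[lam]_(x in `]s, t]) (F x ^+ 2)%:E <= ((t - s) * F s ^+ 2)%:E.
Proof.
move=> nF s0 st; have cE c : ((t - s) * c)%:E = \int[lam]_(x in `]s, t]) (cst c%:E x).
  rewrite integral_cst; last exact: mI.
  rewrite completed_lebesgue_itv /= lte_fin.
  case: ltP => st'; first by rewrite -EFinB -EFinM mulrC.
  have -> : t = s by apply/eqP; rewrite eq_le st st'.
  by rewrite subrr mul0r mule0.
have mF : measurable_fun (`]s, t]%classic : set cT) (fun x => (F x ^+ 2)%:E).
  by apply: nonneg_ninc_measurable_sqr => //; apply: ocR; exact: ltW.
split; rewrite cE; apply: ge0_le_integral; try exact: mI; try exact: measurable_cst;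
  try exact: mF.
- by move=> x _; rewrite lee_fin sqr_ge0.
- move=> x xs; rewrite lee_fin; move: (xs); rewrite /= in_itv/= => /andP[sx xt].
  have Rx : Rplus x by rewrite RplusE (lt_trans s0).
  by rewrite ler_sqr ?nnegrE; [apply nF.2|apply nF.1; rewrite RplusE (lt_le_trans s0)|apply nF.1].
- by move=> x _; rewrite lee_fin sqr_ge0.
- move=> x xs; rewrite lee_fin; move: (xs); rewrite /= in_itv/= => /andP[sx xt].
  have Rx : Rplus x by rewrite RplusE (lt_trans s0).
  have Rs : Rplus s by rewrite RplusE.
  by rewrite ler_sqr ?nnegrE; [apply nF.2 => //; exact: ltW|apply nF.1|apply nF.1].
Qed.

(** Since s p(s) <= G(1/s), the left side is at most the integral of G(1/s)^2 / s^2 over (1/t, +oo),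
    which is int_0^t G^2 after the substitution s -> 1/s. Dyadic sums in place of the substitution
    cost the factor 2. *)
Lemma sqr_tail_le (t : R) : (0 < t)%R ->
  sqp `]t^-1%R, +oo[ <= 2%:E * sqG `]0%R, t].
Proof.
move=> t0; have y0 : (0 < t^-1)%R by rewrite invr_gt0.
have e0 k : (0 < 2 ^+ k :> R)%R by rewrite exprn_gt0.
have e1 k : (1 <= 2 ^+ k :> R)%R by rewrite exprn_ege1// ler1n.
have mG (B : set R) : B `<=` Rplus -> measurable_fun (B : set cT) (fun x => (G x ^+ 2)%:E).
  by move=> BR; exact: nonneg_ninc_measurable_sqr.
have mp2 (B : set R) : B `<=` Rplus -> measurable_fun (B : set cT) (fun x => (p x ^+ 2)%:E).
  by move=> BR; exact: nonneg_ninc_measurable_sqr.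
(* On dyadic pieces, s p(s) <= G(1/s) exchanges p at s for G at 1/s. *)
have fin N : sqp `]t^-1%R, (t^-1 * 2 ^+ N)%R] <= 2%:E * sqG `](t / 2 ^+ N)%R, t].
  elim: N => [|N IH].
    rewrite expr0 mulr1 divr1 !set_itvoc0 !integral_set0 mule0//.
  have split_p : `]t^-1%R, (t^-1 * 2 ^+ N.+1)%R]%classic =
      `]t^-1%R, (t^-1 * 2 ^+ N)%R] `|` `](t^-1 * 2 ^+ N)%R, (t^-1 * 2 ^+ N.+1)%R] :> set R.
    apply: itv_bndbnd_setU; rewrite bnd_simp.
      by rewrite ler_peMr// ltW.
    by rewrite ler_pM2l// exprS ler_peMl ?ler1n// ltW.
  have split_G : `](t / 2 ^+ N.+1)%R, t]%classic =
      `](t / 2 ^+ N.+1)%R, (t / 2 ^+ N)%R] `|` `](t / 2 ^+ N)%R, t] :> set R.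
    apply: itv_bndbnd_setU; rewrite bnd_simp.
      by rewrite ler_pM2l// lef_pV2 ?posrE// exprS ler_peMl ?ler1n// ltW.
    by rewrite ler_pdivrMr// ler_peMr// ltW.
  rewrite split_p split_G.
  have a0 : (0 <= t^-1 * 2 ^+ N)%R by rewrite mulr_ge0// ltW.
  have b0 : (0 < t / 2 ^+ N.+1)%R by rewrite divr_gt0.
  have b1 : (0 < t / 2 ^+ N)%R by rewrite divr_gt0.
  have disj (a b c : R) : [disjoint `]a, b]%classic & `]b, c]%classic].
    apply/disj_setPS => x []; rewrite /= !in_itv/= => /andP[_ xb] /andP[bx _].
    by have := lt_le_trans bx xb; rewrite ltxx.
  rewrite ge0_integral_setU; first last.
  - exact: disj.
  - by move=> x _; rewrite lee_fin sqr_ge0.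
  - apply: mp2 => x []; first by apply: ocR; exact: ltW.
    by apply: ocR.
  - exact: mI.
  - exact: mI.
  rewrite ge0_integral_setU; first last.
  - exact: disj.
  - by move=> x _; rewrite lee_fin sqr_ge0.
  - apply: mG => x []; first by apply: ocR; exact: ltW.
    by apply: ocR; exact: ltW.
  - exact: mI.
  - exact: mI.
  rewrite addeC ge0_muleDr; [|by apply: integral_ge0 => x _; rewrite lee_fin sqr_ge0
    |by apply: integral_ge0 => x _; rewrite lee_fin sqr_ge0].
  apply: leeD; last exact: IH.
  set z := (t^-1 * 2 ^+ N)%R in a0 *.
  have z0 : (0 < z)%R by rewrite mulr_gt0.
  have zE : (t / 2 ^+ N = z^-1)%R by rewrite /z invfM invrK.
  have zS : (t^-1 * 2 ^+ N.+1 = 2 * z)%R by rewrite /z exprS; ring.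
  have zSE : (t / 2 ^+ N.+1 = z^-1 / 2)%R by rewrite -zE exprS invfM; ring.
  rewrite zS zSE zE.
  have z2 : (z <= 2 * z)%R by lra.
  have zi0 : (0 < z^-1)%R by rewrite invr_gt0.
  have [_ U] := ninc_sqr_integral_bounds np z0 z2.
  have h0 : (0 < z^-1 / 2)%R by exact: divr_gt0.
  have h1 : (z^-1 / 2 <= z^-1)%R by rewrite ler_pdivrMr// ler_peMr ?ler1n// ltW.
  have [W _] := ninc_sqr_integral_bounds nG h0 h1.
  apply: (le_trans U); apply: (@le_trans _ _ (2%:E * ((z^-1 - z^-1 / 2) * G z^-1 ^+ 2)%:E)); last first.
    by apply: lee_wpmul2l => //; rewrite lee_fin.
  rewrite -EFinM lee_fin.
  have pz := mulr_le_uop z0.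
  have pz0 : (0 <= p z)%R by apply np.1; rewrite RplusE.
  have -> : ((2 * z - z) * p z ^+ 2 = z^-1 * (z * p z) ^+ 2)%R by field; rewrite gt_eqF.
  have -> : (2 * ((z^-1 - z^-1 / 2) * G z^-1 ^+ 2) = z^-1 * G z^-1 ^+ 2)%R by field; rewrite gt_eqF.
  have zp0 : (0 <= z * p z)%R by exact: mulr_ge0.
  by rewrite ler_pM2l// ler_sqr ?nnegrE// (le_trans zp0).
have p20 x : 0 <= (p x ^+ 2)%:E by rewrite lee_fin sqr_ge0.
have hE : {homo (fun N : nat => `]t^-1%R, (t^-1 * 2 ^+ N)%R]%classic : set cT) : i j / (i <= j)%N >-> (i <= j)%O}.
  move=> i j ij; apply/subsetPset => x; rewrite /= !in_itv/= => /andP[-> /le_trans]; apply.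
  by rewrite ler_pM2l// ler_weXn2l// ler1n.
have UE : \bigcup_N (`]t^-1%R, (t^-1 * 2 ^+ N)%R]%classic : set cT) = `]t^-1%R, +oo[%classic.
  apply/seteqP; split=> x; rewrite /= in_itv/=.
    by move=> [N _]; rewrite /= in_itv/= => /andP[-> _].
  rewrite andbT => tx; have [N xN] := exists_exp2_gt (t * x)%R.
  by exists N => //; rewrite /= in_itv/= tx/= mulrC ler_pdivlMr// mulrC ltW.
have inf : `]t^-1%R, +oo[%classic `<=` @Rplus R.
  by move=> x; rewrite /= in_itv/= RplusE andbT; exact: lt_trans.
have ocR' N : `]t^-1%R, (t^-1 * 2 ^+ N)%R]%classic `<=` @Rplus R by apply: ocR; exact: ltW.
have := @ge0_nondecreasing_set_cvg_integral _ cT R _ (fun x => (p x ^+ 2)%:E) lam hE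
  (fun N => mI _) (fun N => mp2 _ (ocR' N)) (fun N x _ => p20 x).
rewrite UE => /cvg_lim <-; last exact: ereal_hausdorff.
apply: lime_le.
  apply: ereal_nondecreasing_is_cvgn => i j ij; apply: ge0_subset_integral; [exact: mI|exact: mI| | |].
  - exact: mp2.
  - by move=> x _; rewrite lee_fin sqr_ge0.
  - by have := hE _ _ ij; move/subsetPset.
apply: nearW => N; apply: (le_trans (fin N)).
apply: lee_wpmul2l; first by rewrite lee_fin.
apply: ge0_subset_integral; [exact: mI|exact: mI| | |].
- by apply: mG; exact: itv0_Rplus.
- by move=> x _; rewrite lee_fin sqr_ge0.
- move=> x; rewrite /= !in_itv/= => /andP[+ ->]; rewrite andbT.
  by apply: lt_trans; rewrite divr_gt0.
Qed.

Lemma mulr_sqr_uop_le (t : R) : (0 < t)%R ->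
  (t * G t ^+ 2)%:E <= sqG `]0%R, t].
Proof.
move=> t0; rewrite (_ : (t * G t ^+ 2)%:E = \int[lam]_(x in `]0%R, t]) (cst (G t ^+ 2)%:E x)); last first.
  rewrite integral_cst; last exact: mI.
  by rewrite completed_lebesgue_itv /= lte_fin t0 sube0 -EFinM mulrC.
apply: ge0_le_integral; [exact: mI| |exact: measurable_cst| |].
- by move=> x _; rewrite lee_fin sqr_ge0.
- by apply: nonneg_ninc_measurable_sqr => //; exact: itv0_Rplus.
- move=> x xt; have Rx := itv0_Rplus xt; have Rt : Rplus t by rewrite RplusE.
  rewrite lee_fin ler_sqr ?nnegrE; [|by apply nG.1|by apply nG.1].
  by apply nG.2 => //; move: xt; rewrite /= in_itv/= => /andP[].
Qed.

(** 3 = 1 + 2. On (0, 1/t] the truncation contributes p(1/t)^2 / t, at most t G(t)^2 and so at most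
    int_0^t G^2; beyond 1/t the contribution is that of [sqr_tail_le]. *)
Lemma trunc_integral_le (t : R) : (0 < t)%R ->
  \int[lam]_(x in Rplus) (trunc_sqr (p t^-1) (p x))%:E <= 3%:E * sqG `]0%R, t].
Proof.
move=> t0; have y0 : (0 < t^-1)%R by rewrite invr_gt0.
have Ry : Rplus (t^-1)%R by rewrite RplusE.
have py0 : (0 <= p t^-1)%R by apply np.1.
have -> : @Rplus R = `]0%R, t^-1%R] `|` `]t^-1%R, +oo[.
  apply/seteqP; split=> x; rewrite /= ?in_itv/= RplusE.
    by move=> x0; rewrite x0/= andbT; case: leP; [left|right].
  by rewrite andbT => -[/andP[]|/(lt_trans y0)].
have SR : (`]0%R, t^-1%R] `|` `]t^-1%R, +oo[) `<=` @Rplus R.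
  by move=> x [/itv0_Rplus//|]; rewrite /= in_itv/= RplusE andbT; exact: lt_trans.
have mtr (B : set R) : B `<=` Rplus -> measurable_fun (B : set cT) (fun x => (trunc_sqr (p t^-1) (p x))%:E).
  move=> BR; apply/measurable_EFinP; apply: (measurableT_comp (measurable_trunc_sqr (p t^-1))).
  by have /measurable_EFinP := mp BR.
have tr0 x : 0 <= (trunc_sqr (p t^-1) (p x))%:E by rewrite lee_fin sqr_ge0.
rewrite ge0_integral_setU; first last.
- apply/disj_setPS => x []; rewrite /= !in_itv/= andbT => /andP[_ xb] bx.
  by have := lt_le_trans bx xb; rewrite ltxx.
- by move=> x _; exact: tr0.
- exact: mtr.
- exact: mI.
- exact: mI.
have -> : 3%:E * sqG `]0%R, t] = sqG `]0%R, t] + 2%:E * sqG `]0%R, t].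
  rewrite (_ : 3%:E = 1 + 2%:E); last by rewrite -EFinD; congr EFin; ring.
  by rewrite ge0_muleDl ?mul1e ?lee01 ?lee_fin.
apply: leeD.
- apply: le_trans (mulr_sqr_uop_le t0).
  apply: (@le_trans _ _ (\int[lam]_(x in `]0%R, t^-1%R]) (cst (p t^-1 ^+ 2)%:E x))).
    apply: ge0_le_integral; [exact: mI| | |exact: measurable_cst|].
    + by move=> x _; exact: tr0.
    + by apply: mtr; exact: itv0_Rplus.
    + move=> x _; rewrite lee_fin ler_sqr ?nnegrE//; first by rewrite ge_min lexx orbT.
      by rewrite le_min py0 le_max lexx orbT.
  rewrite integral_cst; last exact: mI.
  rewrite completed_lebesgue_itv /= lte_fin y0 sube0 -EFinM lee_fin.
  have := mulr_le_uop y0; rewrite invrK => le.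
  rewrite (_ : p t^-1 ^+ 2 * t^-1 = t * (t^-1 * p t^-1) ^+ 2)%R; last by field; rewrite gt_eqF.
  have z0 : (0 <= t^-1 * p t^-1)%R by rewrite mulr_ge0// ltW.
  by rewrite ler_pM2l// ler_sqr ?nnegrE// (le_trans z0).
- apply: le_trans (sqr_tail_le t0); apply: ge0_le_integral; [exact: mI| | | |].
  + by move=> x _; exact: tr0.
  + by apply: mtr => x xt; apply: SR; right.
  + by apply: nonneg_ninc_measurable_sqr => // x xt; apply: SR; right.
  + move=> x xt; have Rx : Rplus x by apply: SR; right.
    have px0 : (0 <= p x)%R by apply np.1.
    rewrite lee_fin trunc_sqrE// ler_sqr ?nnegrE//; first by rewrite ge_min lexx.
    by rewrite le_min px0.
Qed.

End uop_energy.

(** * Cutting a function at a height of its rearrangement *)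

Section calderon.
Context d (T : measurableType d) (R : realType).
Variable nu : {measure set T -> \bar R}.
Local Notation cT := (caratheodory_type (@wlength R idfun)^*%mu).
Local Notation lam := (@completed_lebesgue_measure R : {measure set cT -> \bar R}).
Local Notation rearr := (rearrangement nu setT).

Let mI (i : interval R) : measurable ([set` i] : set cT).
Proof. exact: completed_measurable_itv. Qed.

Definition star (h : T -> \bar R) (s : R) : R := fine (rearr h s).

Lemma nonneg_ninc_star h : (forall s, Rplus s -> rearr h s \is a fin_num) ->
  nonneg_ninc (star h).
Proof.
move=> hf; split=> [x Rx|s t Rs st]; first by apply: fine_ge0; exact: rearrangement_ge0.
apply: fine_le; [apply: hf|exact: hf|exact: rearrangement_ninc].
by move: Rs; rewrite !RplusE => /lt_le_trans; apply.
Qed.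

(** The rearrangement is at least its value at s on (0, s], so s times that value is at most the
    integral of h. *)
Lemma rearrangement_fin_summable h : Mplus nu setT h -> \int[nu]_x h x < +oo ->
  forall s, Rplus s -> rearr h s \is a fin_num.
Proof.
move=> Mh ih s Rs; have s0 : (0 < s)%R by rewrite -RplusE.
rewrite ge0_fin_numE ?rearrangement_ge0//.
have [mr r0] := Mplus_rearrangement nu setT h.
have sub := @itv0_Rplus R s.
have : \int[lam]_(x in `]0%R, s]) (cst (rearr h s) x) < +oo.
  apply: le_lt_trans ih; rewrite -(integral_rearrangement measurableT Mh).
  apply: (@le_trans _ _ (\int[lam]_(x in `]0%R, s]) rearr h x)).
    apply: ge0_le_integral; [exact: mI| |exact: measurable_cst| |].
    - by move=> x _; exact: rearrangement_ge0.
    - exact: (measurable_funS measurable_Rplus sub mr).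
    - by move=> x; rewrite /= in_itv/= => /andP[_ xs]; exact: rearrangement_ninc.
  apply: ge0_subset_integral; [exact: mI|exact: measurable_Rplus|exact: mr|exact: r0|exact: sub].
rewrite integral_cst; last exact: mI.
rewrite completed_lebesgue_itv /= lte_fin s0 sube0.
apply: contraTT; rewrite -!leNgt !leye_eq => /eqP ->.
by rewrite gt0_mulye// lte_fin.
Qed.

Lemma rearrangement_fin_bounded h (B : R) : Mplus nu setT h ->
  (forall x, h x <= B%:E) -> forall s, Rplus s -> rearr h s \is a fin_num.
Proof.
move=> Mh hB s Rs; have s0 : (0 < s)%R by rewrite -RplusE.
apply: rearrangement_fin_num => //; exists B; rewrite distribution_functionE//.
rewrite (_ : _ `&` _ = set0) ?measure0 ?lee_fin ?ltW//.
by apply/seteqP; split=> // x [_] /=; rewrite ltNge hB.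
Qed.

Lemma integral_star_comp (k : T -> R) (psi : R -> R) : Mplus nu setT (EFin \o k) ->
  (forall s, Rplus s -> rearr (EFin \o k) s \is a fin_num) ->
  measurable_fun (setT : set (measurableTypeR R)) psi -> (forall v, (0 <= psi v)%R) ->
  (forall l, (0 <= l)%R ->
    (exists2 l', (0 <= l')%R & forall v, (0 <= v)%R -> (l < psi v)%R = (l' < v)%R) \/
    (forall v, (0 <= v)%R -> (psi v <= l)%R)) ->
  \int[lam]_(s in Rplus) (psi (star (EFin \o k) s))%:E = \int[nu]_x (psi (k x))%:E.
Proof.
move=> Mk fin mpsi psi0 psiP; apply/esym.
have Ms : Mplus lam Rplus (EFin \o star (EFin \o k)).
  by apply: Mplus_nonneg_ninc; exact: nonneg_ninc_star.
apply: (equimeasurable_integral_comp measurableT measurable_Rplus Mk Ms _ mpsi psi0 psiP).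
move=> l l0; rewrite -(distribution_rearrangement measurableT Mk l0).
have E s : Rplus s -> (EFin \o star (EFin \o k)) s = rearr (EFin \o k) s.
  by move=> Rs; rewrite /= /star fineK//; exact: fin.
rewrite /distribution_function; congr (lam _).
by apply/seteqP; split=> s [Rs sl]; (split; first exact: Rs); move: sl; rewrite /mkset (E s Rs).
Qed.

(** The Fourier transform enters the estimate only through these properties: additivity, an L_1 ->
    L_oo bound with constant a, and an L_2 bound on summable functions with constant b. *)
Variables (A : (T -> R[i]) -> T -> R[i]) (a b : R).
Hypotheses (a0 : (0 <= a)%R) (b0 : (0 <= b)%R).
Hypothesis A_meas : forall f, summable nu f -> cmeasurable nu setT (A f).
Hypothesis A_bounded : forall f x, summable nu f ->
  (Normc.normc (A f x))%:E <= a%:E * \int[nu]_x modulus f x.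
Hypothesis A_add : forall f f1 f2 x, summable nu f1 -> summable nu f2 ->
  (forall x, f x = f1 x + f2 x)%R -> A f x = (A f1 x + A f2 x)%R.
Hypothesis A_sqr : forall f, summable nu f ->
  \int[nu]_x (Normc.normc (A f x) ^+ 2)%:E <=
  b%:E * \int[nu]_x (Normc.normc (f x) ^+ 2)%:E.

Lemma summable_Mplus f : summable nu f -> Mplus nu setT (modulus f).
Proof. by case=> cf _; exact: Mplus_modulus. Qed.

Lemma image_fin f : summable nu f ->
  forall s, Rplus s -> rearr (modulus (A f)) s \is a fin_num.
Proof.
move=> sf; have MA := Mplus_modulus (A_meas sf).
apply: (rearrangement_fin_bounded (B := (a * fine (\int[nu]_x modulus f x))%R) MA) => x.
have [_ if1] := sf; rewrite EFinM fineK; first exact: A_bounded.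
rewrite ge0_fin_numE//; apply: integral_ge0 => y _.
by rewrite lee_fin normc_ge0.
Qed.

Lemma summable_fin f : summable nu f ->
  forall s, Rplus s -> rearr (modulus f) s \is a fin_num.
Proof.
by move=> sf; apply: rearrangement_fin_summable; [exact: summable_Mplus|case: sf].
Qed.

Definition restrict_to (E : set T) (f : T -> R[i]) (x : T) : R[i] :=
  Complex (complex.Re (f x) * \1_E x)%R (complex.Im (f x) * \1_E x)%R.

Lemma restrict_toE E f x : restrict_to E f x = if x \in E then f x else 0%R.
Proof.
rewrite /restrict_to indicE; case: (f x) => u v /=.
by case: (_ \in _); rewrite ?mulr1 ?mulr0.
Qed.

Lemma summable_restrict E f : measurable E -> summable nu f -> summable nu (restrict_to E f).
Proof.
move=> mE sf; have [[mr mi] if1] := sf.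
have mE1 : measurable_fun setT (\1_E : T -> R) by exact: measurable_indic.
have cE : cmeasurable nu setT (restrict_to E f) by split; exact: measurable_funM.
split=> //; apply: le_lt_trans if1; apply: ge0_le_integral => //.
- by move=> x _; rewrite lee_fin normc_ge0.
- by case: (Mplus_modulus cE).
- by case: (summable_Mplus sf).
- move=> x _; rewrite lee_fin restrict_toE; case: ifPn => // _.
  by rewrite Normc.normc0 normc_ge0.
Qed.

Variable f : T -> R[i].
Hypothesis sf : summable nu f.
Local Notation p := (star (modulus f)).
Local Notation G := (uop_fine p).

Let np : nonneg_ninc p.
Proof. by apply: nonneg_ninc_star; exact: summable_fin. Qed.

Let pE s : Rplus s -> (p s)%:E = rearr (modulus f) s.
Proof. by move=> Rs; rewrite fineK//; exact: summable_fin. Qed.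

Let ip : \int[lam]_(x in Rplus) (p x)%:E < +oo.
Proof.
have [_] := sf; apply: le_lt_trans.
rewrite -(integral_rearrangement measurableT (summable_Mplus sf)).
by rewrite le_eqVlt; apply/orP; left; apply/eqP; apply: eq_integral => x; rewrite inE => /pE.
Qed.

Lemma Uop_star s : Uop (rearr (modulus f)) s = (G s)%:E.
Proof.
rewrite uop_fineE//; rewrite /Uop.
have -> : [set x : R | (0 < x < s^-1)%R] = `]0%R, (s^-1)%R[%classic.
  by apply/seteqP; split=> x; rewrite /= in_itv.
apply: eq_integral => x; rewrite inE => xs; rewrite -pE// RplusE.
by move: xs; rewrite /= in_itv/= => /andP[].
Qed.

Section cutting.
Variables (t : R) (t0 : (0 < t)%R).
Let y0 : (0 < t^-1)%R. Proof. by rewrite invr_gt0. Qed.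
Let c := p t^-1.
Let c0 : (0 <= c)%R. Proof. by apply np.1; rewrite RplusE. Qed.
Let E := [set x | (c < Normc.normc (f x))%R].

Let mE : measurable E.
Proof.
have := measurable_superlevel measurableT c%:E (summable_Mplus sf).
by rewrite setTI; congr measurable; apply/seteqP; split=> x; rewrite /= /modulus lte_fin.
Qed.

(** The left side is the integral of [cut c] along the rearrangement p of |f|. From 1/t on p is at
    most c and the integrand vanishes; what remains is at most int_0^{1/t} p = G(t). *)
Lemma integral_high_le : \int[nu]_x modulus (restrict_to E f) x <= (G t)%:E.
Proof.
rewrite (eq_integral (fun x => (cut c (Normc.normc (f x)))%:E)); last first.
  move=> x _; rewrite cutE /modulus restrict_toE; congr EFin.
  case: ifPn; first by rewrite inE /E /= => ->.
  by rewrite notin_setE => /negP/negbTE Ex; rewrite Normc.normc0 ifF.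
rewrite -(integral_star_comp (k := fun x => Normc.normc (f x)) (summable_Mplus sf)
  (summable_fin sf) (measurable_cut c) (fun v => cut_ge0 v c0) (fun l => cut_levelP c0)).
have RE : @Rplus R = `]0%R, (t^-1)%R[ `|` `[(t^-1)%R, +oo[.
  apply/seteqP; split=> x; rewrite /= ?in_itv/= RplusE.
    by move=> x0; rewrite x0/= andbT; case: ltP; [left|right].
  by rewrite andbT => -[/andP[]|/(lt_le_trans y0)].
have SR1 : `]0%R, (t^-1)%R[ `<=` @Rplus R by rewrite RE; exact: subsetUl.
have SR2 : `[(t^-1)%R, +oo[ `<=` @Rplus R by rewrite RE; exact: subsetUr.
have mp : measurable_fun (Rplus : set cT) (EFin \o p) by case: (Mplus_nonneg_ninc np).
have mc : measurable_fun (Rplus : set cT) (fun x => (cut c (p x))%:E).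
  apply/measurable_EFinP; apply: (measurableT_comp (measurable_cut c)).
  exact/measurable_EFinP.
have cut0 x : 0 <= (cut c (p x))%:E by rewrite lee_fin cut_ge0.
rewrite -[X in integral _ X](_ : `]0%R, (t^-1)%R[ `|` `[(t^-1)%R, +oo[ = _); last by rewrite RE.
rewrite ge0_integral_setU; first last.
- apply/disj_setPS => x []; rewrite /= !in_itv/= andbT => /andP[_ xb] bx.
  by have := lt_le_trans xb bx; rewrite ltxx.
- by move=> x _; exact: cut0.
- by rewrite -RE.
- exact: mI.
- exact: mI.
rewrite [X in _ + X]integral0_eq; last first.
  move=> x; rewrite /= in_itv/= andbT => tx; congr EFin; rewrite cutE ifF//.
  by apply/negbTE; rewrite -leNgt; apply np.2 => //; rewrite RplusE.
rewrite adde0 (uop_fineE np ip); apply: ge0_le_integral; [exact: mI| | | |].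
- by move=> x _; exact: cut0.
- exact: (measurable_funS measurable_Rplus SR1 mc).
- exact: (measurable_funS measurable_Rplus SR1 mp).
- move=> x /SR1 Rx; rewrite lee_fin cutE; case: ifPn => // _; exact: np.1.
Qed.

(** The low part is dominated by min(|f|, c), whose square integral can be computed on the
    rearrangement. *)
Lemma integral_low_sqr_le : \int[nu]_x (Normc.normc (restrict_to (~` E) f x) ^+ 2)%:E <=
  3%:E * \int[lam]_(x in `]0%R, t]) (G x ^+ 2)%:E.
Proof.
apply: le_trans (trunc_integral_le np ip t0).
rewrite (integral_star_comp (k := fun x => Normc.normc (f x)) (summable_Mplus sf)
  (summable_fin sf) (measurable_trunc_sqr c) (fun v => sqr_ge0 _)
  (fun l => trunc_sqr_levelP c0)).
have sf2 := summable_restrict (measurableC mE) sf.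
have [/measurable_EFinP m2 _] := summable_Mplus sf2.
have [/measurable_EFinP m1 _] := summable_Mplus sf.
apply: ge0_le_integral => //.
- by move=> x _; rewrite lee_fin sqr_ge0.
- by apply/measurable_EFinP; exact: measurable_funX.
- by apply/measurable_EFinP; exact: (measurableT_comp (measurable_trunc_sqr c)).
- move=> x _; rewrite lee_fin trunc_sqrE ?normc_ge0// restrict_toE.
  case: ifPn => [|_]; last by rewrite Normc.normc0 expr0n sqr_ge0.
  rewrite inE /E /= => /negP; rewrite -leNgt => h.
  by rewrite (min_l h).
Qed.

Lemma star_image_le s : Rplus s ->
  (star (modulus (A f)) s <= a * G t + star (modulus (A (restrict_to (~` E) f))) s)%R.
Proof.
move=> Rs; have s1 := summable_restrict mE sf.
have s2 := summable_restrict (measurableC mE) sf.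
rewrite -lee_fin EFinD !fineK; [|exact: image_fin|exact: image_fin].
have G0 : (0 <= G t)%R by apply (uop_nonneg_ninc np ip).1; rewrite RplusE.
apply: (rearrangement_affine measurableT).
- exact: (Mplus_modulus (A_meas sf)).
- exact: (Mplus_modulus (A_meas s2)).
- exact: mulr_ge0.
- move=> x _; rewrite /modulus (A_add x s1 s2); last first.
    move=> z; rewrite !restrict_toE in_setC; case: (_ \in _); [exact/esym/addr0|exact/esym/add0r].
  rewrite -EFinD lee_fin; apply: (le_trans (le_normcD _ _)).
  rewrite lerD2r -lee_fin EFinM; apply: (le_trans (A_bounded x s1)).
  by apply: lee_wpmul2l; [rewrite lee_fin|exact: integral_high_le].
Qed.

(** Split f at height c. The image of the high part is at most a G(t), and t G(t)^2 <= int_0^t G^2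
    gives 2 a^2; the L_2 bound on the low part gives 6 b = 2 b 3, with the 3 of
    [integral_low_sqr_le]. The 2 in both terms is that of (x + y)^2 <= 2 x^2 + 2 y^2. *)
Lemma calderon_energy :
  \int[lam]_(x in `]0%R, t]) (star (modulus (A f)) x ^+ 2)%:E <=
  (2 * a ^+ 2 + 6 * b)%:E * \int[lam]_(x in `]0%R, t]) (G x ^+ 2)%:E.
Proof.
have s2 := summable_restrict (measurableC mE) sf.
pose K := star (modulus (A (restrict_to (~` E) f))).
have nG := uop_nonneg_ninc np ip.
have nF : nonneg_ninc (star (modulus (A f))).
  by apply: nonneg_ninc_star; exact: image_fin.
have nK : nonneg_ninc K by apply: nonneg_ninc_star; exact: image_fin.
have Rt : Rplus t by rewrite RplusE.
have G0 : (0 <= G t)%R by exact: nG.1.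
have sub := @itv0_Rplus R t.
have mK (B : set R) : B `<=` Rplus -> measurable_fun (B : set cT) (fun x => (K x ^+ 2)%:E).
  by move=> BR; exact: nonneg_ninc_measurable_sqr.
have K0 x : 0 <= (K x ^+ 2)%:E by rewrite lee_fin sqr_ge0.
set I := \int[lam]_(x in `]0%R, t]) (G x ^+ 2)%:E.
have I0 : 0 <= I by apply: integral_ge0 => x _; rewrite lee_fin sqr_ge0.
have aG0 : 0 <= (2 * (a * G t) ^+ 2)%:E by rewrite lee_fin mulr_ge0// sqr_ge0.
apply: (@le_trans _ _ (\int[lam]_(x in `]0%R, t])
    (cst (2 * (a * G t) ^+ 2)%:E x + 2%:E * (K x ^+ 2)%:E))).
  apply: ge0_le_integral; [exact: mI| | | |].
  - by move=> x _; rewrite lee_fin sqr_ge0.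
  - exact: nonneg_ninc_measurable_sqr.
  - apply: emeasurable_funD; first exact: measurable_cst.
    by apply: measurable_funeM; exact: mK.
  - move=> x /sub Rx; rewrite -EFinM -EFinD lee_fin -mulrDr.
    apply: le_trans (sqrD_le _ _).
    have := star_image_le Rx; rewrite -/K => le.
    have F0 := nF.1 x Rx.
    by rewrite ler_sqr ?nnegrE// (le_trans F0).
rewrite ge0_integralD; first last.
- by apply: measurable_funeM; exact: mK.
- by move=> x _; rewrite mule_ge0// lee_fin.
- exact: measurable_cst.
- by move=> x _; exact: aG0.
- exact: mI.
rewrite [(2 * a ^+ 2 + 6 * b)%:E]EFinD ge0_muleDl; [|by rewrite lee_fin mulr_ge0// sqr_ge0|by rewrite lee_fin mulr_ge0].
apply: leeD.
- rewrite integral_cst; last exact: mI.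
  rewrite completed_lebesgue_itv /= lte_fin t0 sube0 -EFinM.
  apply: (@le_trans _ _ ((2 * a ^+ 2)%:E * (t * G t ^+ 2)%:E)).
    by rewrite -EFinM lee_fin le_eqVlt; apply/orP; left; apply/eqP; ring.
  apply: lee_wpmul2l; first by rewrite lee_fin mulr_ge0// sqr_ge0.
  exact: (mulr_sqr_uop_le np ip t0).
- rewrite ge0_integralZl; first last.
  + by rewrite lee_fin.
  + by move=> x _; exact: K0.
  + exact: mK.
  + exact: mI.
  have -> : (6 * b)%:E * I = 2%:E * (b%:E * (3%:E * I)).
    by rewrite !muleA -!EFinM; congr (_%:E * _); ring.
  apply: lee_wpmul2l; first by rewrite lee_fin.
  apply: (@le_trans _ _ (\int[lam]_(x in Rplus) (K x ^+ 2)%:E)).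
    apply: ge0_subset_integral; [exact: mI|exact: measurable_Rplus| | |exact: sub].
    + exact: mK.
    + by move=> x _; exact: K0.
  rewrite (integral_star_comp (k := fun x => Normc.normc (A (restrict_to (~` E) f) x))
    (Mplus_modulus (A_meas s2)) (image_fin s2) measurable_sqrR (fun v => sqr_ge0 v)
    (fun l => @sqr_levelP R l)).
  apply: (le_trans (A_sqr s2)); apply: lee_wpmul2l; first by rewrite lee_fin.
  exact: integral_low_sqr_le.
Qed.

End cutting.
End calderon.

(** * The inequality for the Fourier transform *)

Section sufficiency.
Context {R : realType} (n : nat).
Local Notation cT := (caratheodory_type (@wlength R idfun)^*%mu).
Local Notation lam := (@completed_lebesgue_measure R : {measure set cT -> \bar R}).
Local Notation L := (lebesgue_tuple R n).
Variables (rho sigma : (n.-tuple R -> \bar R) -> \bar R).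
Variables (rhobar sigmabar : (R -> \bar R) -> \bar R).
Hypothesis rhobar_ri : ri_norm completed_lebesgue_measure Rplus rhobar.
Hypothesis rhoE : forall f, Mplus L setT f -> rho f = rhobar (rearrangement L setT f).
Hypothesis sigmaE : forall f, Mplus L setT f -> sigma f = sigmabar (rearrangement L setT f).
Hypothesis interp : interpolation_space completed_lebesgue_measure Rplus
  (Lp_norm completed_lebesgue_measure Rplus 2%:E)
  (Lp_norm completed_lebesgue_measure Rplus +oo) rhobar.

Lemma sufficiency :
  (exists2 C : R, (0 < C)%R & forall g : R -> \bar R,
     Mplus completed_lebesgue_measure Rplus g -> sigmabar g < +oo ->
     rhobar (Uop g) <= C%:E * sigmabar g) ->
  exists2 C : R, (0 < C)%R & forall f : n.-tuple R -> R[i],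
    Lspace_of L setT sigma f -> Lspace_of L setT (Lp_norm L setT 1) f ->
    rho (modulus (fourier f)) <= C%:E * sigma (modulus f).
Proof.
move=> [C C0 UC]; have [B B0 BP] := interpolation_monotone rhobar_ri interp.
(* The constant of [calderon_energy] with a = 2 and b = 2 8^n. *)
pose K : R := (2 * 2 ^+ 2 + 6 * (2 * 8 ^+ n))%R.
have K0 : (0 < K)%R by rewrite /K ltr_pwDl// mulr_ge0// mulr_ge0// exprn_ge0.
exists (B * Num.sqrt K * C)%R; first by rewrite !mulr_gt0// sqrtr_gt0.
move=> f [_ sigmaf] /summable_Lspace sf.
have Mf := summable_Mplus sf.
have cf := cmeasurable_fourier sf.
have MF := Mplus_modulus cf.
have h8 : (0 <= 2 * 8 ^+ n :> R)%R by rewrite mulr_ge0// exprn_ge0.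
have h2 : (0 <= 2 :> R)%R by [].
have Fm := @cmeasurable_fourier R n.
have Fb h xi := @normc_fourier_le R n h xi.
have Fa h h1 h2 xi := @fourierD R n h h1 h2 xi.
have Fs := @integral_fourier_sqr R n.
have Ffin := @image_fin _ _ _ L (@fourier R n) 2%R Fm Fb f sf.
have nF : nonneg_ninc (star L (modulus (fourier f))) by exact: nonneg_ninc_star.
have np : nonneg_ninc (star L (modulus f)) by apply: nonneg_ninc_star; exact: summable_fin.
have UE := Uop_star sf.
set G := uop_fine (star L (modulus f)) in UE.
have ip : \int[lam]_(x in Rplus) (star L (modulus f) x)%:E < +oo.
  have [_] := sf; apply: le_lt_trans.
  rewrite -(integral_rearrangement measurableT Mf).
  rewrite le_eqVlt; apply/orP; left; apply/eqP; apply: eq_integral => x; rewrite inE => Rx.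
  by rewrite fineK//; exact: summable_fin.
have nG : nonneg_ninc G by exact: uop_nonneg_ninc.
have nKG := nonneg_ninc_scale (sqrtr_ge0 K) nG.
have MUG : Mplus lam Rplus (EFin \o G) by exact: Mplus_nonneg_ninc.
have energy := @calderon_energy _ _ _ L (@fourier R n) 2%R (2 * 8 ^+ n)%R h2 h8 Fm Fb Fa Fs f sf.
have G2 (t : R) : (0 < t)%R -> \int[lam]_(x in `]0%R, t]) ((Num.sqrt K * G x) ^+ 2)%:E =
    K%:E * \int[lam]_(x in `]0%R, t]) (G x ^+ 2)%:E.
  move=> t0; rewrite -ge0_integralZl; first last.
  - by rewrite lee_fin ltW.
  - by move=> x _; rewrite lee_fin sqr_ge0.
  - by apply: nonneg_ninc_measurable_sqr; [exact: nG|exact: itv0_Rplus].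
  - exact: completed_measurable_itv.
  by apply: eq_integral => x _; rewrite exprMn sqr_sqrtr ?EFinM// ltW.
(* G is bounded by the L_1 norm of f, so its energy is finite on (0, t], as K-monotonicity
   requires. *)
have Gb x : Rplus x -> (G x <= fine (\int[lam]_(x in Rplus) (star L (modulus f) x)%:E))%R.
  move=> Rx; rewrite -lee_fin (uop_fineE np ip) fineK; last first.
    rewrite ge0_fin_numE//; apply: integral_ge0 => y Ry.
    by rewrite lee_fin; exact: np.1.
  apply: ge0_subset_integral.
  - exact: completed_measurable_itv.
  - exact: measurable_Rplus.
  - by case: (Mplus_nonneg_ninc np).
  - by move=> y Ry; rewrite lee_fin; exact: np.1.
  - by move=> y; rewrite /= in_itv/= RplusE => /andP[].
have Gfin (t : R) : \int[lam]_(x in `]0%R, t]) ((Num.sqrt K * G x) ^+ 2)%:E < +oo.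
  set M := fine _ in Gb.
  apply: (@le_lt_trans _ _ (\int[lam]_(x in `]0%R, t]) (cst ((Num.sqrt K * M) ^+ 2)%:E x))).
    apply: ge0_le_integral.
    - exact: completed_measurable_itv.
    - by move=> x _; rewrite lee_fin sqr_ge0.
    - by apply: nonneg_ninc_measurable_sqr; [exact: nKG|exact: itv0_Rplus].
    - exact: measurable_cst.
    - move=> x /itv0_Rplus Rx; have gx0 := nG.1 x Rx; have gM := Gb x Rx.
      have h : (0 <= Num.sqrt K * G x)%R by exact: nKG.1.
      rewrite lee_fin ler_sqr ?nnegrE; [|exact: h|].
        by rewrite ler_wpM2l// sqrtr_ge0.
      by rewrite mulr_ge0 ?sqrtr_ge0// (le_trans gx0).
  rewrite integral_cst; last exact: completed_measurable_itv.
  rewrite completed_lebesgue_itv /= lte_fin; case: ifPn => _; last by rewrite mule0 ltry.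
  by rewrite sube0 -EFinM ltry.
have FG : rhobar (EFin \o star L (modulus (fourier f))) <=
    B%:E * rhobar (EFin \o (fun x => Num.sqrt K * G x)%R).
  apply: BP; [exact: nF|exact: nKG|exact: Gfin|].
  by move=> t t0; rewrite G2//; exact: energy.
have MFs : Mplus lam Rplus (EFin \o star L (modulus (fourier f))) by exact: Mplus_nonneg_ninc.
have -> : rho (modulus (fourier f)) = rhobar (EFin \o star L (modulus (fourier f))).
  rewrite rhoE//; apply: (ri_norm_ext rhobar_ri); [exact: Mplus_rearrangement|exact: MFs|].
  by move=> x Rx; rewrite /= fineK//; exact: Ffin.
apply: (le_trans FG).
have -> : rhobar (EFin \o (fun x => Num.sqrt K * G x)%R) = (Num.sqrt K)%:E * rhobar (EFin \o G).
  rewrite -(ri_normZ_ge0 rhobar_ri (sqrtr_ge0 K) MUG); congr rhobar.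
have -> : rhobar (EFin \o G) = rhobar (Uop (rearrangement L setT (modulus f))).
  by congr rhobar; apply/funext => s; rewrite UE.
have BK0 : 0 <= (B * Num.sqrt K)%:E by rewrite lee_fin mulr_ge0 ?sqrtr_ge0// ltW.
rewrite (sigmaE Mf) muleA -EFinM [(B * Num.sqrt K * C)%:E]EFinM -[leRHS]muleA.
apply: lee_wpmul2l; first exact: BK0.
apply: UC; first exact: Mplus_rearrangement.
by rewrite -sigmaE.
Qed.

End sufficiency.

(** * The Fourier transform controls the operator U *)

Section nested_sums.
Context {R : realType}.

Definition layers (T : Type) (N : nat) (v : nat -> R) (E : nat -> set T) (x : T) : R :=
  (\sum_(0 <= j < N) v j * \1_(E j) x)%R.

Lemma layers_ge0 (T : Type) N v (E : nat -> set T) x : (forall j, 0 <= v j)%R ->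
  (0 <= layers N v E x)%R.
Proof. by move=> v0; apply: sumr_ge0 => j _; rewrite mulr_ge0// indicE ler0n. Qed.

(** As the E_j shrink, the dual cubes on the frequency side grow; reversing the order restores the
    nesting that the following lemmas assume. *)
Lemma layers_rev (T : Type) N v (E : nat -> set T) x :
  layers N v E x = layers N (fun j => v (N - j.+1)%N) (fun j => E (N - j.+1)%N) x.
Proof. by rewrite /layers big_nat_rev/= add0n. Qed.

Lemma layers_in (T : Type) N v (E : nat -> set T) x k : (forall j, 0 <= v j)%R ->
  (forall i j, (i <= j < N)%N -> E j `<=` E i) -> (k < N)%N -> E k x ->
  (\sum_(0 <= j < k.+1) v j <= layers N v E x)%R.
Proof.
move=> v0 nE kN Ex; rewrite /layers [leRHS](big_cat_nat (n := k.+1))//=.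
rewrite -[leLHS]addr0; apply: lerD; last first.
  by apply: sumr_ge0 => j _; rewrite mulr_ge0// indicE ler0n.
rewrite !big_mkord; apply: ler_sum => j _; rewrite indicE mem_set ?mulr1//.
by apply: nE Ex; rewrite -ltnS ltn_ord.
Qed.

Lemma layers_notin (T : Type) N v (E : nat -> set T) x k : (forall j, 0 <= v j)%R ->
  (forall i j, (i <= j < N)%N -> E j `<=` E i) -> (k <= N)%N ->
  ((k < N)%N -> ~ E k x) ->
  (layers N v E x <= \sum_(0 <= j < k) v j)%R.
Proof.
move=> v0 nE kN Ex; rewrite /layers [leLHS](big_cat_nat (n := k))//=.
rewrite -[leRHS]addr0; apply: lerD.
  apply: ler_sum => j _; rewrite indicE; case: (_ \in _); rewrite ?mulr1//.
  by rewrite mulr0.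
rewrite big_nat_cond big1// => j /andP[/andP[kj jN] _].
rewrite indicE memNset ?mulr0// => Ejx; apply: (Ex (leq_ltn_trans kj jN)).
by apply: nE Ejx; rewrite kj.
Qed.

Section two_families.
Context d (T : measurableType d) (mu : {measure set T -> \bar R}) (D : set T).
Context d' (T' : measurableType d') (mu' : {measure set T' -> \bar R}) (D' : set T').

(** For nested sets, the superlevel set at l is E_k for the first k at which v_0 + ... + v_k exceeds
    l, and empty if there is none; it depends on the family only through the set E_k. *)
Lemma layers_distribution N v (E : nat -> set T) (E' : nat -> set T') (l : R) :
  (forall j, 0 <= v j)%R ->
  (forall i j, (i <= j < N)%N -> E j `<=` E i) ->
  (forall i j, (i <= j < N)%N -> E' j `<=` E' i) ->
  (forall j, (j < N)%N -> mu (D `&` E j) = mu' (D' `&` E' j)) ->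
  (0 <= l)%R ->
  distribution_function mu D (EFin \o layers N v E) l =
  distribution_function mu' D' (EFin \o layers N v E') l.
Proof.
move=> v0 nE nE' EE' l0; rewrite /distribution_function.
pose S k := (\sum_(0 <= j < k) v j)%R.
have abs (S0 : Type) (F : nat -> set S0) x :
    (l%:E < `|(EFin \o layers N v F) x|) = (l < layers N v F x)%R.
  by rewrite /= ger0_norm ?lte_fin// layers_ge0.
have [SN|SN] := leP (S N) l.
  rewrite (_ : _ `&` _ = set0); last first.
    apply/seteqP; split=> // x [_]; rewrite /mkset abs ltNge => /negP; apply.
    by apply: le_trans SN; apply: layers_notin => //; rewrite ltnn.
  rewrite (_ : _ `&` _ = set0) ?measure0//.
  apply/seteqP; split=> // x [_]; rewrite /mkset abs ltNge => /negP; apply.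
  by apply: le_trans SN; apply: layers_notin => //; rewrite ltnn.
have ex : exists k, (l < S k)%R by exists N.
have [k lk kmin] := ex_minnP ex.
case: k lk kmin => [|k] lk kmin; first by move: lk; rewrite /S big_geq// ltNge l0.
have kN : (k < N)%N by exact: kmin.
have Sk : (S k <= l)%R by rewrite leNgt; apply/negP => /kmin; rewrite ltnn.
have level (S0 : Type) (F : nat -> set S0) (B : set S0) :
    (forall i j, (i <= j < N)%N -> F j `<=` F i) ->
    B `&` [set x | l%:E < `|(EFin \o layers N v F) x|] = B `&` F k.
  move=> nF; apply/seteqP; split=> x [Bx]; rewrite /mkset ?abs => h; split=> //.
    apply: contrapT => nx; move: h; rewrite ltNge => /negP; apply.
    by apply: le_trans Sk; apply: layers_notin => //; exact: ltnW.
  by rewrite /mkset abs; apply: (lt_le_trans lk); exact: layers_in.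
by rewrite !level// EE'.
Qed.

End two_families.
End nested_sums.

(** * Sums of products of triangles and their Fourier transforms *)

Section cubes.
Context {R : realType} (n : nat).
Local Notation T := (n.-tuple (measurableTypeR R)).
Local Notation mu := (@borel_lebesgue R n).
Local Notation cT := (caratheodory_type (mu^*)%mu).
Local Notation L := (lebesgue_tuple R n : {measure set cT -> \bar R}).

Definition cube (r : R) : set T := [set x | forall i, (`|tnth x i| <= r)%R].

Lemma indic_cube r (x : T) :
  \1_(cube r) x = tuple_prod (fun=> \1_(`[(- r)%R, r]%classic) : R -> R) x.
Proof.
rewrite indicE /tuple_prod; case: (boolP (x \in cube r)) => xr.
  rewrite big1// => i _; rewrite indicE mem_set//= in_itv/= -ler_norml.
  by move: xr; rewrite inE; exact.
have [i ri] : exists i, ~ (`|tnth x i| <= r)%R.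
  by move: xr; rewrite notin_setE => /existsNP.
rewrite (bigD1 i)//= indicE memNset ?mul0r//= in_itv/= -ler_norml.
exact: ri.
Qed.

Lemma measurable_indic_itv (r : R) :
  measurable_fun (setT : set (measurableTypeR R)) (\1_(`[(- r)%R, r]%classic) : R -> R).
Proof. by apply: measurable_indic; exact: measurable_itv. Qed.

Lemma measurable_cube r : measurable (cube r).
Proof.
have := @measurable_tuple_prod R n (fun=> \1_(`[(- r)%R, r]%classic))
  (fun _ => measurable_indic_itv r) measurableT [set 1%R] (measurable_set1 _).
rewrite setTI; congr measurable; apply/seteqP; split=> x; rewrite /= -indic_cube indicE.
  by move=> /eqP; rewrite pnatr_eq1 eqb1 inE.
by move=> xr; rewrite mem_set.
Qed.

Lemma borel_lebesgue_cube r : (0 < r)%R -> mu (cube r) = ((2 * r) ^+ n)%:E.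
Proof.
move=> r0; rewrite -[cube r]setIT -integral_indic//; last exact: measurable_cube.
under eq_integral do rewrite indic_cube.
rewrite integral_tuple_prod.
- rewrite (eq_bigr (fun=> (2 * r)%:E)); first by rewrite prodEFin prodr_const card_ord.
  move=> i _; rewrite integral_indic; [|exact: measurableT|exact: measurable_itv].
  rewrite setIT; apply: (etrans (lebesgue_measure_itv _)).
  rewrite /= lte_fin ifT; last lra.
  by rewrite -EFinB; congr EFin; ring.
- by move=> _; exact: measurable_indic_itv.
- by move=> _ x; rewrite indicE ler0n.
Qed.

Lemma lebesgue_tuple_cube r : (0 < r)%R -> L (cube r) = ((2 * r) ^+ n)%:E.
Proof.
move=> r0; rewrite -(borel_lebesgue_cube r0); apply: completed_extensionE.
exact: measurable_cube.
Qed.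

Lemma box_le_cube r (x : T) : (0 < r)%R -> (box r x <= \1_(cube r) x)%R.
Proof.
move=> r0; rewrite indic_cube; apply: ler_prod => i _; rewrite tri_ge0/=.
rewrite indicE; case: (boolP (_ \in _)) => [_|]; first exact: tri_le1.
rewrite notin_setE/= in_itv/= -ler_norml => /negP; rewrite -ltNge => ri.
by rewrite tri_eq0// ltW.
Qed.

Section box_sum.
Variables (N : nat) (v r : nat -> R).
Hypotheses (v0 : forall j, (0 <= v j)%R) (r0 : forall j, (0 < r j)%R).

Definition box_sum (x : T) : R := (\sum_(0 <= j < N) v j * box (r j) x)%R.

Lemma box_sum_ge0 x : (0 <= box_sum x)%R.
Proof. by apply: sumr_ge0 => j _; rewrite mulr_ge0// box_ge0. Qed.

Lemma box_sum_le x : (box_sum x <= layers N v (fun j => cube (r j)) x)%R.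
Proof. by apply: ler_sum => j _; rewrite ler_wpM2l// box_le_cube. Qed.

Lemma measurable_box_sum : measurable_fun (setT : set T) box_sum.
Proof.
apply: measurable_sum => j; apply: measurable_funM => //; exact: measurable_box.
Qed.

Lemma integral_box_sum_lty : \int[mu]_x (box_sum x)%:E < +oo.
Proof.
have -> : \int[mu]_x (box_sum x)%:E = \sum_(0 <= j < N) \int[mu]_x (v j * box (r j) x)%:E.
  rewrite -ge0_integral_sum//.
  - by apply: eq_integral => x _; rewrite sumEFin.
  - move=> j; apply/measurable_EFinP; apply: measurable_funM => //; exact: measurable_box.
  - by move=> j x _; rewrite lee_fin mulr_ge0// box_ge0.
apply: lte_sum_pinfty => j _.
under eq_integral do rewrite EFinM.
rewrite ge0_integralZl//.
- by rewrite integral_box// -EFinM ltry.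
- by apply/measurable_EFinP; exact: measurable_box.
- by move=> x _; rewrite lee_fin box_ge0.
- by rewrite lee_fin.
Qed.

Definition box_fun (x : T) : R[i] := Complex (box_sum x) 0%R.

Lemma modulus_box_fun x : modulus box_fun x = (box_sum x)%:E.
Proof. by rewrite /modulus normc_real ger0_norm// box_sum_ge0. Qed.

Lemma summable_box_fun : summable L box_fun.
Proof.
split; first split.
- exact: (completed_extension_measurable_fun measurable_box_sum measurableT).
- exact: measurable_cst.
- apply: (@le_lt_trans _ _ (\int[L]_x (box_sum x)%:E)).
    rewrite le_eqVlt; apply/orP; left; apply/eqP.
    by apply: eq_integral => x _; exact: modulus_box_fun.
  have m : measurable_fun setT (fun x : T => (box_sum x)%:E).
    by apply/measurable_EFinP; exact: measurable_box_sum.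
  rewrite (completed_extension_integral mu m); exact: integral_box_sum_lty.
Qed.

Lemma Rintegral_box_phase (s : R) (xi : T) : (0 < s)%R ->
  (\int[mu]_x (box s x * cos (phase xi x)) = \prod_(i < n) tri_hat s (2 * pi * tnth xi i))%R.
Proof.
move=> s0.
rewrite (@eq_Rintegral _ _ _ mu setT (fun x => box s x * cos (0 +
   tuple_sum (fun i => 2 * pi * nth 0 xi i) x))%R); last first.
  move=> x _; congr (_ * cos _)%R; rewrite add0r /phase /dot /tuple_sum.
  by rewrite mulr_sumr; apply: eq_bigr => i _; rewrite !(tnth_nth 0%R); ring.
rewrite integral_box_cos// cos0 mul1r; apply: eq_bigr => i _.
by rewrite (tnth_nth 0%R).
Qed.

Lemma integrable_box_phase (s : R) (xi : T) : (0 < s)%R ->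
  mu.-integrable setT (EFin \o (fun x => box s x * cos (phase xi x))%R).
Proof.
move=> s0; have := @integrable_box_cos R n s (fun i => 2 * pi * nth 0 xi i)%R 0%R s0.
congr integrable; apply/funext => x; rewrite /=; congr (_ * cos _)%:E.
rewrite add0r /phase /dot /tuple_sum mulr_sumr.
by apply: eq_bigr => i _; rewrite !(tnth_nth 0%R); ring.
Qed.

Lemma Re_fourier_box_fun (xi : T) : complex.Re (fourier box_fun xi) =
  (\sum_(0 <= j < N) v j * \prod_(i < n) tri_hat (r j) (2 * pi * tnth xi i))%R.
Proof.
rewrite /fourier /cintegral /=.
have mc := @measurable_sectionr R n _ _ _ xi (@measurable_cos_phase2 R n).
have m : measurable_fun setT (fun x : T => (box_sum x * cos (phase xi x))%:E).
  by apply/measurable_EFinP; apply: measurable_funM; [exact: measurable_box_sum|exact: mc].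
transitivity (\int[L]_x (box_sum x * cos (phase xi x)))%R.
  apply: eq_Rintegral => x _.
  by rewrite /= cosN mul0r subr0.
rewrite /Rintegral (completed_extension_integral mu m) -/(Rintegral _ _ _).
have : forall M, mu.-integrable setT (EFin \o (fun x =>
     (\sum_(0 <= j < M) v j * box (r j) x) * cos (phase xi x))%R) /\
   (\int[mu]_x ((\sum_(0 <= j < M) v j * box (r j) x) * cos (phase xi x)) =
   \sum_(0 <= j < M) v j * \prod_(i < n) tri_hat (r j) (2 * pi * tnth xi i))%R.
  elim=> [|M [iM IH]].
    rewrite big_geq//; split.
      rewrite (_ : EFin \o _ = cst 0); first exact: integrable0.
      by apply/funext => x; rewrite /= big_geq// mul0r.
    rewrite /Rintegral integral0_eq// => x _.
    by rewrite big_geq// mul0r.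
  have ib := integrable_box_phase xi (r0 M).
  have iv : mu.-integrable setT (EFin \o (fun x => v M * (box (r M) x * cos (phase xi x)))%R).
    by have := integrableZl measurableT (v M) ib.
  have E x : ((\sum_(0 <= j < M.+1) v j * box (r j) x) * cos (phase xi x) =
     (\sum_(0 <= j < M) v j * box (r j) x) * cos (phase xi x) +
     v M * (box (r M) x * cos (phase xi x)))%R.
    by rewrite big_nat_recr//= mulrDl mulrA.
  split.
    rewrite (_ : EFin \o _ = ((EFin \o (fun x => (\sum_(0 <= j < M) v j * box (r j) x) * cos (phase xi x))%R)
      \+ (EFin \o (fun x => v M * (box (r M) x * cos (phase xi x)))%R))).
      exact: integrableD.
    by apply/funext => x; rewrite /= E EFinD.
  rewrite (eq_Rintegral _ (fun x _ => E x)) RintegralD// IH big_nat_recr//=.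
  by congr (_ + _)%R; rewrite RintegralZl// Rintegral_box_phase.
by move=> /(_ N)[].
Qed.

(** All transforms are nonnegative, so each layer may be bounded below on its own dual cube. There
    each of the n factors is at least cos 1 times r_j, which is (cos 1 / 2) (2 r_j). *)
Lemma normc_fourier_box_fun (xi : T) :
  ((cos 1 / 2) ^+ n * layers N (fun j => v j * (2 * r j) ^+ n)
     (fun j => cube ((2 * pi * r j)^-1)) xi <= Normc.normc (fourier box_fun xi))%R.
Proof.
apply: le_trans (ler_normc_Re _); rewrite Re_fourier_box_fun.
apply: le_trans (ler_norm _); rewrite /layers mulr_sumr; apply: ler_sum => j _.
rewrite -(mulrA (v j)) mulrCA; apply: ler_wpM2l => //.
rewrite indicE; case: (boolP (_ \in _)) => [|_]; last first.
  by rewrite !mulr0; apply: prodr_ge0 => i _; exact: tri_hat_ge0.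
rewrite inE => xir; rewrite mulr1 -exprMn.
rewrite (_ : cos 1 / 2 * (2 * r j) = cos 1 * r j)%R; last by field.
rewrite -[X in (_ ^+ X)%R]card_ord -prodr_const; apply: ler_prod => i _.
rewrite (mulr_ge0 (ltW (cos1_gt0 R)) (ltW (r0 j)))/=; apply: tri_hat_ge => //.
have p0 := @pi_gt0 R; have w0 : (0 < 2 * pi * r j)%R by rewrite !mulr_gt0.
have := xir i; rewrite -[X in (_ <= X)%R]mul1r ler_pdivlMr//.
rewrite !normrM (ger0_norm (ltW p0)) (ger0_norm (ltW (r0 j))) (ger0_norm (ler0n _ 2)).
by rewrite mulrC mulrAC.
Qed.

End box_sum.
End cubes.

(** * Dilations of step functions *)

Section dilations.
Context {R : realType}.
Local Notation cT := (caratheodory_type (@wlength R idfun)^*%mu).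
Local Notation lam := (@completed_lebesgue_measure R : {measure set cT -> \bar R}).

Let mI (i : interval R) : measurable ([set` i] : set cT).
Proof. exact: completed_measurable_itv. Qed.

Lemma nonneg_ninc_dilate (th : R) (F : R -> R) : (0 < th)%R -> nonneg_ninc F ->
  nonneg_ninc (fun x => F (th * x)%R).
Proof.
move=> th0 [F0 nF]; split=> [x|s s']; rewrite RplusE => x0.
  by apply: F0; rewrite RplusE mulr_gt0.
by move=> ss'; apply: nF; [rewrite RplusE mulr_gt0|rewrite ler_pM2l].
Qed.

Definition stair (N : nat) (v b : nat -> R) : R -> R :=
  layers N v (fun j => `]0%R, (b j)[%classic).

Variables (N : nat) (v b : nat -> R).
Hypotheses (v0 : forall j, (0 <= v j)%R) (b0 : forall j, (0 < b j)%R).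
Local Notation k := (stair N v b).

Lemma stairE (x : R) : (0 < x)%R ->
  k x = (\sum_(0 <= j < N) v j * ((x < b j)%R)%:R)%R.
Proof.
move=> x0; apply: eq_bigr => j _; rewrite indicE; congr (_ * (nat_of_bool _)%:R)%R.
by apply/idP/idP; rewrite inE/= in_itv/= x0.
Qed.

Lemma nonneg_ninc_stair : nonneg_ninc k.
Proof.
split=> [x _|s t Rs st]; first exact: layers_ge0.
have s0 : (0 < s)%R by rewrite -RplusE.
rewrite !stairE//; last exact: lt_le_trans st.
apply: ler_sum => j _; apply: ler_wpM2l => //; rewrite ler_nat.
by case: (ltP t (b j)) => // /(le_lt_trans st) ->.
Qed.

Lemma lam_initial (z t : R) : (0 < z)%R -> (0 < t)%R ->
  lam (`]0%R, z[%classic `&` `]0%R, t]%classic) = (Num.min z t)%:E.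
Proof.
move=> z0 t0; case: (leP z t) => zt.
  rewrite (_ : _ `&` _ = `]0%R, z[%classic).
    by rewrite completed_lebesgue_itv /= lte_fin z0 sube0.
  apply/seteqP; split=> x; rewrite /= !in_itv/=; first by case.
  by move=> /andP[-> xz]; rewrite xz/= (ltW (lt_le_trans xz zt)).
rewrite (_ : _ `&` _ = `]0%R, t]%classic).
  by rewrite completed_lebesgue_itv /= lte_fin t0 sube0.
apply/seteqP; split=> x; rewrite /= !in_itv/=; first by case.
by move=> /andP[-> xz]; rewrite xz (le_lt_trans xz zt).
Qed.

(** Squaring gives products of indicators of initial intervals, which are again such indicators. In
    this explicit form the dilation merely divides the endpoints by th, without a change of
    variables. *)
Lemma stair_energyE (th t : R) : (0 < th)%R -> (0 < t)%R ->
  \int[lam]_(x in `]0%R, t]) (k (th * x) ^+ 2)%:E =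
  (\sum_(0 <= i < N) \sum_(0 <= j < N)
     v i * v j * Num.min (Num.min (b i) (b j) / th) t)%:E.
Proof.
move=> th0 t0.
pose z i j := (Num.min (b i) (b j) / th)%R.
have z0 i j : (0 < z i j)%R by rewrite divr_gt0// lt_min !b0.
have mz (A : set R) i j : measurable_fun (A : set cT)
    (fun x => ((v i * v j)%:E * (\1_(`]0%R, z i j[%classic) x)%:E)).
  apply: measurable_funeM; apply/measurable_EFinP; apply: measurable_indic.
  exact: mI.
have f0 i j x : 0 <= (v i * v j)%:E * (\1_(`]0%R, z i j[%classic) x)%:E.
  by rewrite mule_ge0// lee_fin ?mulr_ge0// indicE ler0n.
transitivity (\int[lam]_(x in `]0%R, t]) \sum_(0 <= i < N) \sum_(0 <= j < N)
    ((v i * v j)%:E * (\1_(`]0%R, z i j[%classic) x)%:E)).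
  apply: eq_integral => x; rewrite inE/= in_itv/= => /andP[x0 _].
  rewrite stairE ?mulr_gt0// expr2 mulr_suml -sumEFin; apply: eq_bigr => i _.
  rewrite mulr_sumr -sumEFin; apply: eq_bigr => j _.
  rewrite -EFinM; congr EFin; rewrite mulrACA; congr (_ * _)%R.
  rewrite -natrM mulnb indicE; congr (nat_of_bool _)%:R.
  rewrite -!(ltr_pdivlMl _ _ th0) ![(th^-1 * _)%R]mulrC.
  apply/idP/idP; rewrite inE/= in_itv/= x0/= /z.
    by rewrite !ltr_pdivlMr// lt_min.
  by rewrite !ltr_pdivlMr// lt_min.
rewrite ge0_integral_sum; first last.
- by move=> i x _; apply: sume_ge0 => j _; exact: f0.
- by move=> i; apply: emeasurable_sum => j; exact: mz.
- exact: mI.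
rewrite -sumEFin; apply: eq_bigr => i _.
rewrite ge0_integral_sum; first last.
- by move=> j x _; exact: f0.
- by move=> j; exact: mz.
- exact: mI.
rewrite -sumEFin; apply: eq_bigr => j _.
rewrite ge0_integralZl; first last.
- by rewrite lee_fin mulr_ge0.
- by move=> x _; rewrite lee_fin indicE ler0n.
- by apply/measurable_EFinP; apply: measurable_indic; exact: mI.
- exact: mI.
rewrite integral_indic; [|exact: mI|exact: mI].
by rewrite [RHS]EFinM; congr (_ * _); exact: lam_initial.
Qed.

Lemma stair_energy_lty (t : R) : \int[lam]_(x in `]0%R, t]) (k x ^+ 2)%:E < +oo.
Proof.
have [t0|t0] := ltP 0%R t; last first.
  rewrite (_ : `]0%R, t]%classic = set0) ?integral_set0 ?ltry//.
  apply/seteqP; split=> // x; rewrite /= in_itv/= => /andP[x0 xt].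
  by have := lt_le_trans x0 (le_trans xt t0); rewrite ltxx.
have := stair_energyE (ltr01 : (0 < 1 :> R)%R) t0.
under eq_integral do rewrite mul1r.
by move=> ->; exact: ltry.
Qed.

(** Term by term, with w = min(b_i, b_j): th min(w / th, t) = min(w, th t) <= min(w, t). *)
Lemma stair_energy_dilation (th t : R) : (0 < th <= 1)%R -> (0 < t)%R ->
  \int[lam]_(x in `]0%R, t]) ((Num.sqrt th * k (th * x)) ^+ 2)%:E <=
  \int[lam]_(x in `]0%R, t]) (k x ^+ 2)%:E.
Proof.
move=> /andP[th0 th1] t0.
have nk := nonneg_ninc_dilate th0 nonneg_ninc_stair.
have -> : \int[lam]_(x in `]0%R, t]) ((Num.sqrt th * k (th * x)) ^+ 2)%:E =
    th%:E * \int[lam]_(x in `]0%R, t]) (k (th * x) ^+ 2)%:E.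
  rewrite -ge0_integralZl; first last.
  - by rewrite lee_fin ltW.
  - by move=> x _; rewrite lee_fin sqr_ge0.
  - exact: (nonneg_ninc_measurable_sqr nk (@itv0_Rplus R t)).
  - exact: mI.
  by apply: eq_integral => x _; rewrite exprMn sqr_sqrtr ?EFinM// ltW.
have -> : \int[lam]_(x in `]0%R, t]) (k x ^+ 2)%:E =
    \int[lam]_(x in `]0%R, t]) (k (1 * x) ^+ 2)%:E.
  by apply: eq_integral => x _; rewrite mul1r.
rewrite !stair_energyE// -EFinM lee_fin mulr_sumr; apply: ler_sum => i _.
rewrite mulr_sumr; apply: ler_sum => j _; rewrite mulrCA; apply: ler_wpM2l.
  exact: mulr_ge0.
set w := Num.min (b i) (b j); have w0 : (0 < w)%R by rewrite lt_min !b0.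
rewrite divr1 le_min; apply/andP; split.
  by rewrite -[leRHS](divfK (lt0r_neq0 th0)) mulrC ler_pM2r// ge_min lexx.
apply: (@le_trans _ _ (th * t)%R); first by rewrite ler_pM2l// ge_min lexx orbT.
by rewrite ler_piMl// ltW.
Qed.

Section interpolation.
Variable rhobar : (R -> \bar R) -> \bar R.
Hypothesis rhobar_ri : ri_norm completed_lebesgue_measure Rplus rhobar.
Variable B : R.
Hypothesis B0 : (0 < B)%R.
Hypothesis BP : forall F G, nonneg_ninc F -> nonneg_ninc G ->
  (forall t : R, \int[lam]_(x in `]0%R, t]) (G x ^+ 2)%:E < +oo) ->
  (forall t : R, (0 < t)%R -> \int[lam]_(x in `]0%R, t]) (F x ^+ 2)%:E <=
     \int[lam]_(x in `]0%R, t]) (G x ^+ 2)%:E) ->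
  rhobar (EFin \o F) <= B%:E * rhobar (EFin \o G).

Lemma ri_norm_dilation (th : R) : (0 < th <= 1)%R ->
  (Num.sqrt th)%:E * rhobar (EFin \o (fun x => k (th * x)%R)) <=
  B%:E * rhobar (EFin \o k).
Proof.
move=> th01; have /andP[th0 _] := th01.
have nkt := nonneg_ninc_dilate th0 nonneg_ninc_stair.
rewrite -(ri_normZ_ge0 rhobar_ri (sqrtr_ge0 th) (Mplus_nonneg_ninc nkt)).
apply: (BP (F := fun x => Num.sqrt th * k (th * x))%R).
- exact: (nonneg_ninc_scale (sqrtr_ge0 th) nkt).
- exact: nonneg_ninc_stair.
- exact: stair_energy_lty.
- by move=> t; exact: stair_energy_dilation.
Qed.

End interpolation.
End dilations.

(** * Domination of U g by a series of dilations *)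

Section min_series.
Context {R : realType}.

(** The term of the least m with s u < 4^(m+1) suffices: it is u if m = 0, and otherwise 4^m <= s u
    makes it at least 1/s. *)
Lemma min_le_geometric (u s : R) M : (0 < u)%R -> (0 < s)%R -> (s * u < 4 ^+ M.+1)%R ->
  (Num.min u s^-1 <= \sum_(0 <= m < M.+1) 4 ^- m * (u * ((s * u < 4 ^+ m.+1)%R)%:R))%R.
Proof.
move=> u0 s0 suM; have ex : exists m, (s * u < 4 ^+ m.+1)%R by exists M.
have [m sm mmin] := ex_minnP ex; have mM : (m <= M)%N by exact: mmin.
have t0 i : (0 <= 4 ^- i * (u * ((s * u < 4 ^+ i.+1)%R)%:R))%R.
  by rewrite mulr_ge0 ?invr_ge0 ?exprn_ge0// mulr_ge0// ltW.
rewrite (bigD1_seq m) ?mem_index_iota ?iota_uniq ?ltnS//=.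
rewrite -[leLHS]addr0; apply: lerD; last exact: sumr_ge0.
rewrite sm mulr1; case: m sm mmin {mM} => [|m] sm mmin.
  by rewrite expr0 invr1 mul1r ge_min lexx.
have : (4 ^+ m.+1 <= s * u)%R.
  by rewrite leNgt; apply/negP => /mmin; rewrite ltnn.
rewrite ge_min => h; apply/orP; right.
by rewrite ler_pdivlMl ?exprn_gt0// ler_pdivrMr// mulrC.
Qed.

End min_series.

Section uop_layers.
Context {R : realType}.
Local Notation cT := (caratheodory_type (@wlength R idfun)^*%mu).
Local Notation lam := (@completed_lebesgue_measure R : {measure set cT -> \bar R}).
Variables (N : nat) (c : R) (u : nat -> R) (E : nat -> set R).
Hypothesis c0 : (0 <= c)%R.
Hypothesis u0 : forall j, (0 < u j)%R.
Hypothesis mE : forall j, measurable (E j : set cT).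
Hypothesis uE : forall j, (j < N)%N -> lam (Rplus `&` E j) = (u j)%:E.
Local Notation g := (EFin \o layers N (fun=> c) E).

Let mI (i : interval R) : measurable ([set` i] : set cT).
Proof. exact: completed_measurable_itv. Qed.

Lemma Mplus_layers (v : nat -> R) : (forall j, 0 <= v j)%R -> Mplus lam Rplus (EFin \o layers N v E).
Proof.
move=> v0; split; last by move=> x _; rewrite lee_fin layers_ge0.
apply/measurable_EFinP; apply: measurable_sum => j; apply: measurable_funM.
  exact: measurable_cst.
by apply: measurable_indic; exact: mE.
Qed.

Lemma Uop_ninc (h : R -> \bar R) : Mplus lam Rplus h -> Mplus lam Rplus (Uop h).
Proof.
move=> [mh h0]; have setE (s : R) : [set x : R | (0 < x < s^-1)%R] = `]0%R, (s^-1)%R[%classic.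
  by apply/seteqP; split=> x; rewrite /= in_itv.
have sub (s : R) : `]0%R, (s^-1)%R[%classic `<=` @Rplus R.
  by move=> x; rewrite /= in_itv/= RplusE => /andP[].
split; last first.
  by move=> s _; rewrite /Uop setE; apply: integral_ge0 => x /sub; exact: h0.
apply: ninc_measurable_fun => s t; rewrite !inE => Rs Rt st.
rewrite /Uop !setE; apply: ge0_subset_integral; [exact: mI|exact: mI| | |].
- exact: (measurable_funS measurable_Rplus (@sub s) mh).
- by move=> x /sub; exact: h0.
- move=> x; rewrite /= !in_itv/= => /andP[-> /lt_le_trans]; apply.
  by rewrite lef_pV2// posrE -RplusE.
Qed.

Lemma Uop_layers_le (s : R) : (0 < s)%R ->
  Uop g s <= (\sum_(0 <= j < N) c * Num.min (u j) s^-1)%:E.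
Proof.
move=> s0; rewrite /Uop.
have -> : [set x : R | (0 < x < s^-1)%R] = `]0%R, (s^-1)%R[%classic.
  by apply/seteqP; split=> x; rewrite /= in_itv.
set I := `]0%R, (s^-1)%R[%classic.
have mIE j : measurable_fun (I : set cT) (fun x => (c%:E * (\1_(E j) x)%:E)).
  apply: measurable_funeM; apply/measurable_EFinP; apply: measurable_indic; exact: mE.
have f0 j x : 0 <= c%:E * (\1_(E j) x)%:E :> \bar R.
  by rewrite mule_ge0// lee_fin indicE ler0n.
have -> : \int[lam]_(x in I) g x = \int[lam]_(x in I) (\sum_(0 <= j < N) c%:E * (\1_(E j) x)%:E).
  apply: eq_integral => x _.
  by rewrite /= /layers -sumEFin; apply: eq_bigr => j _; rewrite EFinM.
rewrite ge0_integral_sum; first last.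
- by move=> j x _; exact: f0.
- by move=> j; exact: mIE.
- exact: mI.
rewrite -sumEFin !big_mkord; apply: lee_sum => j _.
rewrite ge0_integralZl; first last.
- by rewrite lee_fin.
- by move=> x _; rewrite lee_fin indicE ler0n.
- by apply/measurable_EFinP; apply: measurable_indic; exact: mE.
- exact: mI.
rewrite EFinM; apply: lee_wpmul2l; first by rewrite lee_fin.
rewrite integral_indic; [|exact: mI|exact: mE].
have IR : I `<=` Rplus by move=> x; rewrite /I/= in_itv/= RplusE => /andP[].
rewrite EFin_min le_min; apply/andP; split.
  rewrite -(uE (ltn_ord j)); apply: le_measure; rewrite ?inE.
  - by apply: measurableI; [exact: mE|exact: mI].
  - by apply: measurableI; [exact: measurable_Rplus|exact: mE].
  - by move=> x [Ex Ix]; split=> //; exact: IR.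
apply: (@le_trans _ _ (lam I)).
  apply: le_measure; rewrite ?inE; [|exact: mI|exact: subIsetr].
  by apply: measurableI; [exact: mE|exact: mI].
by rewrite completed_lebesgue_itv /= lte_fin invr_gt0 s0 sube0.
Qed.

Section bound.
(** In the application a is the product of the volume of a cube and that of its dual cube, so that a
    / u_j is the volume of the dual of a cube of volume u_j. *)
Variable a : R.
Hypothesis a01 : (0 < a <= 1)%R.
Local Notation k := (stair N (fun j => c * u j)%R (fun j => a / u j)%R).
Local Notation th := (fun m : nat => a * 4 ^- m.+1)%R.

Let a0 : (0 < a)%R. Proof. by case/andP : a01. Qed.
Let th0 m : (0 < th m)%R. Proof. by rewrite mulr_gt0// invr_gt0 exprn_gt0. Qed.
Let v0 j : (0 <= c * u j)%R. Proof. by rewrite mulr_ge0// ltW. Qed.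
Let b0 j : (0 < a / u j)%R. Proof. by rewrite divr_gt0. Qed.

Lemma sum_min_le_series (s : R) : (0 < s)%R ->
  (\sum_(0 <= j < N) c * Num.min (u j) s^-1)%:E <=
  \sum_(0 <= m <oo) (4 ^- m)%:E * (k (th m * s))%:E.
Proof.
(* M is so large that s u_j < 4^(M+1) for every j < N; then M + 1 terms of the series are enough for
   all layers at once. *)
move=> s0; have [M SM] := exists_exp2_gt (s * \sum_(0 <= j < N) u j)%R.
have suM j : (j < N)%N -> (s * u j < 4 ^+ M.+1)%R.
  move=> jN; apply: (@le_lt_trans _ _ (s * \sum_(0 <= i < N) u i)%R).
    rewrite ler_pM2l// (bigD1_seq j) ?mem_index_iota ?iota_uniq//= lerDl.
    by apply: sumr_ge0 => i _; exact: ltW.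
  apply: (lt_le_trans SM); apply: (@le_trans _ _ (4 ^+ M)%R).
    by rewrite lerXn2r ?nnegrE// ler_nat.
  by rewrite exprS ler_peMl ?exprn_ge0// ler1n.
have T0 m : 0 <= (4 ^- m)%:E * (k (th m * s))%:E.
  by rewrite mule_ge0 ?lee_fin ?invr_ge0 ?exprn_ge0//; exact: layers_ge0.
apply: le_trans (le_partial_nneseries M.+1 T0).
rewrite [leRHS](eq_bigr (fun m => (4 ^- m * k (th m * s))%:E)); last by move=> m _; rewrite EFinM.
rewrite sumEFin lee_fin.
rewrite [leRHS](eq_bigr (fun m => \sum_(0 <= j < N) c * (4 ^- m * (u j * ((s * u j < 4 ^+ m.+1)%R)%:R)))%R); last first.
  move=> m _; rewrite stairE ?mulr_gt0// mulr_sumr; apply: eq_bigr => j _.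
  (* The factor a cancels: the indicator in [min_le_geometric] says that the dilated point lies
     below the j-th jump of the stair. *)
  have -> : (a * 4 ^- m.+1 * s < a / u j)%R = (s * u j < 4 ^+ m.+1)%R.
    rewrite -mulrA ltr_pM2l// -[X in (_ < X)%R]mul1r ltr_pdivlMr// -mulrA.
    by rewrite ltr_pdivrMl ?exprn_gt0// mulr1.
  by ring.
rewrite [leRHS]exchange_big/=; apply: ler_sum_nat => j /andP[_ jN].
rewrite -mulr_sumr; apply: ler_wpM2l => //.
by apply: min_le_geometric => //; exact: suM.
Qed.

Variable rhobar : (R -> \bar R) -> \bar R.
Hypothesis rhobar_ri : ri_norm completed_lebesgue_measure Rplus rhobar.
Variable B : R.
Hypothesis B0 : (0 < B)%R.
Hypothesis BP : forall F G, nonneg_ninc F -> nonneg_ninc G ->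
  (forall t : R, \int[lam]_(x in `]0%R, t]) (G x ^+ 2)%:E < +oo) ->
  (forall t : R, (0 < t)%R -> \int[lam]_(x in `]0%R, t]) (F x ^+ 2)%:E <=
     \int[lam]_(x in `]0%R, t]) (G x ^+ 2)%:E) ->
  rhobar (EFin \o F) <= B%:E * rhobar (EFin \o G).

(** The m-th term costs 4^-m divided by the square root of a 4^-(m+1), that is, 2 2^-m over the
    square root of a. The sum of the 2^-m contributes another 2, whence the 4. *)
Lemma ri_norm_Uop_layers : rhobar (Uop g) <= (4 * B / Num.sqrt a)%:E * rhobar (EFin \o k).
Proof.
have nk : nonneg_ninc k by exact: nonneg_ninc_stair.
have Mk : Mplus lam Rplus (EFin \o k) by exact: Mplus_nonneg_ninc.
have nkt m : nonneg_ninc (fun x => k (th m * x)%R) by exact: nonneg_ninc_dilate.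
have Mkt m : Mplus lam Rplus (EFin \o (fun x => k (th m * x)%R)) by exact: Mplus_nonneg_ninc.
have q0 m : (0 <= 4 ^- m :> R)%R by rewrite invr_ge0 exprn_ge0.
pose F m (x : R) := (4 ^- m)%:E * (k (th m * x))%:E : \bar R.
have MF m : Mplus lam Rplus (F m) by apply: (MplusZ (q0 m)); exact: Mkt.
have X0 : 0 <= rhobar (EFin \o k) by exact: (ri_norm_ge0 rhobar_ri).
have F0 m x : Rplus x -> 0 <= F m x by case: (MF m) => _; exact.
apply: (@le_trans _ _ (rhobar (fun x => \sum_(0 <= m <oo) F m x))).
  apply: (ri_norm_le rhobar_ri).
  - by apply: Uop_ninc; exact: Mplus_layers.
  - split; last by move=> x Rx; apply: nneseries_ge0 => m _ _; exact: F0.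
    apply: ge0_emeasurable_sum => m; first by move=> x Rx _; exact: F0.
    by move=> _; case: (MF m).
  - move=> s; rewrite RplusE => s0.
    exact: (le_trans (Uop_layers_le s0) (sum_min_le_series s0)).
apply: (le_trans (ri_norm_nneseries rhobar_ri MF)).
have sa : (0 < Num.sqrt a)%R by rewrite sqrtr_gt0.
have Y0 : 0 <= (2 * B / Num.sqrt a)%:E * rhobar (EFin \o k).
  by rewrite mule_ge0// lee_fin divr_ge0 ?mulr_ge0// ltW.
have term m : rhobar (F m) <= (2 ^- m)%:E * ((2 * B / Num.sqrt a)%:E * rhobar (EFin \o k)).
  rewrite (ri_normZ_ge0 rhobar_ri (q0 m) (Mkt m)).
  have th01 : (0 < th m <= 1)%R.
    rewrite th0/=; case/andP : a01 => _ a1; apply: mulr_ile1 => //; first exact: ltW.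
    by rewrite invf_le1 ?exprn_gt0// exprn_ege1// ler1n.
  have D := ri_norm_dilation N v0 b0 rhobar_ri BP th01.
  have sth : (Num.sqrt (th m) = Num.sqrt a * 2 ^- m.+1)%R.
    rewrite sqrtrM ?ltW//; congr (_ * _)%R.
    rewrite (_ : 4 ^- m.+1 = (2 ^- m.+1) ^+ 2)%R ?sqrtr_sqr ?ger0_norm ?invr_ge0 ?exprn_ge0//.
    by rewrite exprVn -exprM mulnC exprM; congr (_ ^- _)%R; ring.
  have st0 : (0 < Num.sqrt (th m))%R by rewrite sqrtr_gt0.
  have -> : (4 ^- m)%:E = (2 ^- m * (2 / Num.sqrt a))%:E * (Num.sqrt (th m))%:E.
    rewrite -EFinM; congr EFin; rewrite sth.
    have -> : (4 ^- m = 2 ^- m * 2 ^- m :> R)%R.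
      by rewrite -invfM -exprMn; congr (_ ^- _)%R; ring.
    by rewrite exprS; field; rewrite expf_neq0//= gt_eqF.
  rewrite -muleA; apply: (@le_trans _ _ ((2 ^- m * (2 / Num.sqrt a))%:E * (B%:E * rhobar (EFin \o k)))).
    apply: lee_wpmul2l; last exact: D.
    by rewrite lee_fin mulr_ge0 ?invr_ge0 ?exprn_ge0// divr_ge0// ltW.
  rewrite !muleA -!EFinM le_eqVlt; apply/orP; left; apply/eqP; congr (_%:E * _).
  by field; rewrite expf_neq0//= gt_eqF.
apply: lime_le; first by apply: is_cvg_nneseries => m _ _; exact: (ri_norm_ge0 rhobar_ri).
apply: nearW => M.
apply: (@le_trans _ _ (\sum_(0 <= m < M) (2 ^- m)%:E * ((2 * B / Num.sqrt a)%:E * rhobar (EFin \o k)))).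
  by rewrite !big_mkord; apply: lee_sum => m _; exact: term.
rewrite -ge0_sume_distrl; last by move=> m _; rewrite lee_fin invr_ge0 exprn_ge0.
apply: (@le_trans _ _ (2%:E * ((2 * B / Num.sqrt a)%:E * rhobar (EFin \o k)))).
  apply: lee_wpmul2r => //; apply: le_trans (@nneseries_geometric R).
  by apply: le_partial_nneseries => i; rewrite lee_fin invr_ge0 exprn_ge0.
rewrite muleA -EFinM le_eqVlt; apply/orP; left; apply/eqP; congr (_%:E * _).
by field; rewrite gt_eqF.
Qed.

End bound.
End uop_layers.

Section roots.
Context {R : realType} (n : nat).
Hypothesis n0 : (0 < n)%N.

(** Half the side of the cube of volume u in R^n. *)
Definition half_side (u : R) : R := (u `^ n%:R^-1 / 2)%R.

Lemma half_side_gt0 u : (0 < u)%R -> (0 < half_side u)%R.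
Proof. by move=> u0; rewrite divr_gt0// powR_gt0. Qed.

Lemma half_side_exp u : (0 < u)%R -> ((2 * half_side u) ^+ n)%R = u.
Proof.
move=> u0; rewrite /half_side mulrC divfK ?pnatr_eq0//.
rewrite -powR_mulrn ?powR_ge0// -powRrM mulVf ?pnatr_eq0 -?lt0n//.
by rewrite powRr1// ltW.
Qed.

Lemma half_side_homo u w : (0 < u)%R -> (u <= w)%R -> (half_side u <= half_side w)%R.
Proof.
move=> u0 uw; rewrite ler_pM2r ?invr_gt0//.
by apply: ge0_ler_powR => //; rewrite ?nnegrE ?invr_ge0 ?ler0n// ltW// (lt_le_trans u0).
Qed.

End roots.

(** * Testing the Fourier inequality on layer sums *)

Section necessity_layers.
Context {R : realType} (n : nat).
Hypothesis n0 : (0 < n)%N.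
Local Notation cT := (caratheodory_type (@wlength R idfun)^*%mu).
Local Notation lam := (@completed_lebesgue_measure R : {measure set cT -> \bar R}).
Local Notation cTn := (caratheodory_type ((@borel_lebesgue R n)^*)%mu).
Local Notation L := (lebesgue_tuple R n : {measure set cTn -> \bar R}).
Variables (rho sigma : (n.-tuple R -> \bar R) -> \bar R).
Variables (rhobar sigmabar : (R -> \bar R) -> \bar R).
Hypothesis rho_ri : ri_norm L setT rho.
Hypothesis sigma_ri : ri_norm L setT sigma.
Hypothesis rhobar_ri : ri_norm completed_lebesgue_measure Rplus rhobar.
Hypothesis sigmabar_ri : ri_norm completed_lebesgue_measure Rplus sigmabar.
Hypothesis rhoE : forall f, Mplus L setT f -> rho f = rhobar (rearrangement L setT f).
Hypothesis sigmaE : forall f, Mplus L setT f -> sigma f = sigmabar (rearrangement L setT f).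
Variable B : R.
Hypothesis B0 : (0 < B)%R.
Hypothesis BP : forall F G, nonneg_ninc F -> nonneg_ninc G ->
  (forall t : R, \int[lam]_(x in `]0%R, t]) (G x ^+ 2)%:E < +oo) ->
  (forall t : R, (0 < t)%R -> \int[lam]_(x in `]0%R, t]) (F x ^+ 2)%:E <=
     \int[lam]_(x in `]0%R, t]) (G x ^+ 2)%:E) ->
  rhobar (EFin \o F) <= B%:E * rhobar (EFin \o G).
Variable C : R.
Hypothesis C0 : (0 < C)%R.
Hypothesis CP : forall f : n.-tuple R -> R[i],
  Lspace_of L setT sigma f -> Lspace_of L setT (Lp_norm L setT 1) f ->
  rho (modulus (fourier f)) <= C%:E * sigma (modulus f).

(** Nested families with equal measures have equimeasurable layer sums, so a norm on R^n and the
    norm that determines it agree on them. It is applied to [sigma] on the cubes and to [rho] on the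
    dual cubes. *)
Lemma sigma_transport (v : nat -> R) N (E : nat -> set R) (Q : nat -> set cTn) :
  (forall j, 0 <= v j)%R ->
  (forall i j, (i <= j < N)%N -> E j `<=` E i) ->
  (forall i j, (i <= j < N)%N -> Q j `<=` Q i) ->
  (forall j, measurable (E j : set cT)) -> (forall j, measurable (Q j)) ->
  (forall j, (j < N)%N -> L (setT `&` Q j) = lam (Rplus `&` E j)) ->
  forall tau taubar, ri_norm completed_lebesgue_measure Rplus taubar ->
  (forall f, Mplus L setT f -> tau f = taubar (rearrangement L setT f)) ->
  tau (EFin \o layers N v Q) = taubar (EFin \o layers N v E).
Proof.
move=> v0 nE nQ mE mQ QE tau taubar tri tE.
have MQ : Mplus L setT (EFin \o layers N v Q).
  split; last by move=> x _; rewrite lee_fin layers_ge0.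
  apply/measurable_EFinP; apply: measurable_sum => j; apply: measurable_funM.
    exact: measurable_cst.
  by apply: measurable_indic; exact: mQ.
have ME : Mplus lam Rplus (EFin \o layers N v E) by exact: Mplus_layers.
rewrite tE//; apply: (ri_norm_equimeasurable tri).
- exact: Mplus_rearrangement.
- exact: ME.
- move=> l l0; rewrite (distribution_rearrangement measurableT MQ l0).
  exact: layers_distribution.
Qed.

(** A cube of side 2 r has a dual cube of side 1 / (pi r); this is the product of their volumes. *)
Let a : R := ((2 / pi) ^+ n)%R.

Let a01 : (0 < a <= 1)%R.
Proof.
have p0 := @pi_gt0 R; have p2 := @pi_ge2 R.
rewrite /a exprn_gt0 ?divr_gt0//= exprn_ile1//.
  by rewrite divr_ge0// ltW.
by rewrite ler_pdivrMr// mul1r.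
Qed.

(** The chain is: U g is controlled by the stair k; k is equimeasurable with the layer sum H over
    dual cubes; H is at most (2 / cos 1)^n |hat f|; and f is at most a layer sum over cubes
    equimeasurable with g. The constant does not depend on N, c, u or E. *)
Lemma necessity_layers N (c : R) (u : nat -> R) (E : nat -> set R) :
  (0 <= c)%R -> (forall j, 0 < u j)%R -> (forall i j, (i <= j)%N -> u j <= u i)%R ->
  (forall j, measurable (E j : set cT)) ->
  (forall i j, (i <= j < N)%N -> E j `<=` E i) ->
  (forall j, (j < N)%N -> lam (Rplus `&` E j) = (u j)%:E) ->
  sigmabar (EFin \o layers N (fun=> c) E) < +oo ->
  rhobar (Uop (EFin \o layers N (fun=> c) E)) <=
  (4 * B / Num.sqrt a * ((2 / cos 1) ^+ n * C))%:E * sigmabar (EFin \o layers N (fun=> c) E).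
Proof.
move=> c0 u0 nu mE nE uE sg.
pose r j := half_side n (u j).
have r0 j : (0 < r j)%R by exact: half_side_gt0.
have ru j : ((2 * r j) ^+ n)%R = u j by exact: half_side_exp.
have nr i j : (i <= j)%N -> (r j <= r i)%R.
  by move=> ij; apply: half_side_homo => //; exact: nu.
have cn0 (j : nat) : (0 <= c)%R by [].
pose Q j := @cube R n (r j) : set cTn.
have mQ j : measurable (Q j) by apply: completed_extension_measurable; exact: measurable_cube.
pose f := box_fun N (fun=> c) r : n.-tuple R -> R[i].
have sf : summable L f by exact: summable_box_fun.
have Mf : Mplus L setT (modulus f) by case: sf => cf _; exact: Mplus_modulus.
have MQ : Mplus L setT (EFin \o layers N (fun=> c) Q).
  split; last by move=> x _; rewrite lee_fin layers_ge0.
  apply/measurable_EFinP; apply: measurable_sum => j; apply: measurable_funM.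
    exact: measurable_cst.
  by apply: measurable_indic; exact: mQ.
have sf_le : sigma (modulus f) <= sigmabar (EFin \o layers N (fun=> c) E).
  rewrite -(sigma_transport (tau := sigma) (Q := Q) cn0 nE _ mE mQ _ sigmabar_ri sigmaE).
  - apply: (ri_norm_le sigma_ri Mf MQ) => x _.
    have -> : modulus f x = (box_sum N (fun=> c) r x)%:E by exact: modulus_box_fun.
    by rewrite lee_fin; exact: box_sum_le.
  - move=> i j /andP[ij _] x Qx k; exact: le_trans (Qx k) (nr _ _ ij).
  - by move=> j jN; rewrite setTI uE// -ru; exact: lebesgue_tuple_cube.
have fC : rho (modulus (fourier f)) <= C%:E * sigma (modulus f).
  apply: CP; first by case: sf => cf _; split=> //; exact: le_lt_trans sf_le sg.
  by apply/summable_Lspace.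
pose k := stair N (fun j => c * u j)%R (fun j => a / u j)%R.
have step1 : rhobar (Uop (EFin \o layers N (fun=> c) E)) <=
    (4 * B / Num.sqrt a)%:E * rhobar (EFin \o k).
  exact: (ri_norm_Uop_layers c0 u0 mE uE a01 rhobar_ri B0 BP).
pose P j := @cube R n ((2 * pi * r j)^-1) : set cTn.
have p0 := @pi_gt0 R.
have q0 j : (0 < 2 * pi * r j)%R by exact: (mulr_gt0 (mulr_gt0 (ltr0Sn R 1) p0) (r0 j)).
have w0 j : (0 < (2 * pi * r j)^-1)%R by rewrite invr_gt0.
have mP j : measurable (P j) by apply: completed_extension_measurable; exact: measurable_cube.
pose v j := (c * (2 * r j) ^+ n)%R.
have v0 j : (0 <= v j)%R by rewrite mulr_ge0// exprn_ge0// mulr_ge0// ltW.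
pose H := layers N v P.
have MH : Mplus L setT (EFin \o H).
  split; last by move=> x _; rewrite lee_fin layers_ge0.
  apply/measurable_EFinP; apply: measurable_sum => j; apply: measurable_funM.
    exact: measurable_cst.
  by apply: measurable_indic; exact: mP.
have HE : rho (EFin \o H) = rhobar (EFin \o k).
  have -> : EFin \o H = EFin \o layers N (fun j => v (N - j.+1)%N) (fun j => P (N - j.+1)%N).
    by apply/funext => x; rewrite /= /H layers_rev.
  have -> : EFin \o k = EFin \o layers N (fun j => v (N - j.+1)%N)
      (fun j => `]0%R, (a / u (N - j.+1)%N)%R[%classic).
    apply/funext => x; rewrite /= /k /stair layers_rev; congr EFin.
    by apply: eq_bigr => j _; rewrite /v ru.
  apply: (sigma_transport _ _ _ _ _ _ rhobar_ri rhoE).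
  - by move=> j; exact: v0.
  - move=> i j /andP[ij jN] x; rewrite /= !in_itv/= => /andP[-> /lt_le_trans]; apply.
    have /andP[a0 _] := a01.
    by rewrite ler_pM2l// lef_pV2 ?posrE//; apply: nu; exact: leq_sub2l.
  - move=> i j /andP[ij jN] x Px l; apply: (le_trans (Px l)).
    rewrite lef_pV2 ?posrE; [|exact: q0|exact: q0].
    rewrite (ler_pM2l (mulr_gt0 (ltr0Sn R 1) p0)); apply: nr; exact: leq_sub2l.
  - by move=> j; exact: completed_measurable_itv.
  - by move=> j; exact: mP.
  - move=> j jN; rewrite setTI.
    have -> : Rplus `&` `]0%R, (a / u (N - j.+1)%N)%R[%classic = `]0%R, (a / u (N - j.+1)%N)%R[%classic.
      by apply: setIidr => x; rewrite /= in_itv/= RplusE => /andP[].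
    have /andP[a0 _] := a01.
    rewrite completed_lebesgue_itv /= lte_fin divr_gt0// sube0.
    rewrite lebesgue_tuple_cube//; congr EFin; rewrite -[in RHS]ru /a -exprVn -exprMn.
    have aux (p w : R) : (0 < p)%R -> (0 < w)%R -> (2 * (2 * p * w)^-1 = 2 / p / (2 * w))%R.
      by move=> p1 w1; field; rewrite !gt_eqF.
    by congr (_ ^+ _)%R; exact: aux.
have cos0 := @cos1_gt0 R.
have step2 : rhobar (EFin \o k) <= ((2 / cos 1) ^+ n)%:E * rho (modulus (fourier f)).
  have MF := Mplus_modulus (cmeasurable_fourier sf).
  have d0 : (0 <= (2 / cos 1) ^+ n :> R)%R by rewrite exprn_ge0// divr_ge0// ltW.
  rewrite -HE -(ri_normZ_ge0 rho_ri d0 MF); apply: (ri_norm_le rho_ri MH).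
    exact: MplusZ.
  move=> xi _; rewrite -EFinM lee_fin.
  have := @normc_fourier_box_fun R n N (fun=> c) r cn0 r0 xi; rewrite -/f => h.
  rewrite [leLHS](_ : _ = (2 / cos 1) ^+ n * ((cos 1 / 2) ^+ n * H xi))%R.
    by apply: ler_wpM2l.
  rewrite mulrA -exprMn (_ : 2 / cos 1 * (cos 1 / 2) = 1)%R ?expr1n ?mul1r//.
  by field; rewrite gt_eqF.
have /andP[a0 _] := a01.
have K1 : 0 <= (4 * B / Num.sqrt a)%:E.
  by rewrite lee_fin divr_ge0 ?sqrtr_ge0// mulr_ge0// ltW.
have K2 : 0 <= ((2 / cos 1) ^+ n : R)%:E by rewrite lee_fin exprn_ge0// divr_ge0// ltW.
apply: (le_trans step1); rewrite [X in _ <= X * _]EFinM -muleA.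
apply: lee_wpmul2l; first exact: K1.
apply: (le_trans step2); rewrite EFinM -muleA.
apply: lee_wpmul2l; first exact: K2.
apply: (le_trans fC); apply: lee_wpmul2l; first by rewrite lee_fin ltW.
exact: sf_le.
Qed.

End necessity_layers.

(** * Approximation by finite layer sums *)

Section approximation.
Context {R : realType}.
Local Notation cT := (caratheodory_type (@wlength R idfun)^*%mu).
Local Notation lam := (@completed_lebesgue_measure R : {measure set cT -> \bar R}).
Variable g : R -> \bar R.
Hypothesis Mg : Mplus lam Rplus g.

Let mI (i : interval R) : measurable ([set` i] : set cT).
Proof. exact: completed_measurable_itv. Qed.

(** The intersection with (0, m] gives every level finite measure, so that a cube of the same volume
    exists. *)
Definition level (m j : nat) : set R :=
  (Rplus `&` [set x | (j.+1%:R / 2 ^+ m)%:E < g x]) `&` `]0%R, (m%:R)%R].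

Lemma measurable_level m j : measurable (level m j : set cT).
Proof.
apply: measurableI; last exact: mI.
exact: (measurable_superlevel measurable_Rplus (j.+1%:R / 2 ^+ m)%:E Mg).
Qed.

Lemma level_nested m i j : (i <= j)%N -> level m j `<=` level m i.
Proof.
move=> ij x [[Rx gx] xm]; split=> //; split=> //.
move: gx; rewrite /mkset; apply: le_lt_trans; rewrite lee_fin ler_pM2r ?invr_gt0 ?exprn_gt0//.
by rewrite ler_nat ltnS.
Qed.

Lemma lam_level_lty m j : lam (Rplus `&` level m j) < +oo.
Proof.
apply: (@le_lt_trans _ _ (lam (`]0%R, (m%:R)%R]%classic : set cT))).
  apply: le_measure; rewrite ?inE; [|exact: mI|by move=> x [_ []]].
  by apply: measurableI; [exact: measurable_Rplus|exact: measurable_level].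
by rewrite completed_lebesgue_itv /=; case: ifP => _; rewrite ?sube0 ltry.
Qed.

Definition approx (m : nat) : R -> \bar R :=
  EFin \o layers (m * 2 ^ m) (fun=> 2 ^- m)%R (level m).

Lemma approxE m x : Rplus x ->
  approx m x = (staircase m (g x) * ((x <= m%:R)%R)%:R)%:E.
Proof.
move=> Rx; congr EFin; rewrite /layers /staircase mulr_suml; apply: eq_bigr => j _.
rewrite -mulrA; congr (_ * _)%R; rewrite -natrM mulnb indicE; congr (nat_of_bool _)%:R.
apply/idP/idP; rewrite inE.
  by move=> [[_ gx] xm]; move: gx xm; rewrite /mkset/= in_itv/= => -> /andP[_ ->].
move=> /andP[gx xm]; split; first by split.
by rewrite /= in_itv/= xm andbT -RplusE.
Qed.

Lemma Mplus_approx m : Mplus lam Rplus (approx m).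
Proof.
apply: Mplus_layers; first exact: measurable_level.
by move=> j; rewrite invr_ge0 exprn_ge0.
Qed.

Lemma approx_nondecreasing x : Rplus x -> nondecreasing_seq (approx ^~ x).
Proof.
move=> Rx m m' mm'; rewrite !approxE// lee_fin ler_pM ?staircase_ge0//.
  exact: staircase_homo.
by rewrite ler_nat; case: (leP x m%:R) => // xm; rewrite (le_trans xm)// ler_nat.
Qed.

Lemma cvg_approx x : Rplus x -> approx m x @[m --> \oo] --> g x.
Proof.
move=> Rx; have gx0 : 0 <= g x by case: Mg => _; exact.
apply: cvg_trans (cvg_staircase gx0); apply: near_eq_cvg.
exists (Num.bound x) => // m /= xm; rewrite approxE//.
rewrite (_ : (x <= m%:R)%R = true) ?mulr1//; apply/ltW.
apply: (lt_le_trans (archi_boundP (ltW _))); first by rewrite -RplusE.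
by rewrite ler_nat.
Qed.

Lemma approx_le m x : Rplus x -> approx m x <= g x.
Proof.
move=> Rx; have := cvg_approx Rx => /cvg_lim <-; last exact: ereal_hausdorff.
rewrite (cvg_lim _ (ereal_nondecreasing_cvgn (approx_nondecreasing Rx))).
  by apply: ereal_sup_ubound; exists m.
exact: ereal_hausdorff.
Qed.

Let IR (s : R) : `]0%R, (s^-1)%R[%classic `<=` @Rplus R.
Proof. by move=> x; rewrite /= in_itv/= RplusE => /andP[]. Qed.

Lemma UopE (h : R -> \bar R) s : Uop h s = \int[lam]_(x in `]0%R, (s^-1)%R[) h x.
Proof.
by rewrite /Uop; congr (integral _ _ _); apply/seteqP; split=> x; rewrite /= in_itv.
Qed.

Lemma Uop_approx_nondecreasing s : nondecreasing_seq (fun m => Uop (approx m) s).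
Proof.
move=> m m' mm'; rewrite !UopE; apply: ge0_le_integral; [exact: mI| | | |].
- by move=> x /IR Rx; case: (Mplus_approx m) => _; exact.
- by case: (Mplus_approx m) => ma _; exact: (measurable_funS measurable_Rplus (@IR s) ma).
- by case: (Mplus_approx m') => ma _; exact: (measurable_funS measurable_Rplus (@IR s) ma).
- by move=> x /IR Rx; exact: approx_nondecreasing.
Qed.

Lemma cvg_Uop_approx s : Uop (approx m) s @[m --> \oo] --> Uop g s.
Proof.
rewrite UopE.
have := @cvg_monotone_convergence _ cT R lam _ (mI _) (fun m => approx m)
  (fun m => measurable_funS measurable_Rplus (@IR s) (proj1 (Mplus_approx m)))
  (fun m x Ix => proj2 (Mplus_approx m) x (IR Ix))
  (fun x Ix => approx_nondecreasing (IR Ix)).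
rewrite (_ : \int[lam]_(x in `]0%R, (s^-1)%R[) limn (approx ^~ x) =
    \int[lam]_(x in `]0%R, (s^-1)%R[) g x); last first.
  apply: eq_integral => x; rewrite inE => /IR Rx.
  by apply/cvg_lim; [exact: ereal_hausdorff|exact: cvg_approx].
apply: cvg_trans; rewrite (_ : (fun m => Uop (approx m) s) = fun m => \int[lam]_(x in `]0%R, (s^-1)%R[) approx m x) //.
Qed.

End approximation.

Section null_layers.
Context {R : realType}.
Local Notation cT := (caratheodory_type (@wlength R idfun)^*%mu).
Local Notation lam := (@completed_lebesgue_measure R : {measure set cT -> \bar R}).
Variables (c : R) (E : nat -> set R) (N : nat).
Hypothesis c0 : (0 <= c)%R.
Hypothesis mE : forall j, measurable (E j : set cT).

Lemma Uop_null_layer : lam (Rplus `&` E N) = 0 ->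
  Uop (EFin \o layers N.+1 (fun=> c) E) = Uop (EFin \o layers N (fun=> c) E).
Proof.
move=> EN0; apply/funext => s; rewrite !UopE.
have IR : `]0%R, (s^-1)%R[%classic `<=` @Rplus R.
  by move=> x; rewrite /= in_itv/= RplusE => /andP[].
have mI : measurable (`]0%R, (s^-1)%R[%classic : set cT) by exact: completed_measurable_itv.
have cn (j : nat) : (0 <= c)%R by [].
have [mN N0] := Mplus_layers N mE cn.
have m1 : measurable_fun (`]0%R, (s^-1)%R[%classic : set cT) (fun x => (\1_(E N) x)%:E : \bar R).
  by apply/measurable_EFinP; apply: measurable_indic; exact: mE.
transitivity (\int[lam]_(x in `]0%R, (s^-1)%R[)
    ((EFin \o layers N (fun=> c) E) x + c%:E * (\1_(E N) x)%:E)).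
  by apply: eq_integral => x _; rewrite /= /layers big_nat_recr//= EFinD EFinM.
rewrite ge0_integralD; first last.
- exact: measurable_funeM.
- by move=> x _; rewrite mule_ge0// lee_fin indicE ler0n.
- exact: (measurable_funS measurable_Rplus IR mN).
- by move=> x /IR; exact: N0.
- exact: mI.
rewrite ge0_integralZl; first last.
- by rewrite lee_fin.
- by move=> x _; rewrite lee_fin indicE ler0n.
- exact: m1.
- exact: mI.
rewrite integral_indic; [|exact: mI|exact: mE].
rewrite (_ : lam _ = 0) ?mule0 ?adde0//; apply/eqP; rewrite eq_le measure_ge0 andbT -EN0.
apply: le_measure; rewrite ?inE.
- by apply: measurableI; [exact: mE|exact: mI].
- by apply: measurableI; [exact: measurable_Rplus|exact: mE].
- by move=> x [Ex /IR Rx].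
Qed.

End null_layers.

(** * The inequality for U *)

Section necessity.
Context {R : realType} (n : nat).
Hypothesis n0 : (0 < n)%N.
Local Notation cT := (caratheodory_type (@wlength R idfun)^*%mu).
Local Notation lam := (@completed_lebesgue_measure R : {measure set cT -> \bar R}).
Local Notation cTn := (caratheodory_type ((@borel_lebesgue R n)^*)%mu).
Local Notation L := (lebesgue_tuple R n : {measure set cTn -> \bar R}).
Variables (rho sigma : (n.-tuple R -> \bar R) -> \bar R).
Variables (rhobar sigmabar : (R -> \bar R) -> \bar R).
Hypothesis rho_ri : ri_norm L setT rho.
Hypothesis sigma_ri : ri_norm L setT sigma.
Hypothesis rhobar_ri : ri_norm completed_lebesgue_measure Rplus rhobar.
Hypothesis sigmabar_ri : ri_norm completed_lebesgue_measure Rplus sigmabar.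
Hypothesis rhoE : forall f, Mplus L setT f -> rho f = rhobar (rearrangement L setT f).
Hypothesis sigmaE : forall f, Mplus L setT f -> sigma f = sigmabar (rearrangement L setT f).
Hypothesis interp : interpolation_space completed_lebesgue_measure Rplus
  (Lp_norm completed_lebesgue_measure Rplus 2%:E)
  (Lp_norm completed_lebesgue_measure Rplus +oo) rhobar.

(** The constant for layer sums is independent of the layers, so the Fatou property carries the
    inequality along the monotone approximations of g. *)
Lemma necessity :
  (exists2 C : R, (0 < C)%R & forall f : n.-tuple R -> R[i],
    Lspace_of L setT sigma f -> Lspace_of L setT (Lp_norm L setT 1) f ->
    rho (modulus (fourier f)) <= C%:E * sigma (modulus f)) ->
  exists2 C : R, (0 < C)%R & forall g : R -> \bar R,
    Mplus completed_lebesgue_measure Rplus g -> sigmabar g < +oo ->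
    rhobar (Uop g) <= C%:E * sigmabar g.
Proof.
move=> [C C0 CP]; have [B B0 BP] := interpolation_monotone rhobar_ri interp.
have p0 := @pi_gt0 R; have cos0 := @cos1_gt0 R.
pose K : R := (4 * B / Num.sqrt ((2 / pi) ^+ n) * ((2 / cos 1) ^+ n * C))%R.
have K0 : (0 < K)%R.
  have h1 : (0 < (2 / pi) ^+ n :> R)%R by rewrite exprn_gt0// divr_gt0.
  have h2 : (0 < (2 / cos 1) ^+ n :> R)%R by rewrite exprn_gt0// divr_gt0.
  apply: mulr_gt0; last exact: mulr_gt0.
  by rewrite divr_gt0 ?sqrtr_gt0// mulr_gt0.
exists K => // g Mg sg.
have Ma := Mplus_approx Mg.
have layered (c : R) (E : nat -> set R) N : (0 <= c)%R ->
    (forall j, measurable (E j : set cT)) -> (forall i j, (i <= j)%N -> E j `<=` E i) ->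
    (forall j, lam (Rplus `&` E j) < +oo) ->
    sigmabar (EFin \o layers N (fun=> c) E) < +oo ->
    rhobar (Uop (EFin \o layers N (fun=> c) E)) <=
    K%:E * sigmabar (EFin \o layers N (fun=> c) E).
  move=> c0 mE nE Efin; have cn (j : nat) : (0 <= c)%R by [].
  have ML M : Mplus lam Rplus (EFin \o layers M (fun=> c) E) by exact: Mplus_layers.
  have mRE j : measurable (Rplus `&` E j : set cT).
    by apply: measurableI; [exact: measurable_Rplus|exact: mE].
  elim: N => [|N IH] sN.
    have -> : rhobar (Uop (EFin \o layers 0 (fun=> c) E)) = 0.
      rewrite -(ri_norm0 rhobar_ri); congr rhobar; apply/funext => s.
      by rewrite UopE; apply: integral0_eq => x _; rewrite /= /layers big_geq.
    by apply: mule_ge0; [rewrite lee_fin ltW|exact: (ri_norm_ge0 sigmabar_ri)].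
  have mono : sigmabar (EFin \o layers N (fun=> c) E) <= sigmabar (EFin \o layers N.+1 (fun=> c) E).
    apply: (ri_norm_le sigmabar_ri (ML N) (ML N.+1)) => x _.
    by rewrite lee_fin /layers big_nat_recr//= lerDl mulr_ge0// indicE ler0n.
  (* A null last layer is dropped and the induction hypothesis applies; otherwise, by nesting, all
     layers have positive measure. *)
  have [EN|EN] := eqVneq (lam (Rplus `&` E N)) 0.
    rewrite Uop_null_layer//; apply: (le_trans (IH (le_lt_trans mono sN))).
    by apply: lee_wpmul2l => //; rewrite lee_fin ltW.
  have EN0 : 0 < lam (Rplus `&` E N) by rewrite lt0e EN measure_ge0.
  (* Beyond N the sequence is frozen at its last value, so that it stays positive and nonincreasing
     for all j. *)
  pose u j := fine (lam (Rplus `&` E (minn j N))).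
  have uE j : (u j)%:E = lam (Rplus `&` E (minn j N)).
    by rewrite /u fineK// ge0_fin_numE ?measure_ge0.
  apply: (necessity_layers n0 rho_ri sigma_ri rhobar_ri sigmabar_ri rhoE sigmaE B0 BP C0 CP c0
    (u := u)).
  - move=> j; rewrite -lte_fin uE; apply: (lt_le_trans EN0).
    apply: le_measure; rewrite ?inE; [exact: mRE|exact: mRE|].
    by apply: setIS; apply: nE; exact: geq_minr.
  - move=> i j ij; rewrite -lee_fin !uE.
    apply: le_measure; rewrite ?inE; [exact: mRE|exact: mRE|].
    by apply: setIS; apply: nE; rewrite leq_min geq_minr andbT (leq_trans (geq_minl _ _)).
  - exact: mE.
  - by move=> i j /andP[ij _]; exact: nE.
  - by move=> j; rewrite ltnS uE => /minn_idPl ->.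
  - exact: sN.
have am m : rhobar (Uop (approx g m)) <= K%:E * sigmabar g.
  have le : sigmabar (approx g m) <= sigmabar g.
    by apply: (ri_norm_le sigmabar_ri (Ma m) Mg) => x; exact: approx_le.
  apply: (@le_trans _ _ (K%:E * sigmabar (approx g m))).
    apply: layered.
    - by rewrite invr_ge0 exprn_ge0.
    - exact: measurable_level.
    - by move=> i j; exact: level_nested.
    - exact: lam_level_lty.
    - exact: le_lt_trans le sg.
  by apply: lee_wpmul2l => //; rewrite lee_fin ltW.
have [_ cv] := ri_norm_fatou rhobar_ri (F := fun m => Uop (approx g m)) (f := Uop g)
  (fun m => Uop_ninc (Ma m)) (Uop_ninc Mg)
  (fun s _ => Uop_approx_nondecreasing Mg s) (fun s _ => @cvg_Uop_approx R g Mg s).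
rewrite -(cvg_lim _ cv); last exact: ereal_hausdorff.
by apply: lime_le; [apply/cvg_ex; exists (rhobar (Uop g))|exact: nearW].
Qed.

End necessity.

Theorem theorem4p1 (R : realType) (n : nat) (n_gt0 : (0 < n)%N)
    (rho sigma : (n.-tuple R -> \bar R) -> \bar R)
    (rhobar sigmabar : (R -> \bar R) -> \bar R)
    (rho_ri : ri_norm (lebesgue_tuple R n) setT rho)
    (sigma_ri : ri_norm (lebesgue_tuple R n) setT sigma)
    (rhobar_ri : ri_norm completed_lebesgue_measure Rplus rhobar)
    (sigmabar_ri : ri_norm completed_lebesgue_measure Rplus sigmabar)
    (rhoE : forall f, Mplus (lebesgue_tuple R n) setT f ->
      rho f = rhobar (rearrangement (lebesgue_tuple R n) setT f))
    (sigmaE : forall f, Mplus (lebesgue_tuple R n) setT f ->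
      sigma f = sigmabar (rearrangement (lebesgue_tuple R n) setT f))
    (rhobar_interpolation :
      interpolation_space completed_lebesgue_measure Rplus
        (Lp_norm completed_lebesgue_measure Rplus 2%:E)
        (Lp_norm completed_lebesgue_measure Rplus +oo) rhobar) :
  (exists2 C : R, (0 < C)%R &
     forall f : n.-tuple R -> R[i],
       Lspace_of (lebesgue_tuple R n) setT sigma f ->
       Lspace_of (lebesgue_tuple R n) setT
         (Lp_norm (lebesgue_tuple R n) setT 1) f ->
       rho (modulus (fourier f)) <= C%:E * sigma (modulus f))
  <->
  (exists2 C : R, (0 < C)%R &
     forall g : R -> \bar R,
       Mplus completed_lebesgue_measure Rplus g -> sigmabar g < +oo ->
       rhobar (Uop g) <= C%:E * sigmabar g).
Proof.
split.
- exact: (necessity n_gt0 rho_ri sigma_ri rhobar_ri sigmabar_ri rhoE sigmaE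
    rhobar_interpolation).
- exact: (sufficiency rhobar_ri rhoE sigmaE rhobar_interpolation).
Qed.
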